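(* Let $X=(X_n)_{n\in\mathbb Z}$ be a stationary renewal process whose jump distribution is non-lattice and has exponential tails. Then $X$ is a finitary factor of an i.i.d.\ process, with a coding window which has exponential tails.
   Context: A (discrete) renewal process is a $\{0,1\}$-valued process $X=(X_n)_{n\in\mathbb Z}$ with infinitely many 1's in both directions such that the distances between consecutive 1's are i.i.d.; their common law, a distribution $T$ on the positive integers, is the jump distribution. A positive-integer-valued random variable $T$ is non-lattice if $\gcd\{t:\mathbb P(T=t)>0\}=1$, and has exponential tails if there are $C,c>0$ with $\mathbb P(T\ge t)\le Ce^{-ct}$ for all $t\ge1$. A process $X$ is a factor of $Y=(Y_n)_{n\in\mathbb Z}$ if $X_n=\varphi(\dots,Y_{n-1},Y_n,Y_{n+1},\dots)$ for a measurable, shift-equivariant $\varphi$; it is finitary if there is an almost surely finite stopping time $R$ for the filtration $\mathcal F_r=\sigma(Y_n:|n|\le r)$ such that $X_0$ is $\mathcal F_R$-measurable ($R$ is a coding window). The coding window has exponential tails if $\mathbb P(R\ge r)\le Ce^{-cr}$ for some $C,c>0$ and all $r\ge1$. *)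

(* Defs.v *)
From HB Require Import structures.
From mathcomp Require Import all_boot all_order all_algebra.
From mathcomp Require Import all_classical all_reals all_analysis.
Set Implicit Arguments. Unset Strict Implicit. Unset Printing Implicit Defensive.
Import Order.TTheory GRing.Theory Num.Theory.
Import numFieldNormedType.Exports.
Local Open Scope classical_set_scope.
Local Open Scope ring_scope.

Definition jump_distribution (R : realType) (p : nat -> R) : Prop :=
  p 0%N = 0 /\ (forall t, 0 <= p t) /\
  ((fun n => \sum_(t < n) p t) @ \oo --> (1 : R)).

Definition non_lattice (R : realType) (p : nat -> R) : Prop :=
  forall d : nat, (forall t : nat, 0 < p t -> (d %| t)%N) -> d = 1%N.

Definition exp_tails (R : realType) (p : nat -> R) : Prop :=
  exists C c : R, 0 < C /\ 0 < c /\
    forall t : nat, (1 <= t)%N -> 1 - \sum_(s < t) p s <= C * expR (- c * t%:R).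

Definition cyl (Omega : Type) (X : int -> Omega -> bool) (cs : seq (int * bool))
  : set Omega := [set w | all (fun c => X c.1 w == c.2) cs].

Definition stationary d (Omega : measurableType d) (R : realType)
  (P : probability Omega R) (X : int -> Omega -> bool) : Prop :=
  forall (m : int) (cs : seq (int * bool)),
    P (cyl (fun n => X (n + m)) cs) = P (cyl X cs).

Definition first_one_at (Omega : Type) (X : int -> Omega -> bool)
  (m : int) (a : nat) : set Omega :=
  [set w | (forall k : nat, (k < a)%N -> X (m + k%:Z) w = false) /\
           X (m + a%:Z) w = true].

Definition gaps_after (Omega : Type) (X : int -> Omega -> bool)
  (m : int) (a : nat) (ts : seq nat) : set Omega :=
  first_one_at X m a `&`
  [set w | forall k : nat, (0 < k <= \sum_(t <- ts) t)%N ->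
             X (m + a%:Z + k%:Z) w = (k \in scanl addn 0%N ts)].

(* Renewal process with jump distribution p: infinitely many 1's in both
   directions (a.s.), and the distances between consecutive 1's are i.i.d.
   with law p: starting from the first 1 at or after any position m, the
   successive gaps are i.i.d. with law p (and independent of the location
   of that first 1). *)
Definition renewal_process d (Omega : measurableType d) (R : realType)
  (P : probability Omega R) (X : int -> Omega -> bool) (p : nat -> R) : Prop :=
  (forall n, measurable [set w | X n w]) /\
  {ae P, forall w, forall N : nat,
      (exists n : int, N%:Z <= n /\ X n w) /\
      (exists n : int, n <= - N%:Z /\ X n w)} /\
  (forall (m : int) (a : nat) (ts : seq nat), all (fun t => 0 < t)%N ts ->
      P (gaps_after X m a ts) =
      (P (first_one_at X m a) * \big[*%E/1%E]_(t <- ts) (p t)%:E)%E).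

Definition stationary_renewal_process d (Omega : measurableType d) (R : realType)
  (P : probability Omega R) (X : int -> Omega -> bool) (p : nat -> R) : Prop :=
  jump_distribution p /\ stationary P X /\ renewal_process P X p.

Definition iid_process d (Omega : measurableType d) (R : realType)
  (P : probability Omega R) dS (S : measurableType dS)
  (Y : int -> Omega -> S) : Prop :=
  (forall n, measurable_fun setT (Y n)) /\
  (forall n (A : set S), measurable A -> P (Y n @^-1` A) = P (Y 0 @^-1` A)) /\
  (forall (ns : seq int) (A : int -> set S), uniq ns ->
     (forall n, measurable (A n)) ->
     P (\bigcap_(n in [set` ns]) (Y n @^-1` A n)) =
     \big[*%E/1%E]_(n <- ns) P (Y n @^-1` A n)).

Definition prodZ_measurable dS (S : measurableType dS) : set (set (int -> S)) :=
  <<s \bigcup_(n in [set: int])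
        preimage_set_system setT (fun y : int -> S => y n) measurable >>.

(* coding radius: None = infinite *)
Definition win_le (o : option nat) (r : nat) : bool :=
  if o is Some s then (s <= r)%N else false.
Definition win_ge (o : option nat) (r : nat) : bool :=
  if o is Some s then (r <= s)%N else true.

(* phi : S^Z -> {0,1} is the value at 0 of a shift-equivariant factor map,
   rho : S^Z -> N u {oo} is a coding window: {rho <= r} and, on it, the
   value phi are determined by the coordinates in [-r, r]
   (i.e. rho is a stopping time for F_r = sigma(y_n : |n| <= r) and
   phi is F_rho-measurable). *)
Definition coding_window dS (S : measurableType dS)
  (phi : (int -> S) -> bool) (rho : (int -> S) -> option nat) : Prop :=
  prodZ_measurable [set y | phi y] /\
  (forall r : nat, prodZ_measurable [set y | rho y = Some r]) /\
  (forall (r : nat) (y y' : int -> S),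
     (forall k : int, `|k| <= r%:Z -> y k = y' k) ->
     (win_le (rho y) r = win_le (rho y') r) /\
     (win_le (rho y) r -> phi y = phi y')).

Definition finitary_factor_of_iid_exp_tails d (Omega : measurableType d)
  (R : realType) (P : probability Omega R) (X : int -> Omega -> bool) : Prop :=
  exists (d' : measure_display) (Omega' : measurableType d')
         (P' : probability Omega' R) (dS : measure_display)
         (S : measurableType dS) (Y : int -> Omega' -> S)
         (phi : (int -> S) -> bool) (rho : (int -> S) -> option nat),
    iid_process P' Y /\
    coding_window phi rho /\
    (forall cs : seq (int * bool),
       P' (cyl (fun n w => phi (fun k => Y (n + k) w)) cs) = P (cyl X cs)) /\
    P' [set w | rho (fun k => Y k w) = None] = 0%E /\
    (exists C c : R, 0 < C /\ 0 < c /\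
       forall r : nat, (1 <= r)%N ->
         (P' [set w | win_ge (rho (fun k => Y k w)) r] <=
          (C * expR (- c * r%:R))%:E)%E).

(* Main.v *)
Require Import Defs.
From HB Require Import structures.
From mathcomp Require Import all_boot all_order all_algebra.
From mathcomp Require Import all_classical all_reals all_analysis.
From mathcomp Require Import zify ring lra.

(** Fix i.i.d. bits with success probability [dl], and call time [n] marked when
    the bits at [n-m+1, ..., n] read [0 ... 0 1].  The marked times form a renewal
    process that is visible through finite windows.  When [dl] is small, the law
    [q] of its gaps has such slowly varying tails that it can be embedded in the
    random walk with jumps [p]: there is a randomized stopping time [tau] of the
    walk such that the stopped position has law [q].  Existence amounts to
    nonnegativity of the solution [w] of [w = delta_0 + p * w - q], where [w n] is
    the mass that visits [n] unstopped.  Because [p] has exponential tails, a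
    positive proportion of the surviving mass lies at a bounded distance behind
    [n], and because [p] is non-lattice a positive proportion of that mass reaches
    [n], which for small [dl] outweighs the mass stopped on the way.

    Now fill each gap [g] of the marked times with the path of the walk
    conditioned to stop at [g], using randomness carried by the right end of the
    gap.  Concatenating independent stopped paths gives i.i.d. jumps of law [p],
    so the filled process is the stationary renewal process; its value at [0] is
    known as soon as a marked time has been seen on both sides of [0]. *)

Set Implicit Arguments. Unset Strict Implicit. Unset Printing Implicit Defensive.
Import Order.TTheory GRing.Theory Num.Theory.
Import numFieldNormedType.Exports.
Local Open Scope classical_set_scope.
Local Open Scope ring_scope.

(** A pattern of length [m] is used because no gap is then shorter than [m]: the walk runs freely
    below [m], and what is stopped at one site is [a] times an earlier value of [gap_tail], with
    [a <= dl]. This lets the constants be chosen without circularity. The rate of decay of [p] gives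
    [r], its constant [C] then gives a window length [K], the non-lattice condition gives [L], and
    the walk alone gives the constants [eta] and [B] for bridging distances up to [L + K]. All of
    them are fixed before [m] and [dl], so [dl] can be made small enough that stopping does not use
    up the mass that [eta] guarantees. Exponential tails enter through a comparison of rates:
    [jump_tail] is bounded by powers of [r ^+ 2], while [gap_tail] loses at most a factor [r] per
    step, so mass far behind contributes little.

    The law of the coded process is identified by comparison. Both processes give words containing a
    1 probabilities proportional to their density of ones, with coefficients that depend on [p]
    only; since long windows almost surely show a 1, the densities agree. *)

(* Course-of-values recursion: [f] receives the list of all previous values. *)
Fixpoint history (T : Type) (f : seq T -> T) (n : nat) : seq T :=
  if n is n'.+1 then rcons (history f n') (f (history f n')) else [::].

Definition cov_rec (T : Type) (f : seq T -> T) (n : nat) : T := f (history f n).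

Lemma cov_recE (T : Type) (f : seq T -> T) n :
  cov_rec f n = f (mkseq (cov_rec f) n).
Proof.
rewrite {1}/cov_rec; congr f.
by elim: n => [//|n IH] /=; rewrite mkseqS -IH.
Qed.

(** * Reachable positions of the walk and the non-lattice condition *)

Inductive reach (R : realType) (p : nat -> R) : nat -> Prop :=
| reach0 : reach p 0
| reachS j t : reach p j -> 0 < p t -> reach p (j + t).

Section Reach.
Variables (R : realType) (p : nat -> R).

Lemma reachD i j : reach p i -> reach p j -> reach p (i + j).
Proof.
move=> ri; elim=> [|k t _ IH pt]; first by rewrite addn0.
by rewrite addnA; apply: reachS.
Qed.

Lemma reachM k i : reach p i -> reach p (k * i).
Proof.
move=> ri; elim: k => [|k IH]; first by rewrite mul0n; apply: reach0.
by rewrite mulSn; apply: reachD.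
Qed.

Lemma reach1 t : 0 < p t -> reach p t.
Proof. by move=> pt; rewrite -[t]add0n; apply: reachS => //; apply: reach0. Qed.

(** The least positive difference [d] between reachable positions divides every jump [t]:
    [t %/ d * (x + d)] and [t %/ d * x + t] are both reachable and differ by [t %% d], which
    minimality forces to be 0. The non-lattice condition then gives [d = 1]. *)
Lemma reach_consecutive : p 0%N = 0 -> non_lattice p -> (exists t, 0 < p t) ->
  exists x, reach p x /\ reach p x.+1.
Proof.
move=> p0 nl [t0 pt0].
pose D d := `[< (0 < d)%N /\ exists x, reach p x /\ reach p (x + d) >].
have exD : exists d, D d.
  exists t0; apply/asboolP; split.
    by case: t0 pt0 => //; rewrite p0 ltxx.
  by exists 0%N; split; [apply: reach0 | rewrite add0n; apply: reach1].
have [d /asboolP[d0 [x [rx rxd]]] dmin] := ex_minnP exD.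
suff d1 : d = 1%N by exists x; rewrite -addn1 -[in (x + 1)%N]d1.
apply: nl => t pt; rewrite /dvdn; apply/eqP.
case: (posnP (t %% d)) => // r0.
have : (d <= t %% d)%N.
  apply: dmin; apply/asboolP; split => //.
  exists (t %/ d * (x + d))%N; split; first exact: reachM.
  have -> : (t %/ d * (x + d) + t %% d = t %/ d * x + t)%N.
    by rewrite {4}(divn_eq t d) mulnDr addnA.
  by apply: reachD; [apply: reachM | apply: reach1].
by rewrite leqNgt ltn_mod d0.
Qed.

(** With quotient [u] and remainder [v] of [j] modulo [x], one has [j = (u - v) * x + v * (x + 1)],
    and [j >= x * x] ensures [v <= u]. If [x = 0], then 1 is reachable and so is everything. *)
Lemma reach_eventually : p 0%N = 0 -> non_lattice p -> (exists t, 0 < p t) ->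
  exists L, forall j, (L <= j)%N -> reach p j.
Proof.
move=> p0 nl ex; have [x [rx rx1]] := reach_consecutive p0 nl ex.
exists (x * x)%N => j xj.
have [x0|x0] := posnP x.
  by rewrite -[j]muln1; apply: reachM; rewrite -[1%N]/(0.+1) -x0.
have xd : (x <= j %/ x)%N by rewrite leq_divRL.
have vx : (j %% x < x)%N by rewrite ltn_mod.
have -> : (j = (j %/ x - j %% x) * x + (j %% x) * x.+1)%N.
  rewrite {1}(divn_eq j x) mulnBl mulnS [(_ + (_ %% _ * x))%N]addnC addnA subnK //.
  by rewrite leq_mul2r (leq_trans (ltnW vx) xd) orbT.
by apply: reachD; apply: reachM.
Qed.
End Reach.

(** * Embedding the marked gaps in the walk *)

Section GapTail.
Variables (R : realType) (m : nat) (a : R).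

(* [gap_tail t] is the probability that an m-letter pattern of probability [a]
   that does not overlap itself fails to occur at times [1, ..., t-1] after an
   occurrence at time [0]. *)
Definition gap_tail : nat -> R := cov_rec (fun h =>
  if (size h <= m)%N then 1
  else nth 0 h (size h).-1 - a * nth 0 h (size h - m)).

(** The [m] letters of a pattern ending at [t] are independent of the absence of occurrences up to
    [t - m], and non-overlap excludes occurrences in between; hence the argument [t.+1 - m]. *)
Definition gap_law (t : nat) : R :=
  if (m <= t)%N then a * gap_tail (t.+1 - m) else 0.

Lemma gap_tail_le t : (t <= m)%N -> gap_tail t = 1.
Proof. by move=> tm; rewrite /gap_tail cov_recE size_mkseq tm. Qed.

Lemma gap_tailS t : (0 < m)%N -> (m <= t)%N ->
  gap_tail t.+1 = gap_tail t - a * gap_tail (t.+1 - m).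
Proof.
move=> m0 mt; rewrite {1}/gap_tail cov_recE size_mkseq leqNgt ltnS mt /=.
by rewrite !nth_mkseq //; lia.
Qed.

Lemma gap_lawE t : (0 < m)%N -> gap_law t = gap_tail t - gap_tail t.+1.
Proof.
move=> m0; rewrite /gap_law; case: leqP => mt.
  by rewrite gap_tailS // opprB addrC subrK.
by rewrite !gap_tail_le ?subrr // ltnW.
Qed.

(** The ratio bound reproduces itself: if it holds below [t], going back [m - 1] steps gives [r ^+
    m.-1 * gap_tail (t.+1 - m) <= gap_tail t], and the condition on [a] then makes the loss
    [a * gap_tail (t.+1 - m)] at most [(1 - r) * gap_tail t]. *)
Lemma gap_tail_ratio r : (0 < m)%N -> 0 < a -> 0 < r < 1 ->
  a <= (1 - r) * r ^+ m -> forall t, 0 < gap_tail t /\ r * gap_tail t <= gap_tail t.+1.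
Proof.
move=> m0 a0 /andP[r0 r1] ha; elim/ltn_ind => t IH.
have pos : 0 < gap_tail t.
  case: t IH => [|t] IH; first by rewrite gap_tail_le ?ltr01.
  have [p1 p2] := IH t (ltnSn t).
  by apply: lt_le_trans p2; rewrite mulr_gt0.
split=> //.
have [tm|mt] := ltnP t m.
  by rewrite !gap_tail_le ?mulr1 ?(ltW r1) // ltnW.
rewrite gap_tailS //.
have iter j : (j <= t)%N -> r ^+ j * gap_tail (t - j) <= gap_tail t.
  elim: j => [|j IHj] jt; first by rewrite expr0 mul1r subn0.
  apply: le_trans (IHj (ltnW jt)).
  rewrite exprSr -mulrA ler_wpM2l // ?exprn_ge0 ?(ltW r0) //.
  have -> : (t - j = (t - j.+1).+1)%N by lia.
  by have [] := IH (t - j.+1)%N ltac:(lia).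
have st : 0 < gap_tail (t.+1 - m).
  have [->|mt1] := eqVneq m 1%N; first by rewrite subn1.
  by have [] := IH (t.+1 - m)%N ltac:(lia).
have h1 : r ^+ m * gap_tail (t.+1 - m) <= gap_tail t.
  have -> : (t.+1 - m = t - m.-1)%N by lia.
  apply: le_trans (iter m.-1 _); last by lia.
  rewrite ler_wpM2r //.
    have -> : (t - m.-1 = t.+1 - m)%N by lia.
    exact: ltW.
  by rewrite -{1}(prednK m0) exprS ger_pMl ?exprn_gt0 // ltW.
have h2 : a * gap_tail (t.+1 - m) <= (1 - r) * gap_tail t.
  apply: le_trans (_ : (1 - r) * r ^+ m * gap_tail (t.+1 - m) <= _).
    by rewrite ler_wpM2r // ltW.
  by rewrite -mulrA ler_wpM2l // subr_ge0 ltW.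
lra.
Qed.

Hypothesis m0 : (0 < m)%N.
Hypothesis a0 : 0 < a.
Hypothesis pos : forall t, 0 < gap_tail t.

Lemma gap_law_ge0 t : 0 <= gap_law t.
Proof. by rewrite /gap_law; case: ifP => // _; rewrite mulr_ge0 ?(ltW a0) // ltW. Qed.

Lemma gap_tail_decr i j : (i <= j)%N -> gap_tail j <= gap_tail i.
Proof.
elim: j => [|j IH]; first by rewrite leqn0 => /eqP->.
rewrite leq_eqVlt => /orP[/eqP->//|ij].
apply: le_trans (IH ij); have := gap_law_ge0 j; rewrite gap_lawE //; lra.
Qed.

Lemma gap_tail_lt1 : a < 1.
Proof.
have := pos m.+1; rewrite gap_tailS // gap_tail_le //.
have -> : (m.+1 - m = 1)%N by lia.
by rewrite gap_tail_le // mulr1 subr_gt0.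
Qed.

(** By monotonicity the recursion subtracts at least [a * gap_tail t]. This decay becomes the tail
    of the coding window. *)
Lemma gap_tail_geom t : gap_tail t <= (1 - a) ^+ (t - m).
Proof.
elim: t => [|t IH]; first by rewrite gap_tail_le // sub0n expr0.
have [tm|mt] := ltnP t m.
  by rewrite gap_tail_le // (_ : (t.+1 - m)%N = 0%N) ?expr0 //; lia.
rewrite gap_tailS // (_ : (t.+1 - m = (t - m).+1)%N); last by lia.
rewrite exprS.
have h : gap_tail t <= gap_tail (t - m).+1 by apply: gap_tail_decr; lia.
have := ler_wpM2l (ltW a0) h.
have := ler_wpM2l (_ : 0 <= 1 - a) IH; rewrite subr_ge0 ltW ?gap_tail_lt1 //.
move/(_ isT) => ? ?; lra.
Qed.
End GapTail.

(** * Mass of the walk before it is stopped *)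

Section Unstopped.
Variables (R : realType) (p : nat -> R) (m : nat) (a : R).

Definition jump_tail (j : nat) : R := 1 - \sum_(s < j.+1) p s.

(* Mass of the walk with jumps [p] that visits [n] without having been stopped,
   when the mass [gap_law t] is stopped at each [t]. *)
Definition unstopped : nat -> R := cov_rec (fun h =>
  if size h is n.+1
  then \sum_(k < n.+1) nth 0 h k * p (n.+1 - k) - gap_law m a n.+1
  else 1).

Lemma unstopped0 : unstopped 0 = 1.
Proof. by rewrite /unstopped cov_recE. Qed.

Lemma unstoppedS n : (0 < n)%N ->
  unstopped n = \sum_(k < n) unstopped k * p (n - k) - gap_law m a n.
Proof.
case: n => // n _; rewrite {1}/unstopped cov_recE size_mkseq; congr (_ - _).
by apply: eq_bigr => k _; rewrite nth_mkseq.
Qed.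

Hypothesis p0 : p 0%N = 0.
Hypothesis m0 : (0 < m)%N.

Lemma jump_tail0 : jump_tail 0 = 1.
Proof. by rewrite /jump_tail big_ord_recl big_ord0 p0 addr0 subr0. Qed.

Lemma jump_tailS j : jump_tail j.+1 = jump_tail j - p j.+1.
Proof. by rewrite /jump_tail [in LHS]big_ord_recr /= opprD addrA. Qed.

(** Conservation of mass: the walk that is not stopped before [t], of mass [gap_tail t], has a last
    position [k < t], from which it jumps to [t] or beyond with probability
    [jump_tail (t.-1 - k)]. *)
Lemma unstopped_conv t : (0 < t)%N ->
  \sum_(k < t) unstopped k * jump_tail (t.-1 - k) = gap_tail m a t.
Proof.
case: t => // t _; elim: t => [|t IH].
  by rewrite big_ord_recl big_ord0 unstopped0 jump_tail0 mul1r addr0 gap_tail_le.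
rewrite big_ord_recr /= subnn jump_tail0 mulr1 unstoppedS //.
under eq_bigr => k _ do rewrite subSn -1?ltnS // jump_tailS mulrBr -subSn -1?ltnS //.
rewrite sumrB /= in IH *; rewrite IH gap_lawE //; lra.
Qed.
End Unstopped.

(** * Nonnegativity of the unstopped mass *)

Section Embedding.
Variables (R : realType) (p : nat -> R).
Hypothesis p0 : p 0%N = 0.
Hypothesis p_ge0 : forall t, 0 <= p t.

(** [E] bounds the mass stopped at one site. The quantification over every [w] makes [eta] and [B]
    depend on [p] and [j] only, so that they are available before [m] and [dl] are chosen. *)
Definition lower_bound_along (j : nat) (eta B : R) : Prop :=
  forall (w : nat -> R) (E : R) n, (j <= n)%N -> 0 <= E ->
    (forall k, (k < n)%N -> 0 <= w k) ->
    (forall i, (n < i + j)%N -> (i <= n)%N ->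
       \sum_(k < i) w k * p (i - k) - E <= w i) ->
    eta * w (n - j)%N - B * E <= w n.

(** Follow a path of jumps of positive probability back from [n]: each jump [t] multiplies the bound
    by [p t] and costs one more [E], weighted by the [eta] accumulated so far. *)
Lemma reach_lower_bound j : reach p j ->
  exists eta B, [/\ 0 < eta, 0 <= B & lower_bound_along j eta B].
Proof.
elim=> [|{}j t _ [eta [B [eta0 B0 IH]]] pt].
  exists 1, 0; split => // w E n _ _ _ _.
  by rewrite mul1r mul0r subr0 subn0.
have t0 : (0 < t)%N by case: t pt => //; rewrite p0 ltxx.
exists (eta * p t), (B + eta); split; [exact: mulr_gt0| lra |].
move=> w E n jn E0 w0 hw.
have h1 := IH w E n ltac:(lia) E0 w0 (fun i h1 h2 => hw i ltac:(lia) h2).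
have h2 := hw (n - j)%N ltac:(lia) ltac:(lia).
have h3 : p t * w (n - (j + t))%N <= \sum_(k < n - j) w k * p (n - j - k)%N.
  have hk : (n - (j + t) < n - j)%N by lia.
  rewrite (bigD1 (Ordinal hk)) //= mulrC.
  rewrite (_ : (n - j - (n - (j + t)) = t)%N); last by lia.
  rewrite lerDl; apply: sumr_ge0 => k _; rewrite mulr_ge0 // w0 //.
  by have := ltn_ord k; lia.
have := ler_wpM2l (ltW eta0) (_ : p t * w (n - (j + t))%N - E <= w (n - j)%N).
move=> /(_ ltac:(lra)); lra.
Qed.

Lemma reach_lower_bound_le N : exists eta B, [/\ 0 < eta, 0 <= B &
  forall j, (0 < j <= N)%N -> reach p j -> lower_bound_along j eta B].
Proof.
elim: N => [|N [eta [B [eta0 B0 IH]]]].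
  by exists 1, 0; split => // j; case: j.
have [rN|nrN] := pselect (reach p N.+1); last first.
  exists eta, B; split => // j /andP[j0]; rewrite leq_eqVlt => /orP[/eqP->//|jN].
  by apply: IH; rewrite j0.
have [eta' [B' [eta'0 B'0 IH']]] := reach_lower_bound rN.
exists (Num.min eta eta'), (Num.max B B'); split.
- by rewrite lt_min eta0.
- by rewrite le_max B0.
have weaken j e1 b1 e2 b2 : (0 < j)%N -> e2 <= e1 -> b1 <= b2 ->
    lower_bound_along j e1 b1 -> lower_bound_along j e2 b2.
  move=> j0 he hb H w E n jn E0 w0 hw.
  apply: le_trans (H w E n jn E0 w0 hw).
  by rewrite lerB // ler_wpM2r // w0 //; lia.
move=> j /andP[j0]; rewrite leq_eqVlt => /orP[/eqP jN|jN] rj.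
  rewrite jN in j0 *; apply: weaken IH' => //; first by rewrite ge_min lexx orbT.
  by rewrite le_max lexx orbT.
apply: weaken (IH j _ rj) => //; last by rewrite j0.
  by rewrite ge_min lexx.
by rewrite le_max lexx.
Qed.

Lemma geometric_window (r : R) n K :
  (1 - r) * \sum_(k < n) r ^+ (n + K - k) = r ^+ K.+1 - r ^+ (n + K.+1).
Proof.
elim: n => [|n IH]; first by rewrite big_ord0 mulr0 add0n subrr.
rewrite big_ord_recl /= subn0 mulrDr.
under eq_bigr => k _ do rewrite /bump /= add1n addSn subSS.
by rewrite IH addSnnS !addnS !addSn !exprS; ring.
Qed.

Variables (m : nat) (a r C : R).
Hypothesis m0 : (0 < m)%N.
Hypothesis r01 : 0 < r < 1.
Hypothesis spos : forall t, 0 < gap_tail m a t.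
Hypothesis sratio : forall t, r * gap_tail m a t <= gap_tail m a t.+1.
Hypothesis gC : forall j, jump_tail p j <= C * r ^+ (2 * j.+1).
Hypothesis g_ge0 : forall j, 0 <= jump_tail p j.
Local Notation s := (gap_tail m a).
Local Notation w := (unstopped p m a).

Lemma gap_tail_ratioX j t : r ^+ j * s t <= s (t + j).
Proof.
have /andP[r0 _] := r01.
elim: j => [|j IH]; first by rewrite expr0 mul1r addn0.
rewrite addnS exprS -mulrA; apply: le_trans (sratio _).
by rewrite ler_wpM2l // ltW.
Qed.

Lemma unstopped_le k : (forall i, (i <= k)%N -> 0 <= w i) -> w k <= s k.+1.
Proof.
move=> w0; rewrite -(unstopped_conv a p0 m0) // big_ord_recr /= subnn jump_tail0 // mulr1.
by rewrite lerDr sumr_ge0 // => i _; rewrite mulr_ge0 ?w0 // ltnW.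
Qed.

(** In [unstopped_conv] at [n + K], the positions [k < n] contribute little: [w k <= s k.+1], and
    going back from [n + K] increases [s] by at most a factor [r^-1] per step, while the jump tail
    decays at twice that rate. They account for at most half of [s (n + K)], so the other half lies
    on [K] positions and one of them carries its share. *)
Lemma unstopped_window n K : (0 < K)%N -> 0 < C -> C * r ^+ K <= (1 - r) / 2 ->
  (forall i, (i < n + K)%N -> 0 <= w i) ->
  exists k, (n <= k < n + K)%N /\ s (n + K) / (2 * K%:R) <= w k.
Proof.
move=> K0 C0 hK w0; have /andP[r0 r1] := r01.
have conv := unstopped_conv a p0 m0 (t := n + K) ltac:(lia).
rewrite big_split_ord /= in conv.
have far : \sum_(k < n) w k * jump_tail p ((n + K).-1 - k) <= s (n + K) / 2.
  have term (k : 'I_n) : w k * jump_tail p ((n + K).-1 - k)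
      <= s (n + K) * C * r ^+ (n + K - k).
    have kn := ltn_ord k.
    apply: le_trans (_ : s k.+1 * (C * r ^+ (2 * (n + K - k))) <= _).
      apply: ler_pM; [by apply: w0; lia | by [] | |].
        by apply: unstopped_le => i ik; apply: w0; lia.
      by apply: le_trans (gC _) _; rewrite (_ : ((n + K).-1 - k).+1 = n + K - k)%N //; lia.
    have := gap_tail_ratioX (n + K - k.+1) k.+1.
    rewrite (_ : (k.+1 + (n + K - k.+1) = n + K)%N); last by lia.
    move=> h.
    (* Half of the exponent pays for passing from [s k.+1] to [s (n + K)]; the other half leaves the
       term of a geometric series. *)
    have -> : r ^+ (2 * (n + K - k)) = r ^+ (n + K - k.+1) * (r * r ^+ (n + K - k)).
      by rewrite -exprS -exprD; congr (_ ^+ _); lia.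
    have x0 : 0 <= r ^+ (n + K - k) by rewrite exprn_ge0 // ltW.
    have h2 : C * r * r ^+ (n + K - k) * (r ^+ (n + K - k.+1) * s k.+1) <=
              C * r * r ^+ (n + K - k) * s (n + K).
      by rewrite ler_wpM2l // mulr_ge0 // mulr_ge0 // ltW.
    have h3 : C * s (n + K) * r ^+ (n + K - k) * r <= C * s (n + K) * r ^+ (n + K - k).
      by rewrite ger_pMr ?(ltW r1) // !mulr_gt0 // exprn_gt0.
    lra.
  apply: le_trans (ler_sum _ (fun k _ => term k)) _.
  rewrite -mulr_sumr.
  have geo := geometric_window r n K.
  have X : \sum_(k < n) r ^+ (n + K - k) <= r ^+ K / (1 - r).
    rewrite ler_pdivlMr ?subr_gt0 // mulrC geo.
    apply: le_trans (_ : r ^+ K.+1 <= _); first by rewrite gerBl exprn_ge0 // ltW.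
    by rewrite exprS ger_pMl ?exprn_gt0 // ltW.
  have Y : C * (r ^+ K / (1 - r)) <= 2^-1.
    by rewrite mulrA ler_pdivrMr ?subr_gt0 // [leRHS]mulrC.
  rewrite -mulrA ler_wpM2l ?(ltW (spos _)) //.
  by apply: le_trans Y; rewrite ler_wpM2l // ltW.
apply: contrapT => noK.
have small (k : 'I_K) : w (n + k)%N * jump_tail p ((n + K).-1 - (n + k)) < s (n + K) / (2 * K%:R).
  have kK := ltn_ord k.
  rewrite ltNge; apply/negP => h; apply: noK; exists (n + k)%N; split; first by lia.
  apply: le_trans h _; apply: ler_piMr; first by apply: w0; lia.
  by rewrite /jump_tail gerBl sumr_ge0.
have near : \sum_(k < K) w (n + k)%N * jump_tail p ((n + K).-1 - (n + k)) < s (n + K) / 2.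
  apply: lt_le_trans (_ : \sum_(k < K) s (n + K) / (2 * K%:R) <= _).
    apply: ltr_sum => [|k _]; last exact: small.
    by apply/hasP; exists (Ordinal K0) => //; rewrite mem_index_enum.
  rewrite sumr_const card_ord -mulr_natr le_eqVlt; apply/orP; left; apply/eqP.
  by field; rewrite pnatr_eq0 -lt0n.
lra.
Qed.
End Embedding.

Lemma jump_tail_ge0 (R : realType) (p : nat -> R) j :
  jump_distribution p -> 0 <= jump_tail p j.
Proof.
move=> [_ [p_ge0 psum]]; rewrite subr_ge0.
rewrite -(cvg_lim _ psum) //.
apply: limr_ge; first by apply/cvg_ex; exists 1.
exists j.+1 => // n /= jn.
rewrite -!(big_mkord xpredT p) (@big_cat_nat _ _ _ j.+1 0 n) //=.
by rewrite lerDl sumr_ge0.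
Qed.

Lemma jump_positive (R : realType) (p : nat -> R) :
  jump_distribution p -> exists t, 0 < p t.
Proof.
move=> [_ [p_ge0 psum]]; apply: contrapT => none.
have pz t : p t = 0.
  apply/eqP; rewrite eq_le p_ge0 andbT leNgt; apply/negP => pt.
  by apply: none; exists t.
have : (fun n => \sum_(t < n) p t) @ \oo --> (0 : R).
  under eq_fun do rewrite big1 //.
  exact: cvg_cst.
by move/(cvg_unique _ psum) => /(_ (@norm_hausdorff _ _))/eqP; rewrite oner_eq0.
Qed.

Lemma embedding (R : realType) (p : nat -> R) :
  jump_distribution p -> non_lattice p -> exp_tails p ->
  exists m dl, let a := dl * (1 - dl) ^+ m.-1 in
    [/\ (0 < m)%N, 0 < dl < 1, forall t, 0 < gap_tail m a t &
        forall n, 0 <= unstopped p m a n].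
Proof.
move=> jd nl [C [c [C0 [c0 tail]]]].
have [p0 [p_ge0 _]] := jd.
have [L reachL] := reach_eventually p0 nl (jump_positive jd).
(* Half of the rate [c]: the tail of [p] is then bounded by powers of [r ^+ 2], while [gap_tail]
   will lose at most a factor [r] per step. *)
set r := expR (- (c / 2)).
have r0 : 0 < r by exact: expR_gt0.
have r1 : r < 1 by rewrite expR_lt1 oppr_lt0 divr_gt0.
have r01 : 0 < r < 1 by rewrite r0.
have gC j : jump_tail p j <= C * r ^+ (2 * j.+1).
  apply: le_trans (tail j.+1 isT) _; rewrite ler_wpM2l ?(ltW C0) //.
  by rewrite /r -expRM_natl ler_expR natrM; lra.
have g0 j : 0 <= jump_tail p j by exact: jump_tail_ge0.
have [K K0 hK] : exists2 K, (0 < K)%N & C * r ^+ K <= (1 - r) / 2.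
  have : (fun n => C * r ^+ n) @ \oo --> C * 0.
    apply: cvgM; first exact: cvg_cst.
    by apply: cvg_expr; rewrite ger0_norm ?ltW.
  rewrite mulr0 => /cvgrPdist_le/(_ ((1 - r) / 2)).
  case; first by rewrite divr_gt0 // subr_gt0.
  move=> N _ hN; exists N.+1 => //.
  have := hN N.+1 (leqnSn N); rewrite sub0r normrN ger0_norm //.
  by rewrite mulr_ge0 ?exprn_ge0 // ltW.
have [eta [B [eta0 B0 low]]] := reach_lower_bound_le p0 p_ge0 (L + K).
(* Below [m] nothing is stopped, and from [m] on there is room to look back [L + K] sites. *)
pose m := (L + K).+1.
(* Below this threshold, [B] times the mass stopped at a site, with [gap_tail] compared across
   [2 * m] sites, stays under the gain [eta / (2 * K%:R)]; [B + 1] keeps the denominator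
   positive. *)
pose bound := eta * r ^+ (2 * m) / (2 * K%:R * (B + 1)).
(* The bound [2^-1] gives [dl < 1], the second one serves [gap_tail_ratio], the third the final
   comparison; the last two pass to [a] because [a <= dl]. *)
pose dl := Num.min 2^-1 (Num.min ((1 - r) * r ^+ m) bound).
have K0' : 0 < K%:R :> R by rewrite ltr0n.
have bound0 : 0 < bound.
  by rewrite divr_gt0 ?mulr_gt0 ?exprn_gt0 // ltr_wpDl.
have dl0 : 0 < dl.
  by rewrite !lt_min invr_gt0 ltr0n mulr_gt0 ?subr_gt0 ?exprn_gt0.
have dl1 : dl < 1.
  by rewrite gt_min invf_lt1 ?ltr0n // ltr1n.
exists m, dl => a.
have adl : a <= dl.
  rewrite /a ger_pMr // exprn_ile1 //; lra.
have a0 : 0 < a by rewrite mulr_gt0 // exprn_gt0 // subr_gt0.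
have ar : a <= (1 - r) * r ^+ m.
  by apply: le_trans adl _; rewrite !ge_min lexx !orbT.
have ab : a <= bound.
  by apply: le_trans adl _; rewrite !ge_min lexx !orbT.
have m0 : (0 < m)%N by [].
clearbody a.
have sr := gap_tail_ratio m0 a0 r01 ar.
have spos t : 0 < gap_tail m a t by have [] := sr t.
have sratio t : r * gap_tail m a t <= gap_tail m a t.+1 by have [] := sr t.
split=> //; first by rewrite dl0.
elim/ltn_ind => n IH.
have [nm|mn] := ltnP n m.
  have [->|n0] := posnP n; first by rewrite unstopped0 ler01.
  rewrite unstoppedS // /gap_law leqNgt nm /= subr0.
  by apply: sumr_ge0 => k _; rewrite mulr_ge0 // IH.
(* The window starts at [n - (L + K)] and has length [K], so that [L < n - k <= L + K]: this
   distance is reachable and in the range for which [eta] and [B] were fixed. *)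
have [] := @unstopped_window _ p p0 p_ge0 m a r C m0 r01 spos sratio gC g0
  (n - (L + K)) K K0 C0 hK.
  by move=> i hi; apply: IH; clear -hi mn; lia.
move=> k [/andP[k1 k2] wk].
(* A site [i] between [k] and [n] stops at most [a * gap_tail (i.+1 - m)], and [i.+1 - m] lies at
   most [2 * m] before [n]. *)
pose E := a * (r ^+ (2 * m))^-1 * gap_tail m a n.
have E0 : 0 <= E by rewrite !mulr_ge0 ?invr_ge0 ?exprn_ge0 ?(ltW a0) ?(ltW r0) ?(ltW (spos _)).
have hl : lower_bound_along p (n - k) eta B.
  by apply: low; [clear -k1 k2 mn; lia | apply: reachL; clear -k1 k2 mn; lia].
have := hl (unstopped p m a) E n (leq_subr _ _) E0 IH.
have hE i : (n < i + (n - k))%N -> (i <= n)%N ->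
    \sum_(k < i) unstopped p m a k * p (i - k)%N - E <= unstopped p m a i.
  move=> i1 i2; rewrite unstoppedS; last by clear -i1 k2; lia.
  rewrite lerD2l lerN2 /gap_law; case: leqP => // mi.
  rewrite /E -mulrA ler_wpM2l ?(ltW a0) // mulrC ler_pdivlMr ?exprn_gt0 // mulrC.
  have h := gap_tail_ratioX r01 sratio (n - (i.+1 - m)) (i.+1 - m).
  rewrite (_ : (i.+1 - m + (n - (i.+1 - m)) = n)%N) in h; last by clear -i2 mi; lia.
  apply: le_trans h; rewrite ler_wpM2r ?(ltW (spos _)) //.
  apply: ler_wiXn2l; [exact: ltW | exact: ltW | clear -i1 i2 k1 k2 mi; lia].
move=> /(_ hE); rewrite (_ : (n - (n - k) = k)%N); last by clear -k1 k2 mn; lia.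
apply: le_trans; rewrite subr_ge0.
have sn : gap_tail m a n <= gap_tail m a (n - (L + K) + K).
  by apply: gap_tail_decr => //; clear -mn; lia.
apply: le_trans (_ : eta * (gap_tail m a n / (2 * K%:R)) <= _); last first.
  rewrite ler_wpM2l ?(ltW eta0) //; apply: le_trans wk.
  by rewrite ler_wpM2r // invr_ge0 mulr_ge0.
have h : a * (B + 1) * (2 * K%:R) <= eta * r ^+ (2 * m).
  by move: ab; rewrite /bound ler_pdivlMr ?mulr_gt0 ?ltr_wpDl //; lra.
rewrite /E [leRHS]mulrA ler_pdivlMr ?mulr_gt0 //.
have rm0 : 0 < r ^+ (2 * m) by rewrite exprn_gt0.
rewrite -(ler_pM2l rm0).
have -> : r ^+ (2 * m) * (B * (a / r ^+ (2 * m) * gap_tail m a n) * (2 * K%:R)) =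
  a * B * (2 * K%:R) * gap_tail m a n by field; rewrite gt_eqF.
rewrite [leRHS]mulrA ler_wpM2r ?(ltW (spos _)) //.
have : 0 <= a * (2 * K%:R) by rewrite !mulr_ge0 // ltW.
lra.
Qed.

(** * Weights of stopped paths *)

(** The possible paths from 0 to [n], listed by their last jump as in the recursion of
    [unstopped]. *)
Definition compositions : nat -> seq (seq nat) := cov_rec (fun h =>
  if size h is n.+1
  then [seq rcons e (n.+1 - j)%N | j <- iota 0 n.+1, e <- nth [::] h j]
  else [:: [::]]).

Lemma compositions0 : compositions 0 = [:: [::]].
Proof. by rewrite /compositions cov_recE. Qed.

Lemma compositionsS n : compositions n.+1 =
  [seq rcons e (n.+1 - j)%N | j <- iota 0 n.+1, e <- compositions j].
Proof.
rewrite {1}/compositions cov_recE size_mkseq; congr flatten.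
apply/eq_in_map => j; rewrite mem_iota add0n => /andP[_ jn].
by rewrite nth_mkseq.
Qed.

Lemma mem_compositions n e :
  (e \in compositions n) = all (fun t => 0 < t)%N e && (sumn e == n).
Proof.
elim/ltn_ind: n e => -[_ e|n IH e].
  rewrite compositions0 inE; case: e => // t e /=.
  by rewrite addn_eq0; case: t => //=; rewrite andbF.
rewrite compositionsS; apply/allpairsPdep/idP => [[j [e' [jn e'j ->]]]|].
  rewrite mem_iota add0n /= in jn; rewrite IH // in e'j.
  case/andP: e'j => pe /eqP se; rewrite all_rcons sumn_rcons pe se andbT subn_gt0.
  by rewrite jn /= subnKC // ltnW.
case/lastP: e => [|e t]; first by rewrite andbC.
rewrite all_rcons sumn_rcons => /andP[/andP[t0 pe] /eqP st].
have sn : (sumn e < n.+1)%N by rewrite -st -addn1 leq_add2l.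
exists (sumn e), e; split; first by rewrite mem_iota.
- by rewrite IH // pe eqxx.
- by rewrite -st addnC addnK.
Qed.

Lemma compositions_uniq n : uniq (compositions n).
Proof.
elim/ltn_ind: n => -[_|n IH]; first by rewrite compositions0.
rewrite compositionsS; apply: allpairs_uniq_dep; first exact: iota_uniq.
- by move=> j; rewrite mem_iota => /andP[_ jn]; apply: IH.
move=> [i e] [j e'].
move=> h1 h2.
have [x [e1 [xi _ /(congr1 (@tag _ _)) /= ix]]] := elimT allpairsPdep h1.
have [x' [e1' [xi' _ /(congr1 (@tag _ _)) /= jx]]] := elimT allpairsPdep h2.
rewrite -{}ix in xi; rewrite -{}jx in xi'.
rewrite !mem_iota !add0n /= in xi xi'.
move=> /rcons_inj[<-] ij; congr existT.
by lia.
Qed.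

Section Weights.
Variables (R : realType) (p : nat -> R) (m : nat) (a : R).
Local Notation w := (unstopped p m a).
Local Notation q := (gap_law m a).

(* Probability of stopping at [k] given an arrival there ([0] when no mass arrives). *)
Definition stop_prob (k : nat) : R := q k / (w k + q k).

(** Survival is charged at every landing point, the last one included, but not at the start [k]. *)
Fixpoint partial_wt (k : nat) (ts : seq nat) : R :=
  if ts is t :: ts' then p t * (1 - stop_prob (k + t)) * partial_wt (k + t) ts'
  else 1.

(* The walk takes the jumps [e] and stops at the end, not before. *)
Definition exc_wt (e : seq nat) : R :=
  partial_wt 0 (take (size e).-1 e) * p (last 0%N e) * stop_prob (sumn e).

Lemma partial_wt_rcons k ts t : partial_wt k (rcons ts t) =
  partial_wt k ts * p t * (1 - stop_prob (k + sumn ts + t)).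
Proof.
elim: ts k => [|x ts IH] k /=; first by rewrite addn0 mulr1 mul1r.
by rewrite IH addnA !mulrA.
Qed.

Lemma exc_wt_rcons ts t :
  exc_wt (rcons ts t) = partial_wt 0 ts * p t * stop_prob (sumn ts + t).
Proof.
by rewrite /exc_wt size_rcons /= -cats1 take_size_cat // last_cat sumn_cat /= addn0.
Qed.

Lemma partial_exc_wt ts t :
  partial_wt 0 (rcons ts t) + exc_wt (rcons ts t) = partial_wt 0 ts * p t.
Proof. by rewrite partial_wt_rcons exc_wt_rcons add0n; ring. Qed.

Hypothesis p_ge0 : forall t, 0 <= p t.
Hypothesis m0 : (0 < m)%N.
Hypothesis w_ge0 : forall n, 0 <= w n.
Hypothesis q_ge0 : forall n, 0 <= q n.

Lemma stop_prob_bounds k : 0 <= stop_prob k <= 1.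
Proof.
have qw : 0 <= w k + q k by rewrite addr_ge0.
rewrite /stop_prob divr_ge0 //=.
have [->|h] := eqVneq (w k + q k) 0; first by rewrite invr0 mulr0 ler01.
by rewrite ler_pdivrMr ?lt_neqAle 1?eq_sym ?h ?qw // mul1r lerDr.
Qed.

Lemma stop_probM k : (w k + q k) * stop_prob k = q k.
Proof.
rewrite /stop_prob; have [h|h] := eqVneq (w k + q k) 0.
  rewrite h mul0r; apply/eqP; rewrite eq_sym; move/eqP: h.
  by rewrite paddr_eq0 // => /andP[].
by rewrite mulrC divfK.
Qed.

Lemma partial_wt_ge0 k ts : 0 <= partial_wt k ts.
Proof.
elim: ts k => [|t ts IH] k /=; first exact: ler01.
have /andP[_ c1] := stop_prob_bounds (k + t).
by rewrite !mulr_ge0 // subr_ge0.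
Qed.

Lemma exc_wt_ge0 e : 0 <= exc_wt e.
Proof.
have /andP[c0 _] := stop_prob_bounds (sumn e).
by apply: mulr_ge0 => //; apply: mulr_ge0 => //; apply: partial_wt_ge0.
Qed.

Lemma exc_wt_lt e : (sumn e < m)%N -> exc_wt e = 0.
Proof.
by move=> em; rewrite /exc_wt /stop_prob /gap_law leqNgt em mul0r mulr0.
Qed.

Lemma arrival_split n : (0 < n)%N -> \sum_(k < n) w k * p (n - k) = w n + q n.
Proof. by move=> n0; rewrite [w n]unstoppedS // subrK. Qed.

(** Arrivals at [n] have mass [w n + q n], of which the fraction [1 - stop_prob n] survives. Thus
    [w], defined by a recursion with subtraction, is the visit mass of an actual stopped walk. *)
Lemma sum_partial_wt n : \sum_(e <- compositions n) partial_wt 0 e = w n.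
Proof.
elim/ltn_ind: n => -[_|n IH].
  by rewrite compositions0 big_seq1 unstopped0.
rewrite compositionsS big_allpairs_dep.
rewrite (_ : iota 0 n.+1 = index_iota 0 n.+1) ?big_mkord; last by rewrite /index_iota subn0.
transitivity (\sum_(j < n.+1) w j * p (n.+1 - j)%N * (1 - stop_prob n.+1)).
  apply: eq_bigr => j _; rewrite -(IH j) // !mulr_suml; apply: eq_big_seq => e.
  rewrite mem_compositions => /andP[_ /eqP se].
  by rewrite partial_wt_rcons add0n se subnKC // ltnW.
by rewrite -mulr_suml arrival_split // mulrBr stop_probM mulr1 addrK.
Qed.

(** The embedding itself: of the arrivals at [n] the fraction [stop_prob n] is stopped, so the
    stopped position has law [q]. *)
Lemma sum_exc_wt n : (0 < n)%N -> \sum_(e <- compositions n) exc_wt e = q n.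
Proof.
case: n => // n _; rewrite compositionsS big_allpairs_dep.
rewrite (_ : iota 0 n.+1 = index_iota 0 n.+1) ?big_mkord; last by rewrite /index_iota subn0.
transitivity (\sum_(j < n.+1) w j * p (n.+1 - j)%N * stop_prob n.+1).
  apply: eq_bigr => j _; rewrite -sum_partial_wt !mulr_suml; apply: eq_big_seq => e.
  rewrite mem_compositions => /andP[_ /eqP se].
  by rewrite exc_wt_rcons se subnKC // ltnW.
by rewrite -mulr_suml arrival_split // stop_probM.
Qed.

Variable M : nat.
Hypothesis pM : \sum_(t < M) p t.+1 <= 1.

(* Total weight of the excursions that continue [pr] by at least one and at most
   [d] jumps, all of size at most [M]. *)
Fixpoint ext_wt (d : nat) (pr : seq nat) : R :=
  if d is d'.+1
  then \sum_(t < M) (exc_wt (rcons pr t.+1) + ext_wt d' (rcons pr t.+1))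
  else 0.

Lemma partial_wt_split pr :
  \sum_(t < M) (exc_wt (rcons pr t.+1) + partial_wt 0 (rcons pr t.+1)) <= partial_wt 0 pr.
Proof.
under eq_bigr => t _ do rewrite addrC partial_exc_wt.
by rewrite -mulr_sumr ler_piMr // partial_wt_ge0.
Qed.

Lemma ext_wt_le d pr : ext_wt d pr <= partial_wt 0 pr.
Proof.
elim: d pr => [|d IH] pr /=; first exact: partial_wt_ge0.
apply: le_trans (partial_wt_split pr); apply: ler_sum => t _.
by rewrite lerD2l.
Qed.

(** In the difference for [pr] the stopped weights cancel and a sum of the differences of its
    continuations by one jump remains; these are all nonnegative, so each is bounded by the
    difference for [pr]. *)
Lemma ext_wt_defect d pr t : (0 < t <= M)%N ->
  partial_wt 0 (rcons pr t) - ext_wt d (rcons pr t) <= partial_wt 0 pr - ext_wt d.+1 pr.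
Proof.
case: t => // t /= tM.
have := partial_wt_split pr; set S := \sum_(_ < _) _ => hS.
have : partial_wt 0 (rcons pr t.+1) - ext_wt d (rcons pr t.+1) <=
  S - \sum_(t < M) (exc_wt (rcons pr t.+1) + ext_wt d (rcons pr t.+1)).
  rewrite /S -sumrB (bigD1 (Ordinal tM)) //= opprD addrACA subrr add0r lerDl.
  by apply: sumr_ge0 => k _; rewrite opprD addrACA subrr add0r subr_ge0 ext_wt_le.
lra.
Qed.

(** Removing the jumps of [pr] one by one leads to the empty path, for which [ext_wt_nil_ge] bounds
    the missing weight by a value of [gap_tail]. *)
Lemma ext_wt_defect_nil d pr : all (fun t => 0 < t <= M)%N pr ->
  partial_wt 0 pr - ext_wt d pr <= 1 - ext_wt (d + size pr) [::].
Proof.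
elim/last_ind: pr d => [|pr t IH] d; first by rewrite addn0.
rewrite all_rcons => /andP[tM prM].
by apply: le_trans (ext_wt_defect d pr tM) _; rewrite size_rcons -addSnnS IH.
Qed.
End Weights.

(** * Law of the concatenated excursions *)

Section RealProbability.
Variables (d : measure_display) (Omega : measurableType d) (R : realType).
Variable P : probability Omega R.

Definition prb (A : set Omega) : R := fine (P A).

Lemma prbE A : measurable A -> P A = (prb A)%:E.
Proof. by move=> mA; rewrite fineK // fin_num_measure. Qed.

Lemma prb_ge0 A : 0 <= prb A.
Proof. exact: fine_ge0. Qed.

Lemma prb0 : prb set0 = 0.
Proof. by rewrite /prb measure0. Qed.

Lemma prbT : prb setT = 1.
Proof. by rewrite /prb probability_setT. Qed.

Lemma prb_le A B : measurable A -> measurable B -> A `<=` B -> prb A <= prb B.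
Proof. by move=> mA mB AB; rewrite -lee_fin -!prbE // le_measure // inE. Qed.

Lemma prb_le1 A : measurable A -> prb A <= 1.
Proof. by move=> mA; rewrite -prbT prb_le. Qed.

Lemma prbU A B : measurable A -> measurable B -> A `&` B = set0 ->
  prb (A `|` B) = prb A + prb B.
Proof.
move=> mA mB AB; apply: EFin_inj.
by rewrite EFinD -!prbE //; [exact: measureU | exact: measurableU].
Qed.

Lemma prbD A B : measurable A -> measurable B ->
  prb (A `\` B) = prb A - prb (A `&` B).
Proof.
move=> mA mB; rewrite -[in prb A](setUIDK A B) prbU.
- by rewrite addrC addKr.
- exact: measurableI.
- exact: measurableD.
- by rewrite -subset0 => x [[_ Bx] [_ /(_ Bx)]].
Qed.

Lemma prbU_le A B : measurable A -> measurable B -> prb (A `|` B) <= prb A + prb B.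
Proof.
move=> mA mB; rewrite -lee_fin EFinD -!prbE //; first exact: measureU2.
exact: measurableU.
Qed.

Lemma prb_split A B : measurable A -> measurable B ->
  prb A = prb (A `&` B) + prb (A `&` ~` B).
Proof. by move=> mA mB; rewrite -setDE prbD // addrC subrK. Qed.

Lemma prb_ext A B : (forall x, A x <-> B x) -> prb A = prb B.
Proof. by move=> AB; congr prb; apply/predeqP. Qed.

Lemma mset_exists_seq (I : eqType) (s : seq I) (F : I -> set Omega) :
  (forall i, i \in s -> measurable (F i)) ->
  measurable [set x | exists2 i, i \in s & F i x].
Proof.
elim: s => [|i s IH] mF.
  rewrite [X in measurable X](_ : _ = set0) // -subset0 => x [].
  by move=> j; rewrite in_nil.
rewrite [X in measurable X](_ : _ = F i `|` [set x | exists2 j, j \in s & F j x]).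
  apply: measurableU; first by apply: mF; rewrite mem_head.
  by apply: IH => j js; apply: mF; rewrite inE js orbT.
apply/predeqP => x; split.
  by case=> j; rewrite inE => /orP[/eqP->|js Fj]; [left | right; exists j].
by case=> [Fi|[j js Fj]]; [exists i; rewrite ?mem_head | exists j; rewrite // inE js orbT].
Qed.

Lemma prb_exists_seq (I : eqType) (s : seq I) (F : I -> set Omega) :
  uniq s -> (forall i, i \in s -> measurable (F i)) ->
  (forall i j x, i \in s -> j \in s -> F i x -> F j x -> i = j) ->
  prb [set x | exists2 i, i \in s & F i x] = \sum_(i <- s) prb (F i).
Proof.
elim: s => [|i s IH] /= us mF disj.
  rewrite big_nil -prb0; apply: prb_ext => x; split=> // -[j].
  by rewrite in_nil.
case/andP: us => nis us.
rewrite big_cons -IH //; last first.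
- by move=> j k x js ks; apply: disj; rewrite inE ?js ?ks orbT.
- by move=> j js; apply: mF; rewrite inE js orbT.
rewrite -prbU; last first.
- rewrite -subset0 => x [Fi [j js Fj]].
  by rewrite (disj i j x _ _ Fi Fj) ?mem_head ?js ?inE ?js ?orbT // in nis.
- by apply: mset_exists_seq => j js; apply: mF; rewrite inE js orbT.
- by apply: mF; rewrite mem_head.
apply: prb_ext => x; split.
  by case=> j; rewrite inE => /orP[/eqP->|js Fj]; [left | right; exists j].
by case=> [Fi|[j js Fj]]; [exists i; rewrite ?mem_head | exists j; rewrite // inE js orbT].
Qed.

Lemma mset_ex (I : countType) (F : I -> Omega -> Prop) :
  (forall i, measurable [set x | F i x]) -> measurable [set x | exists i, F i x].
Proof.
move=> mF; rewrite [X in measurable X](_ : _ = \bigcup_i [set x | F i x]).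
  exact: countable_bigcupT_measurable.
by apply/predeqP => x; split=> [[i Fi]|[i _ Fi]]; exists i.
Qed.

Lemma mset_and (A B : Omega -> Prop) :
  measurable [set x | A x] -> measurable [set x | B x] ->
  measurable [set x | A x /\ B x].
Proof. exact: measurableI. Qed.

Lemma mset_or (A B : Omega -> Prop) :
  measurable [set x | A x] -> measurable [set x | B x] ->
  measurable [set x | A x \/ B x].
Proof. exact: measurableU. Qed.

Lemma mset_not (A : Omega -> Prop) :
  measurable [set x | A x] -> measurable [set x | ~ A x].
Proof. exact: measurableC. Qed.

Lemma mset_prop (A : Prop) : measurable [set x : Omega | A].
Proof.
have [a|na] := pselect A.
  by rewrite [X in measurable X](_ : _ = setT) //; apply/predeqP.
by rewrite [X in measurable X](_ : _ = set0) //; apply/predeqP.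
Qed.

Lemma mset_all (I : countType) (F : I -> Omega -> Prop) :
  (forall i, measurable [set x | F i x]) -> measurable [set x | forall i, F i x].
Proof.
move=> mF; rewrite [X in measurable X](_ : _ = [set x | ~ exists i, ~ F i x]).
  by apply: mset_not; apply: mset_ex => i; apply: mset_not.
apply/predeqP => x; split=> [H [i]|H i]; first exact.
by apply: contrapT => nF; apply: H; exists i.
Qed.

Lemma mset_impl (A : Prop) (B : Omega -> Prop) :
  measurable [set x | B x] -> measurable [set x | A -> B x].
Proof.
move=> mB; have [a|na] := pselect A.
  rewrite [X in measurable X](_ : _ = [set x | B x]) //.
  by apply/predeqP => x; split=> [/(_ a)|Bx _].
by rewrite [X in measurable X](_ : _ = setT) //; apply/predeqP => x; split=> // _ /na.
Qed.
End RealProbability.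

(** * Patterns, excursions and chains of excursions *)

Section Pattern.
Variables (S : Type) (m : nat) (bit : S -> bool) (word : nat -> S -> seq nat).

Definition pattern (y : int -> S) (z : int) : bool :=
  bit (y z) && all (fun j : nat => ~~ bit (y (z - j%:Z))) (iota 1 m.-1).

(* [e] is the excursion that starts at [z]: the next pattern (at distance at
   least [m], so that it only reads letters after [z]) ends at [z + sumn e] and
   its letter carries the mark [e]. *)
Definition excursion (y : int -> S) (z : int) (e : seq nat) : Prop :=
  [/\ (m <= sumn e)%N, pattern y (z + (sumn e)%:Z),
      (forall n : nat, (m <= n < sumn e)%N -> ~~ pattern y (z + n%:Z)) &
      word (sumn e) (y (z + (sumn e)%:Z)) = e].

Lemma excursion_inj y z e e' : excursion y z e -> excursion y z e' -> e = e'.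
Proof.
move=> [m1 p1 n1 w1] [m2 p2 n2 w2].
have gg : sumn e = sumn e'.
  apply/eqP; rewrite eqn_leq; apply/andP; split; rewrite leqNgt; apply/negP => h.
    by have := n1 (sumn e'); rewrite m2 h p2 => /(_ isT).
  by have := n2 (sumn e); rewrite m1 h p1 => /(_ isT).
by rewrite -w1 -w2 gg.
Qed.

Lemma patternP y z : reflect
  (bit (y z) /\ forall j : nat, (0 < j < m)%N -> ~~ bit (y (z - j%:Z))) (pattern y z).
Proof.
apply: (iffP andP) => -[b h]; split=> //.
  move=> j jm; move/allP: h; apply; rewrite mem_iota; lia.
by apply/allP => j; rewrite mem_iota => jm; apply: h; lia.
Qed.

Lemma pattern_no_overlap y z j : (0 < j < m)%N -> pattern y z -> ~~ pattern y (z - j%:Z).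
Proof.
by move=> jm /patternP[_ /(_ j jm) h]; apply: contra h => /patternP[].
Qed.

(* The excursions chained from [z] on start with the jumps [pr ++ ts], and the
   first of them strictly extends [pr]. *)
Fixpoint chain (y : int -> S) (z : int) (pr ts : seq nat) : Prop :=
  if ts is t :: ts' then
    chain y z (rcons pr t) ts' \/
    (excursion y z (rcons pr t) /\ chain y (z + (sumn (rcons pr t))%:Z) [::] ts')
  else exists r, r <> [::] /\ excursion y z (pr ++ r).

Lemma chain_excursion y z pr ts : chain y z pr ts ->
  exists r, r <> [::] /\ excursion y z (pr ++ r).
Proof.
elim: ts pr => [//|t ts IH] pr /= [/IH|[e _]].
  by move=> [r [_]]; rewrite cat_rcons => e; exists (t :: r).
by exists [:: t]; rewrite cats1.
Qed.
End Pattern.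

(** * Independence of an event from later letters *)

Section Past.
Variables (d : measure_display) (Omega : measurableType d) (R : realType).
Variable P : probability Omega R.
Variables (dS : measure_display) (S : measurableType dS) (Y : int -> Omega -> S).
Hypothesis HY : iid_process P Y.
Local Notation prb := (prb P).

Definition rect (ns : seq int) (A : int -> set S) : set Omega :=
  [set w | forall n, n \in ns -> A n (Y n w)].

Lemma measurable_coord n A : measurable A -> measurable [set w | A (Y n w)].
Proof.
move=> mA; have [mY _] := HY.
by have := mY n measurableT A mA; rewrite setTI.
Qed.

Lemma measurable_rect ns A : (forall n, measurable (A n)) -> measurable (rect ns A).
Proof.
move=> mA; rewrite [X in measurable X](_ : _ =
    [set w | forall n, [set w' | n \in ns -> A n (Y n w')] w]) //.
by apply: mset_all => n; apply: mset_impl; apply: measurable_coord.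
Qed.

Lemma prb_coord n A : measurable A ->
  prb [set w | A (Y n w)] = prb [set w | A (Y 0 w)].
Proof. by move=> mA; have [_ [h _]] := HY; rewrite /prb (h n A mA). Qed.

Lemma prb_rect ns A : uniq ns -> (forall n, measurable (A n)) ->
  prb (rect ns A) = \prod_(n <- ns) prb [set w | A n (Y 0 w)].
Proof.
move=> us mA; have [_ [_ h]] := HY; apply: EFin_inj.
rewrite -prbE; last exact: measurable_rect.
have -> : rect ns A = \bigcap_(n in [set` ns]) (Y n @^-1` A n).
  by apply/predeqP => w; split=> H n; apply: H.
rewrite h // -prodEFin; apply: eq_bigr => n _.
rewrite -(prb_coord n) // -prbE //; exact: measurable_coord.
Qed.

(* [F] is independent of every rectangle event about the letters after [z]. *)
Definition past (z : int) (F : set Omega) : Prop :=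
  measurable F /\ forall ns A, uniq ns -> all (fun n => z < n) ns ->
    (forall n, measurable (A n)) ->
    prb (F `&` rect ns A) = prb F * prb (rect ns A).

Lemma past_setT z : past z setT.
Proof. by split=> // ns A _ _ _; rewrite setTI prbT mul1r. Qed.

(** The condition on the letter [z + 1] is absorbed into the rectangle: [A'] overrides that
    coordinate by [B], and the independence of [F] is used for the longer list. *)
Lemma past_step z F B : past z F -> measurable B ->
  past (z + 1) (F `&` [set w | B (Y (z + 1) w)]) /\
  prb (F `&` [set w | B (Y (z + 1) w)]) = prb F * prb [set w | B (Y 0 w)].
Proof.
move=> [mF pF] mB.
pose A' (A : int -> set S) n := if n == z + 1 then B else A n.
have mA' A n : (forall n, measurable (A n)) -> measurable (A' A n).
  by rewrite /A'; case: eqP.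
have rectE ns A : all (fun n => z + 1 < n) ns ->
    rect (z + 1 :: ns) (A' A) = [set w | B (Y (z + 1) w)] `&` rect ns A.
  move=> /allP zn; apply/predeqP => w; split=> [H|[Bw H] n].
    split; first by have := H (z + 1) (mem_head _ _); rewrite /A' eqxx.
    move=> n ns_n; have := H n; rewrite inE ns_n orbT /A' => /(_ isT).
    by case: eqP => // nz; have := zn n ns_n; rewrite nz ltxx.
  rewrite inE /A'; case: eqP => [->//|_] /= /H; exact.
have probE ns A : uniq ns -> all (fun n => z + 1 < n) ns ->
    (forall n, measurable (A n)) ->
    prb (F `&` [set w | B (Y (z + 1) w)] `&` rect ns A) =
    prb F * prb [set w | B (Y 0 w)] * prb (rect ns A).
  move=> us zn mA; rewrite -setIA -rectE // pF.
  - rewrite -mulrA; congr (_ * _); rewrite !prb_rect //=.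
      rewrite big_cons {1}/A' eqxx; congr (_ * _); apply: eq_big_seq => n ns_n.
      rewrite /A'; case: eqP => // nz.
      by move/allP: zn => /(_ n ns_n); rewrite nz ltxx.
    by rewrite us andbT; apply/negP => /(allP zn); rewrite ltxx.
    by move=> n; apply: mA'.
  - by rewrite /= us andbT; apply/negP => /(allP zn); rewrite ltxx.
  - rewrite /= ltrDl ltr01 /=; apply/allP => n /(allP zn); lia.
  - by move=> n; apply: mA'.
have eqF : prb (F `&` [set w | B (Y (z + 1) w)]) = prb F * prb [set w | B (Y 0 w)].
  have := probE [::] (fun=> setT) isT isT (fun=> measurableT).
  have -> : rect [::] (fun=> setT) = setT by apply/predeqP.
  by rewrite setIT prbT mulr1.
split=> //; split.
  by apply: measurableI => //; apply: measurable_coord.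
by move=> ns A us zn mA; rewrite probE // eqF.
Qed.

Lemma past_mono z k F : past z F -> past (z + k%:Z) F.
Proof.
move=> pF; elim: k => [|k IH]; first by rewrite addr0.
rewrite (_ : z + k.+1%:Z = z + k%:Z + 1); last by lia.
have [] := past_step IH measurableT.
rewrite (_ : F `&` _ = F) //; apply/predeqP => w; split=> [[]|] //.
Qed.

Lemma past_diff z F G : past z F -> past z G -> G `<=` F -> past z (F `\` G).
Proof.
move=> [mF pF] [mG pG] GF; split; first exact: measurableD.
move=> ns A us zn mA; have mR := measurable_rect ns mA.
rewrite setIC setIDA prbD //; last exact: measurableI.
rewrite (setIC _ F) pF // prbD // (setIidr GF).
rewrite -setIA (setIC _ G) setIA (setIidr GF) pG //; ring.
Qed.
End Past.

Lemma size_leq_sumn e : all (fun t => 0 < t)%N e -> (size e <= sumn e)%N.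
Proof. by elim: e => //= t e IH /andP[t0 /IH]; lia. Qed.

Lemma mem_leq_sumn t e : t \in e -> (t <= sumn e)%N.
Proof.
by elim: e => //= t' e IH; rewrite inE => /orP[/eqP->|/IH]; lia.
Qed.

Section LetterMeasurability.
Variables (d : measure_display) (Omega : measurableType d).
Variables (dS : measure_display) (S : measurableType dS) (Y : int -> Omega -> S).
Hypothesis mY : forall n A, measurable A -> measurable [set w | A (Y n w)].
Variables (m : nat) (bit : S -> bool) (word : nat -> S -> seq nat).
Hypothesis mbit : measurable [set s | bit s].
Hypothesis mword : forall g e, measurable [set s | word g s = e].
Local Notation yw w := (fun k => Y k w).

Lemma measurable_pattern z : measurable [set w | pattern m bit (yw w) z].
Proof.
rewrite [X in measurable X](_ : _ = [set w | bit (Y z w) /\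
    forall j : nat, (0 < j < m)%N -> ~ bit (Y (z - j%:Z) w)]).
  apply: mset_and; first exact: (mY _ mbit).
  apply: mset_all => j; apply: mset_impl; apply: mset_not.
  exact: (mY _ mbit).
apply/predeqP => w; split=> [/patternP[b h]|[b h]].
  by split=> // j jm; apply/negP/h.
by apply/patternP; split=> // j jm; apply/negP/h.
Qed.

Lemma measurable_excursion z e : measurable [set w | excursion m bit word (yw w) z e].
Proof.
rewrite [X in measurable X](_ : _ = [set w | (m <= sumn e)%N /\
   (pattern m bit (yw w) (z + (sumn e)%:Z) /\
   ((forall n : nat, (m <= n < sumn e)%N -> ~ pattern m bit (yw w) (z + n%:Z)) /\
    word (sumn e) (Y (z + (sumn e)%:Z) w) = e))]).
  apply: mset_and; first exact: mset_prop.
  apply: mset_and; first exact: measurable_pattern.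
  apply: mset_and.
    apply: mset_all => n; apply: mset_impl; apply: mset_not.
    exact: measurable_pattern.
  exact: (mY _ (mword (sumn e) e)).
apply/predeqP => w; split=> [[h1 h2 h3 h4]|[h1 [h2 [h3 h4]]]].
  by split=> //; split=> //; split=> // n hn; apply/negP/h3.
by split=> // n hn; apply/negP/h3.
Qed.
End LetterMeasurability.

(** * Probabilities of excursions and chains from a given time on *)

Section ForwardLaw.
Variables (d : measure_display) (Omega : measurableType d) (R : realType).
Variable P : probability Omega R.
Variables (dS : measure_display) (S : measurableType dS) (Y : int -> Omega -> S).
Hypothesis HY : iid_process P Y.
Local Notation prb := (prb P).
Local Notation past := (past P Y).
Local Notation yw w := (fun k => Y k w).
Variables (m : nat) (dl : R) (bit : S -> bool) (word : nat -> S -> seq nat).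
Hypothesis m0 : (0 < m)%N.
Hypothesis dl01 : 0 < dl < 1.
Hypothesis mbit : measurable [set s | bit s].
Hypothesis mword : forall g e, measurable [set s | word g s = e].
Hypothesis Pbit : prb [set w | bit (Y 0 w)] = dl.
Local Notation a := (dl * (1 - dl) ^+ m.-1).
Local Notation s := (gap_tail m a).
Local Notation pat := (pattern m bit).

Let mpattern z : measurable [set w | pat (yw w) z].
Proof. by apply: (measurable_pattern (measurable_coord HY)). Qed.

Definition no_pattern (z : int) (N : nat) : set Omega :=
  [set w | forall n : nat, (m <= n <= N)%N -> ~ pat (yw w) (z + n%:Z)].

Lemma measurable_no_pattern z N : measurable (no_pattern z N).
Proof.
apply: mset_all => n; apply: mset_impl; apply: mset_not.
exact: mpattern.
Qed.

Definition zeros (z : int) (N : nat) : set Omega :=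
  [set w | forall n : nat, (0 < n <= N)%N -> ~ bit (Y (z + n%:Z) w)].

Lemma past_zeros z F N : past z F -> past (z + N%:Z) (F `&` zeros z N) /\
  prb (F `&` zeros z N) = prb F * (1 - dl) ^+ N.
Proof.
move=> pF; elim: N => [|N [IH1 IH2]].
  have -> : zeros z 0 = setT by apply/predeqP => w; split=> // _ n; lia.
  by rewrite setIT addr0 expr0 mulr1.
have mnb : measurable [set s | ~ bit s] by exact: mset_not.
have [] := past_step HY IH1 mnb.
have -> : F `&` zeros z N `&` [set w | [set s | ~ bit s] (Y (z + N%:Z + 1) w)] =
    F `&` zeros z N.+1.
  rewrite -setIA; congr setI; apply/predeqP => w; split.
    move=> [H b] n nN; have [nN'|nN'] := leqP n N; first by apply: H; lia.
    by rewrite (_ : z + n%:Z = z + N%:Z + 1) //; lia.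
  move=> H; split; first by move=> n nN; apply: H; lia.
  by rewrite (_ : z + N%:Z + 1 = z + N.+1%:Z); [apply: H|]; lia.
rewrite (_ : z + N%:Z + 1 = z + N.+1%:Z); last by lia.
move=> ? ->; split=> //; rewrite IH2 exprSr mulrA; congr (_ * _).
rewrite -Pbit -(prbT P) -[X in _ = _ - prb X]setTI -prbD // ?setTD //.
exact: (measurable_coord HY _ mbit).
Qed.

(** Taking [B] inside the bit event allows the word on the last letter of the pattern to be
    prescribed together with the pattern. *)
Lemma past_pattern z F B : past z F -> measurable B -> B `<=` [set s | bit s] ->
  let E := [set w | pat (yw w) (z + m%:Z) /\ B (Y (z + m%:Z) w)] in
  past (z + m%:Z) (F `&` E) /\
  prb (F `&` E) = prb F * ((1 - dl) ^+ m.-1 * prb [set w | B (Y 0 w)]).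
Proof.
move=> pF mB bB E; have [p1 p2] := past_zeros m.-1 pF.
have [] := past_step HY p1 mB.
have zm : z + m.-1%:Z + 1 = z + m%:Z by lia.
have -> : F `&` zeros z m.-1 `&` [set w | B (Y (z + m.-1%:Z + 1) w)] = F `&` E.
  rewrite zm -setIA; congr setI; apply/predeqP => w; split=> -[].
    move=> H b; split=> //; apply/patternP; split; first exact: bB.
    move=> j jm; apply/negP; have := H (m - j)%N ltac:(lia).
    by rewrite (_ : z + (m - j)%N%:Z = z + m%:Z - j%:Z) //; lia.
  move=> /patternP[_ H] b; split=> // n nm; apply/negP.
  have := H (m - n)%N ltac:(lia).
  by rewrite (_ : z + m%:Z - (m - n)%N%:Z = z + n%:Z) //; lia.
by rewrite zm p2 mulrA.
Qed.

(** This realizes the recursion of [gap_tail]: from the event for [N], remove a first occurrence at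
    [N.+1]. Non-overlap excludes occurrences in the [m - 1] positions before it, so only absence up
    to [N.+1 - m] has to be required, and this is independent of the [m] letters of the pattern. *)
Lemma past_no_pattern z F N : past z F ->
  past (z + N%:Z) (F `&` no_pattern z N) /\
  prb (F `&` no_pattern z N) = prb F * s N.+1.
Proof.
move=> pF; elim/ltn_ind: N => N IH.
have [Nm|mN] := ltnP N m.
  have -> : no_pattern z N = setT.
    by apply/predeqP => w; split=> // _ n; lia.
  by rewrite setIT gap_tail_le // mulr1; split=> //; apply: past_mono.
case: N IH mN => [|N] IH mN; first by lia.
have [h1 h2] := IH N (ltnSn N).
have [k1 k2] := IH (N.+1 - m)%N ltac:(lia).
have [] := past_pattern k1 mbit (@subset_refl _ _).
rewrite (_ : z + (N.+1 - m)%N%:Z + m%:Z = z + N.+1%:Z); last by lia.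
set E := [set w | _] => l1 l2.
have -> : F `&` no_pattern z N.+1 = (F `&` no_pattern z N) `\` (F `&` no_pattern z (N.+1 - m) `&` E).
  apply/predeqP => w; split.
    move=> [Fw H]; split.
      by split=> // n nN; apply: H; lia.
    by move=> [_ [pw _]]; apply: (H N.+1) => //; lia.
  move=> [[Fw H] nE]; split=> // n nN.
  have [nN'|nN'] := leqP n N; first by apply: H; lia.
  have -> : n = N.+1 by lia.
  move=> pw; apply: nE; split; last by split=> //; have [] := patternP _ _ _ _ pw.
  by split=> // k kN; apply: H; lia.
have sub : F `&` no_pattern z (N.+1 - m) `&` E `<=` F `&` no_pattern z N.
  move=> w [[Fw H] [pw _]]; split=> // n nN.
  have [nN'|nN'] := leqP n (N.+1 - m)%N; first by apply: H; lia.
  have jm : (0 < N.+1 - n < m)%N by lia.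
  have := pattern_no_overlap jm pw.
  by rewrite (_ : z + N.+1%:Z - (N.+1 - n)%N%:Z = z + n%:Z) //; [move/negP | lia].
split.
  apply: past_diff => //.
  by rewrite (_ : z + N.+1%:Z = z + N%:Z + 1%N%:Z); [apply: past_mono | lia].
rewrite prbD; [|by case: h1|by case: l1].
rewrite (setIidr sub) h2 l2 k2 Pbit (@gap_tailS _ _ _ N.+1) //.
rewrite (_ : (N.+2 - m = (N.+1 - m).+1)%N); last by lia.
ring.
Qed.

Variable p : nat -> R.
Local Notation exc_wt := (exc_wt p m a).
Local Notation partial_wt := (partial_wt p m a).
Local Notation exc := (excursion m bit word).
Hypothesis spos : forall t, 0 < s t.
Hypothesis p_ge0 : forall t, 0 <= p t.
Hypothesis p_le1 : forall M, \sum_(t < M) p t.+1 <= 1.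
Hypothesis w_ge0 : forall n, 0 <= unstopped p m a n.
Hypothesis word_comp : forall g x, word g x \in compositions g.
Hypothesis Pword : forall g e, (m <= g)%N -> e \in compositions g ->
  prb [set w | bit (Y 0 w) /\ word g (Y 0 w) = e] = dl * (exc_wt e / gap_law m a g).

Let a0 : 0 < a.
Proof. by case/andP: dl01 => h1 h2; rewrite mulr_gt0 // exprn_gt0 // subr_gt0. Qed.

Let mexcursion z e : measurable [set w | exc (yw w) z e].
Proof. by apply: (measurable_excursion (measurable_coord HY)). Qed.

(** The gap equals [sumn e] with probability [gap_law], and the letter at its end selects [e] with
    conditional probability [exc_wt e / gap_law]; the factors [gap_law] cancel. Below [m] both sides
    vanish. *)
Lemma past_excursion z F e : past z F -> all (fun t => 0 < t)%N e ->
  past (z + (sumn e)%:Z) (F `&` [set w | exc (yw w) z e]) /\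
  prb (F `&` [set w | exc (yw w) z e]) = prb F * exc_wt e.
Proof.
move=> pF e0; set g := sumn e.
have [gm|mg] := ltnP g m.
  have -> : [set w | exc (yw w) z e] = set0.
    by apply/predeqP => w; split=> // -[]; rewrite -/g; lia.
  rewrite setI0 prb0 exc_wt_lt // mulr0; split=> //; split=> // ns A _ _ _.
  by rewrite set0I prb0 mul0r.
have [h1 h2] := past_no_pattern (g - m) pF.
pose B := [set x | bit x /\ word g x = e].
have mB : measurable B by exact: mset_and.
have [] := past_pattern h1 mB; first by move=> x [].
rewrite (_ : z + (g - m)%N%:Z + m%:Z = z + g%:Z); last by lia.
have -> : F `&` no_pattern z (g - m) `&`
    [set w | pat (yw w) (z + g%:Z) /\ B (Y (z + g%:Z) w)] =
    F `&` [set w | exc (yw w) z e].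
  rewrite -setIA; congr setI; apply/predeqP => w; split.
    move=> [H [pw [_ we]]]; split=> // n ng.
    have [nN|nN] := leqP n (g - m)%N; first by apply/negP/H; lia.
    have jm : (0 < g - n < m)%N by lia.
    have := pattern_no_overlap jm pw.
    by rewrite (_ : z + g%:Z - (g - n)%N%:Z = z + n%:Z) //; lia.
  move=> [_ pw H we]; split; last first.
    by split=> //; split=> //; have [] := patternP _ _ _ _ pw.
  by move=> n nN; apply/negP/H; rewrite -/g; lia.
move=> q1 ->; split=> //.
rewrite h2 Pword //; last by rewrite mem_compositions e0 eqxx.
rewrite {1}/gap_law mg (_ : ((g - m).+1 = g.+1 - m)%N); last by lia.
have := spos (g.+1 - m); move: (s _) => sg sg0.
case/andP: dl01 => d0 d1.
by field; rewrite !gt_eqF // exprn_gt0 // subr_gt0.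
Qed.

Definition bounded_extension (z : int) (M d : nat) (pr : seq nat) : set Omega :=
  [set w | exists r, [/\ (0 < size r <= d)%N, all (fun t => 0 < t <= M)%N r &
     exc (yw w) z (pr ++ r)]].

Lemma measurable_extension_cond z pr (Q : seq nat -> Prop) :
  measurable [set w | exists r, Q r /\ exc (yw w) z (pr ++ r)].
Proof.
apply: mset_ex => r; apply: mset_and; first exact: mset_prop.
exact: mexcursion.
Qed.

Lemma measurable_bounded_extension z M k pr : measurable (bounded_extension z M k pr).
Proof.
rewrite [X in measurable X](_ : _ = [set w | exists r,
   ((0 < size r <= k)%N /\ all (fun t => 0 < t <= M)%N r) /\ exc (yw w) z (pr ++ r)]).
  exact: measurable_extension_cond.
by apply/predeqP => w; split=> [[r [? ? ?]]|[r [[? ?] ?]]]; exists r.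
Qed.

(** Split on the first jump of the extension and on whether the excursion ends there; the cases are
    disjoint because at most one excursion starts at [z]. *)
Lemma prb_bounded_extension z F M k pr : past z F -> all (fun t => 0 < t)%N pr ->
  prb (F `&` bounded_extension z M k pr) = prb F * ext_wt p m a M k pr.
Proof.
move=> pF; have [mF _] := pF; elim: k pr => [|k IH] pr pr0 /=.
  have -> : bounded_extension z M 0 pr = set0.
    by apply/predeqP => w; split=> // -[r [h _ _]]; lia.
  by rewrite setI0 prb0 mulr0.
pose G t := F `&` ([set w | exc (yw w) z (rcons pr t.+1)] `|`
                   bounded_extension z M k (rcons pr t.+1)).
have mG t : measurable (G t).
  apply: measurableI => //; apply: measurableU; first exact: mexcursion.
  exact: measurable_bounded_extension.
have -> : F `&` bounded_extension z M k.+1 pr = [set w | exists2 t, t \in iota 0 M & G t w].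
  apply/predeqP => w; split.
    move=> [Fw [r [sr rM e]]]; case: r sr rM e => [|[|t] r] //= sr /andP[tM rM] e.
    exists t; first by rewrite mem_iota.
    split=> //; case: r => [|t' r] in sr rM e *; first by left; rewrite /mkset -cats1.
    by right; exists (t' :: r); split=> //; rewrite cat_rcons.
  move=> [t tM [Fw]]; rewrite mem_iota add0n /= in tM.
  case=> [e|[r [sr rM e]]]; split=> //.
    by exists [:: t.+1]; split; rewrite /= ?tM ?cats1.
  by exists (t.+1 :: r); split; rewrite /= ?tM -?cat_rcons //; case/andP: sr.
rewrite prb_exists_seq ?iota_uniq //; last first.
  have G_exc t w : G t w -> exists r, exc (yw w) z (rcons pr t.+1 ++ r).
    by case=> _ [e|[r [_ _ e]]]; [exists [::]; rewrite cats0 | exists r].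
  move=> i j w _ _ /G_exc[r e] /G_exc[r' e'].
  have := excursion_inj e e'; rewrite !cat_rcons => /eqP.
  by rewrite eqseq_cat // eqxx /= => /eqP[].
rewrite mulr_sumr (_ : iota 0 M = index_iota 0 M) ?big_mkord; last by rewrite /index_iota subn0.
apply: eq_bigr => t _.
have pr0' : all (fun t => 0 < t)%N (rcons pr t.+1) by rewrite all_rcons.
have [_ e1] := past_excursion pF pr0'.
rewrite /G setIUr prbU.
- by rewrite e1 IH // mulrDr.
- by apply: measurableI => //; apply: mexcursion.
- by apply: measurableI => //; apply: measurable_bounded_extension.
rewrite -subset0 => w [[_ e] [_ [r [sr _ e']]]].
have := excursion_inj e e'; rewrite -[LHS]cats0 => /eqP.
by rewrite eqseq_cat // eqxx /=; case: r sr {e'}.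
Qed.

Lemma excursion_exists w z N : ~ no_pattern z N w ->
  exists e, [/\ exc (yw w) z e, all (fun t => 0 < t)%N e & (sumn e <= N)%N].
Proof.
move=> nN.
have ex : exists n, (m <= n <= N)%N && pat (yw w) (z + n%:Z).
  apply: contrapT => h; apply: nN => n nN pn; apply: h.
  by exists n; rewrite nN.
have [n /andP[nN' pn] nmin] := ex_minnP ex.
have := word_comp n (Y (z + n%:Z) w); rewrite mem_compositions.
case/andP=> e0 /eqP se; exists (word n (Y (z + n%:Z) w)); split=> //; last first.
  by rewrite se; lia.
split; rewrite se //; first by lia.
move=> k kn; apply/negP => pk; have := nmin k; rewrite pk andbT.
by move=> /(_ ltac:(lia)); lia.
Qed.

(** A mark at a distance between [m] and [M] yields an excursion of total length at most [M], hence
    with at most [M] jumps, each at most [M]. Only the event without such a mark, of probability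
    [s M.+1], is missed. *)
Lemma ext_wt_nil_ge M : 1 - s M.+1 <= ext_wt p m a M M [::].
Proof.
have [_ h] := past_no_pattern M (past_setT P Y 0).
have := prb_bounded_extension M M (past_setT P Y 0) (isT : all (fun t => 0 < t)%N [::]).
rewrite prbT !mul1r => <-; rewrite prbT mul1r setTI in h.
rewrite setTI -h -(prbT P) -[X in _ - prb X]setTI -prbD //; last exact: measurable_no_pattern.
apply: prb_le.
- by apply: measurableD => //; apply: measurable_no_pattern.
- exact: measurable_bounded_extension.
move=> w [_ /excursion_exists[e [ee e0 eM]]]; exists e; split=> //.
  rewrite (leq_trans (size_leq_sumn e0) eM) andbT lt0n size_eq0; apply/eqP => e00.
  by case: ee; rewrite e00 /=; lia.
apply/allP => t te; move/allP: e0 => /(_ t te) -> /=.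
exact: leq_trans (mem_leq_sumn te) eM.
Qed.

Lemma gap_tail_cvg0 : s @ \oo --> (0 : R).
Proof.
have a1 := gap_tail_lt1 m0 a0 spos.
have h : (fun n => (1 - a) ^+ n) @ \oo --> (0 : R).
  by apply: cvg_expr; rewrite ger0_norm ?subr_ge0 ?ltW // gtrBl.
have {}h : (fun n => (1 - a) ^+ (n - m)) @ \oo --> (0 : R).
  rewrite -(cvg_shiftn m); under eq_fun do rewrite addnK.
  exact: h.
apply: (squeeze_cvgr _ (cvg_cst 0) h); near=> n.
by rewrite (ltW (spos n)) /= gap_tail_geom.
Unshelve. all: by end_near.
Qed.

(* By [ext_wt_defect_nil], at most the probability [s G.+1] that the first gap
   exceeds [G] is missing from the extensions of total length at most [G]. *)
Lemma prb_extension z F pr : past z F -> all (fun t => 0 < t)%N pr ->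
  prb (F `&` [set w | exists r, r <> [::] /\ exc (yw w) z (pr ++ r)]) =
  prb F * partial_wt 0 pr.
Proof.
move=> pF pr0; set E := [set w | _]; have [mF _] := pF.
have mE : measurable E by exact: measurable_extension_cond.
have F1 := prb_le1 P mF; have F0 := prb_ge0 P F.
suff bound n : (sumn pr + size pr <= n)%N ->
    `|prb F * partial_wt 0 pr - prb (F `&` E)| <= s n.+1.
  have : (fun n => s n.+1) @ \oo --> (0 : R).
    by rewrite (cvg_shiftS s); exact: gap_tail_cvg0.
  move=> h; apply/eqP; rewrite eq_sym -subr_eq0 -normr_le0.
  rewrite -(cvg_lim _ h) //; apply: limr_ge; first by apply/cvg_ex; exists 0.
  by exists (sumn pr + size pr)%N => // n /= hn; exact: bound.
move=> hn; have [_ hN] := past_no_pattern n pF.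
have hB := prb_bounded_extension n (n - size pr) pF pr0.
have mB := measurable_bounded_extension z n (n - size pr) pr.
have mN := measurable_no_pattern z n.
have le1 : prb (F `&` bounded_extension z n (n - size pr) pr) <= prb (F `&` E).
  apply: prb_le; [exact: measurableI | exact: measurableI |].
  move=> w [Fw [r [sr _ e]]]; split=> //; exists r; split=> //.
  by case: r sr {e}.
have le2 : prb (F `&` E) <= prb (F `&` bounded_extension z n (n - size pr) pr)
    + prb (F `&` no_pattern z n).
  apply: le_trans (prbU_le P _ _); [|exact: measurableI|exact: measurableI].
  apply: prb_le; [exact: measurableI | apply: measurableU; exact: measurableI |].
  move=> w [Fw [r [rn e]]].
  have [nN|/excursion_exists[e' [ee' e'0 e'n]]] := pselect (no_pattern z n w); first by right.
  left; split=> //; exists r.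
  have E' := excursion_inj ee' e; rewrite {}E' {ee'} in e'0 e'n.
  rewrite all_cat in e'0; case/andP: e'0 => _ r0; rewrite sumn_cat in e'n.
  have sz := size_leq_sumn r0.
  have szp := size_leq_sumn pr0.
  split=> //; first by case: r rn {e r0} sz e'n => //= t r _; lia.
  apply/allP => t tr; move/allP: r0 => /(_ t tr) -> /=.
  by have := mem_leq_sumn tr; lia.
have q0 n' : 0 <= gap_law m a n' by apply: gap_law_ge0.
have x1 := ext_wt_le p_ge0 w_ge0 q0 (p_le1 n) (n - size pr) pr.
have prn : all (fun t => 0 < t <= n)%N pr.
  apply/allP => t tr; move/allP: pr0 => /(_ t tr) -> /=.
  by have := mem_leq_sumn tr; lia.
have x2 := ext_wt_defect_nil p_ge0 w_ge0 q0 (p_le1 n) (n - size pr) prn.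
have x3 := ext_wt_nil_ge n.
rewrite subnK in x2; last exact: leq_trans (leq_addl _ _) hn.
rewrite hB in le1 le2; rewrite hN in le2.
have s0 := spos n.+1.
set H := ext_wt _ _ _ _ _ pr in x1 x2 le1 le2.
set H0 := ext_wt _ _ _ _ _ _ in x2 x3.
have d1 : 0 <= partial_wt 0 pr - H <= s n.+1 by lra.
have y1 : prb F * (partial_wt 0 pr - H) <= s n.+1.
  apply: le_trans (_ : 1 * s n.+1 <= _); last by rewrite mul1r.
  by apply: ler_pM => //; lra.
have y2 : 0 <= prb F * (partial_wt 0 pr - H) by apply: mulr_ge0 => //; lra.
have y3 : prb F * s n.+1 <= s n.+1 by rewrite ler_piMl // ltW.
by rewrite ler_norml; apply/andP; split; lra.
Qed.

Lemma measurable_chain z pr ts : measurable [set w | chain m bit word (yw w) z pr ts].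
Proof.
elim: ts z pr => [|t ts IH] z pr /=.
  exact: measurable_extension_cond.
apply: mset_or => //; apply: mset_and => //; exact: mexcursion.
Qed.

(* A jump [t] after [pr] either ends the excursion or continues it, and the two
   weights add up to [partial_wt 0 pr * p t]; the labels thus telescope away. *)
Lemma prb_chain z F pr ts : past z F ->
  all (fun t => 0 < t)%N pr -> all (fun t => 0 < t)%N ts ->
  prb (F `&` [set w | chain m bit word (yw w) z pr ts]) =
  prb F * partial_wt 0 pr * \prod_(t <- ts) p t.
Proof.
elim: ts z F pr => [|t ts IH] z F pr pF pr0 /=.
  by move=> _; rewrite big_nil mulr1 prb_extension.
case/andP=> t0 ts0; have [mF _] := pF.
have pr0' : all (fun t => 0 < t)%N (rcons pr t) by rewrite all_rcons t0.
have [e1 e2] := past_excursion pF pr0'.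
rewrite (_ : F `&` _ =
  (F `&` [set w | chain m bit word (yw w) z (rcons pr t) ts]) `|`
  (F `&` [set w | exc (yw w) z (rcons pr t)] `&`
   [set w | chain m bit word (yw w) (z + (sumn (rcons pr t))%:Z) [::] ts])); last first.
  apply/predeqP => w; split; first by move=> [Fw [c|[ew c]]]; [left | right].
  by case=> [[Fw c]|[[Fw ew] c]]; split=> //; [left | right].
have mc := measurable_chain.
rewrite prbU; last first.
- rewrite -subset0 => w [[_ /chain_excursion[r [r0 er]]] [[_ ew] _]].
  have := excursion_inj ew er; rewrite -[LHS]cats0 => /eqP.
  by rewrite eqseq_cat // eqxx /= => /eqP/esym.
- by apply: measurableI => //; case: e1.
- exact: measurableI.
rewrite IH // IH // e2 /= big_cons mulr1.
have := partial_exc_wt p m a pr t.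
move=> h; rewrite -mulrDl -mulrDr h; ring.
Qed.

End ForwardLaw.

(** * Comparison of renewal processes *)

Lemma scanl_addn x y ts : scanl addn (x + y)%N ts = [seq (x + k)%N | k <- scanl addn y ts].
Proof. by elim: ts y => //= t ts IH y; rewrite -addnA IH. Qed.

Lemma mem_partial_sums_cons k t ts : (k \in scanl addn 0%N (t :: ts)) =
  (k == t) || (t <= k)%N && ((k - t)%N \in scanl addn 0%N ts).
Proof.
rewrite /= inE add0n; congr orb; rewrite -{1}[t]addn0 scanl_addn.
apply/mapP/andP => [[j js ->]|[tk js]]; first by rewrite leq_addr addKn.
by exists (k - t)%N; rewrite // subnKC.
Qed.

Lemma foldl_addn x ts : foldl addn x ts = (x + sumn ts)%N.
Proof. by elim: ts x => [|t ts IH] x /=; rewrite ?addn0 // IH addnA. Qed.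

Lemma partial_sums_rcons ts t :
  scanl addn 0%N (rcons ts t) = rcons (scanl addn 0%N ts) (sumn ts + t)%N.
Proof. by rewrite scanl_rcons foldl_addn add0n sumn_rcons. Qed.

Lemma mem_partial_sums_le k ts : k \in scanl addn 0%N ts -> (k <= sumn ts)%N.
Proof.
elim/last_ind: ts => [//|ts t IH]; rewrite partial_sums_rcons mem_rcons inE sumn_rcons.
by case/orP => [/eqP->|/IH]; lia.
Qed.

Lemma eq_false_iff (b : bool) : b = false <-> ~ b.
Proof. by case: b; split. Qed.

Section Words.
Variables (Omega : Type) (X : int -> Omega -> bool).

Definition word_event (m : int) (b : seq bool) : set Omega :=
  [set w | forall i : nat, (i < size b)%N -> X (m + i%:Z) w = nth false b i].

Definition gaps_then_zeros (m : int) (ts : seq nat) (j : nat) : set Omega :=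
  [set w | gaps_after X m 0 ts w /\
    forall i : nat, (i < j)%N -> X (m + (sumn ts + i.+1)%N%:Z) w = false].

Lemma word_event_rcons m b v w : word_event m (rcons b v) w <->
  word_event m b w /\ X (m + (size b)%:Z) w = v.
Proof.
split=> [H|[H Hv] i].
  split; last by have := H (size b); rewrite size_rcons nth_rcons ltnn eqxx; apply.
  by move=> i ib; have := H i; rewrite size_rcons nth_rcons ib => -> //; lia.
rewrite size_rcons nth_rcons ltnS leq_eqVlt => /orP[/eqP->|ib].
  by rewrite ltnn eqxx.
by rewrite ib; apply: H.
Qed.

Lemma word_event_cons m b v w : word_event m (v :: b) w <->
  X m w = v /\ word_event (m + 1) b w.
Proof.
split=> [H|[Hv H] [|i] ib].
- split; first by have := H 0%N isT; rewrite addr0.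
  move=> i ib; have := H i.+1 ib => /= <-; congr (X _ w); lia.
- by rewrite addr0.
- by have := H i ib => /= <-; congr (X _ w); lia.
Qed.

Lemma gaps_after_rcons m ts t w : (0 < t)%N ->
  gaps_after X m 0 (rcons ts t) w <->
  gaps_then_zeros m ts t.-1 w /\ X (m + (sumn ts + t)%N%:Z) w = true.
Proof.
move=> t0; rewrite /gaps_after -!sumnE sumn_rcons addr0; split.
  move=> [f H]; split; last first.
    by rewrite H ?partial_sums_rcons ?mem_rcons ?mem_head //; lia.
  split; first split=> //.
    rewrite -sumnE addr0 => k hk; rewrite H; last by lia.
    by rewrite partial_sums_rcons mem_rcons inE; case: eqP => //; lia.
  move=> i it; rewrite H; last by lia.
  rewrite partial_sums_rcons mem_rcons inE; apply/negP => /orP[/eqP|/mem_partial_sums_le]; lia.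
move=> [[[f H] Hz] Ht]; split=> // k hk; rewrite partial_sums_rcons mem_rcons inE.
rewrite -sumnE addr0 in H.
have [kt|kt] := leqP k (sumn ts).
  by rewrite H; [case: eqP => //; lia | lia].
have [->|kt'] /= := eqVneq k (sumn ts + t)%N; first by rewrite Ht.
have := Hz (k - sumn ts).-1 ltac:(lia).
rewrite (_ : (sumn ts + (k - sumn ts).-1.+1)%N = k); last by lia.
by move=> ->; apply/esym/negP => /mem_partial_sums_le; lia.
Qed.

Lemma gaps_then_zerosS m ts j w : gaps_then_zeros m ts j.+1 w <->
  gaps_then_zeros m ts j w /\ X (m + (sumn ts + j.+1)%N%:Z) w = false.
Proof.
split=> [[g H]|[[g H] Hj]].
  by split; [split=> // i ij; apply: H; lia | apply: H].
split=> // i; rewrite ltnS leq_eqVlt => /orP[/eqP->//|]; exact: H.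
Qed.
End Words.

(** The quantifiers over [Omega] and [X] come after [ts] and [j]: the translation of a word into
    gaps and trailing zeros is the same for all processes, which makes the coefficients below
    universal. *)
Lemma word_gaps b : exists ts j, all (fun t => 0 < t)%N ts /\
  (sumn ts + j)%N = size b /\
  forall (Omega : Type) (X : int -> Omega -> bool) m w,
    word_event X m (true :: b) w <-> gaps_then_zeros X m ts j w.
Proof.
elim/last_ind: b => [|b v [ts [j [ts0 [sj IH]]]]].
  exists [::], 0%N; split=> //; split=> // Omega X m w; split.
    move=> H; split=> //; split; first by split=> //; apply: (H 0%N).
    by rewrite big_nil => k; lia.
  by move=> [[[_ h] _] _] [|i] //= _.
case: v; last first.
  exists ts, j.+1; split=> //; split; first by rewrite size_rcons -sj addnS.
  move=> Omega X m w; rewrite -rcons_cons word_event_rcons IH gaps_then_zerosS.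
  by rewrite /= addnS sj.
exists (rcons ts j.+1), 0%N; split; first by rewrite all_rcons.
split; first by rewrite sumn_rcons size_rcons -sj addn0 addnS.
move=> Omega X m w; rewrite -rcons_cons word_event_rcons IH.
have := @gaps_after_rcons _ X m ts j.+1 w isT; rewrite /= addnS sj => h.
by split=> [/h g|[/h g _]]; [split | ].
Qed.

Section RenewalLike.
Variables (R : realType) (p : nat -> R).

(** All that the comparison uses about either process. With [ts = [::]] the second clause says that
    [c] is the probability of a 1 at any site; the values of [c] for two processes are not assumed
    equal. *)
Definition renewal_like (d : measure_display) (Omega : measurableType d)
    (P : probability Omega R) (X : int -> Omega -> bool) (c : R) : Prop :=
  [/\ forall n, measurable [set w | X n w],
      forall m ts, all (fun t => 0 < t)%N ts ->
        prb P (gaps_after X m 0 ts) = c * \prod_(t <- ts) p t &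
      forall m, (fun N => prb P (word_event X m (nseq N false))) @ \oo --> (0 : R)].

Lemma measurable_value (d : measure_display) (Omega : measurableType d)
    (X : int -> Omega -> bool) n v : (forall n, measurable [set w | X n w]) ->
  measurable [set w | X n w = v].
Proof.
move=> mX; case: v; first exact: mX.
rewrite [X in measurable X](_ : _ = [set w | ~ X n w]); first exact: mset_not.
by apply/predeqP => w; apply: eq_false_iff.
Qed.

Lemma measurable_word_event (d : measure_display) (Omega : measurableType d)
    (X : int -> Omega -> bool) m b : (forall n, measurable [set w | X n w]) ->
  measurable (word_event X m b).
Proof.
move=> mX; apply: mset_all => i; apply: mset_impl; exact: measurable_value.
Qed.

Lemma measurable_cyl (d : measure_display) (Omega : measurableType d)
    (X : int -> Omega -> bool) cs : (forall n, measurable [set w | X n w]) ->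
  measurable (cyl X cs).
Proof.
move=> mX; rewrite /cyl; elim: cs => [|[n v] us IH] /=.
  by rewrite [X in measurable X](_ : _ = setT) //; apply/predeqP.
rewrite [X in measurable X](_ : _ = [set w | X n w = v /\ cyl X us w]).
  by apply: mset_and; [exact: measurable_value | exact: IH].
by apply/predeqP => w; split=> [/andP[/eqP]|[h1 h2]] //; apply/andP; split=> //; apply/eqP.
Qed.

Lemma prb_gaps_then_zeros d (Omega : measurableType d) (P : probability Omega R) X c m ts j :
  renewal_like P X c -> all (fun t => 0 < t)%N ts ->
  measurable (gaps_then_zeros X m ts j) /\
  prb P (gaps_then_zeros X m ts j) =
    c * (\prod_(t <- ts) p t * (1 - \sum_(i < j) p i.+1)).
Proof.
move=> [mX H _] ts0.
have mg us : measurable (gaps_after X m 0 us).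
  apply: mset_and.
    apply: mset_and; last exact: mX.
    by apply: mset_all => k; apply: mset_impl; apply: measurable_value.
  by apply: mset_all => k; apply: mset_impl; apply: measurable_value.
elim: j => [|j [IH1 IH2]].
  have -> : gaps_then_zeros X m ts 0 = gaps_after X m 0 ts.
    by apply/predeqP => w; split=> [[]|].
  by split=> //; rewrite H // big_ord0 subr0 mulr1.
have E : gaps_then_zeros X m ts j.+1 =
    gaps_then_zeros X m ts j `\` gaps_after X m 0 (rcons ts j.+1).
  apply/predeqP => w; have h := @gaps_after_rcons _ X m ts j.+1 w isT.
  rewrite gaps_then_zerosS; split=> -[g g']; split=> //.
    by move=> /h[_]; rewrite g'.
  by apply/negP => g''; apply: g'; apply/h.
rewrite E; split; first exact: measurableD.
rewrite prbD // IH2 setIidr; last by move=> w /gaps_after_rcons[].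
rewrite H ?all_rcons // big_rcons /= big_ord_recr /=; ring.
Qed.

(* [kappa] does not depend on the process: two renewal-like processes assign
   proportional probabilities to the words that contain a [true]. *)
Lemma word_coefficient b : true \in b -> exists kappa, forall d
  (Omega : measurableType d) (P : probability Omega R) X c m,
  renewal_like P X c -> prb P (word_event X m b) = c * kappa.
Proof.
elim: b => // v b IH; have [ts [j [ts0 [_ Hw]]]] := word_gaps b.
have tb : exists kappa, forall d (Omega : measurableType d)
    (P : probability Omega R) X c m, renewal_like P X c ->
    prb P (word_event X m (true :: b)) = c * kappa.
  exists (\prod_(t <- ts) p t * (1 - \sum_(i < j) p i.+1)) => d Omega P X c m rX.
  have [_ <-] := prb_gaps_then_zeros m j rX ts0.
  by apply: prb_ext => w; apply: Hw.
case: v => [_ //|]; rewrite inE /= => /IH[k1 h1]; have [k2 h2] := tb.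
exists (k1 - k2) => d Omega P X c m rX; have [mX _ _] := rX.
rewrite mulrBr -(h1 _ _ P X c (m + 1)) // -(h2 _ _ P X c m) //.
have mW := measurable_word_event _ _ mX.
rewrite -[in X in _ - X](@setIidr _ (word_event X (m + 1) b) (word_event X m (true :: b))).
  rewrite -prbD //; apply: prb_ext => w; rewrite word_event_cons; split.
    by move=> [x H]; split=> //; rewrite word_event_cons x => -[].
  move=> [H nH]; split=> //; apply/negP => x; apply: nH.
  by rewrite word_event_cons.
by move=> w /word_event_cons[].
Qed.

(** Lengthening a run of zeros by one removes the word [0...01], whose probability is proportional
    to [c]. Proportionality therefore holds for the complement of the run. *)
Lemma zeros_coefficient N : exists kappa, forall d
  (Omega : measurableType d) (P : probability Omega R) X c m,
  renewal_like P X c -> 1 - prb P (word_event X m (nseq N false)) = c * kappa.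
Proof.
elim: N => [|N [k IH]].
  exists 0 => d Omega P X c m _; rewrite mulr0 (_ : word_event _ _ _ = setT).
    by rewrite prbT subrr.
  by apply/predeqP.
have [k' h] := @word_coefficient (rcons (nseq N false) true) ltac:(by rewrite mem_rcons mem_head).
exists (k + k') => d Omega P X c m rX; have [mX _ _] := rX.
have mW := measurable_word_event _ _ mX.
rewrite mulrDr -(IH _ _ P X c m) // -(h _ _ P X c m) //.
rewrite (_ : nseq N.+1 false = rcons (nseq N false) false); last first.
  by elim: N {IH h} => //= N {1}->.
rewrite (prb_split P (mW m (nseq N false)) (mW m (rcons (nseq N false) true))).
rewrite setIidr; last by move=> w /word_event_rcons[].
rewrite (_ : word_event X m (rcons (nseq N false) false) =
  word_event X m (nseq N false) `&` ~` word_event X m (rcons (nseq N false) true)).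
  by ring.
apply/predeqP => w; split.
  move=> /word_event_rcons[H x]; split=> // /word_event_rcons[_].
  by rewrite x.
move=> [H nH]; apply/word_event_rcons; split=> //; apply/negP => x; apply: nH.
exact/word_event_rcons.
Qed.

Variables (d1 d2 : measure_display) (O1 : measurableType d1) (O2 : measurableType d2).
Variables (P1 : probability O1 R) (P2 : probability O2 R).
Variables (X1 : int -> O1 -> bool) (X2 : int -> O2 -> bool) (c1 c2 : R).
Hypothesis H1 : renewal_like P1 X1 c1.
Hypothesis H2 : renewal_like P2 X2 c2.

(* The probability of seeing a [true] in a long window tends to 1, which forces
   the factor of proportionality to be 1. *)
Lemma renewal_like_const : c1 = c2.
Proof.
have [k hk] : exists k : nat -> R, forall N, 
    1 - prb P1 (word_event X1 0 (nseq N false)) = c1 * k N /\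
    1 - prb P2 (word_event X2 0 (nseq N false)) = c2 * k N.
  have /choice[k hk] := fun N => zeros_coefficient N.
  by exists k => N; split; apply: hk.
have cv1 : (fun N => c1 * k N) @ \oo --> (1 : R).
  rewrite -[X in _ --> X]subr0; under eq_fun do rewrite -(hk _).1.
  by apply: cvgB; [exact: cvg_cst | have [_ _] := H1; apply].
have cv2 : (fun N => c2 * k N) @ \oo --> (1 : R).
  rewrite -[X in _ --> X]subr0; under eq_fun do rewrite -(hk _).2.
  by apply: cvgB; [exact: cvg_cst | have [_ _] := H2; apply].
have l1 : (fun N => c1 * c2 * k N) @ \oo --> c1 * 1.
  under eq_fun do rewrite -mulrA; apply: cvgM => //; exact: cvg_cst.
have l2 : (fun N => c1 * c2 * k N) @ \oo --> c2 * 1.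
  under eq_fun do rewrite (mulrC c1) -mulrA; apply: cvgM => //; exact: cvg_cst.
have e : c1 * 1 = c2 * 1 by apply: (cvg_unique _ l1 l2).
by rewrite !mulr1 in e.
Qed.

Lemma renewal_like_word m b : prb P1 (word_event X1 m b) = prb P2 (word_event X2 m b).
Proof.
have [tb|ntb] := boolP (true \in b).
  have [k hk] := word_coefficient tb.
  by rewrite (hk _ _ _ _ _ _ H1) (hk _ _ _ _ _ _ H2) renewal_like_const.
have -> : b = nseq (size b) false.
  by apply/all_pred1P/allP => -[] // /(negP ntb).
have [k hk] := zeros_coefficient (size b).
have := hk _ _ _ _ _ m H1; rewrite renewal_like_const -(hk _ _ _ _ _ m H2); lra.
Qed.

Lemma renewal_like_cyl cs : prb P1 (cyl X1 cs) = prb P2 (cyl X2 cs).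
Proof.
have [m1X _ _] := H1; have [m2X _ _] := H2.
have mc1 := measurable_cyl cs m1X; have mc2 := measurable_cyl cs m2X.
have mW1 := measurable_word_event _ _ m1X; have mW2 := measurable_word_event _ _ m2X.
(* The word [b] fixes the start of a window containing all sites of [cs], and [k] counts the sites
   still open; at [k = 0] the word decides the cylinder. *)
suff claim m k b : all (fun c => m <= c.1 < m + (size b + k)%N%:Z) cs ->
    prb P1 (word_event X1 m b `&` cyl X1 cs) = prb P2 (word_event X2 m b `&` cyl X2 cs).
  pose N := \sum_(c <- cs) (absz c.1).+1.
  have := claim (- N%:Z) (N + N)%N [::].
  have nil d (Omega : measurableType d) (X : int -> Omega -> bool) : word_event X (- N%:Z) [::] = setT.
    by apply/predeqP.
  rewrite !nil !setTI; apply; apply/allP => -[n v] ccs /=.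
  have : (absz n < N)%N.
    by rewrite /N (big_rem _ ccs) //= leq_addr.
  by move: (N) => N' /=; clear; lia.
elim: k b => [|k IH] b hb.
  pose ok := all (fun c => nth false b (absz (c.1 - m)) == c.2) cs.
  have decided d (Omega : measurableType d) (X : int -> Omega -> bool) w :
      word_event X m b w -> cyl X cs w = ok.
    move=> H; rewrite /cyl /mkset /ok; congr is_true; apply: eq_in_all => -[n v] ccs.
    have /= := allP hb _ ccs; rewrite addn0 => cm /=.
    rewrite -H; last by clear -cm; lia.
    congr (X _ w == _); clear -cm; lia.
  have [okt|okf] := boolP ok.
    have -> : word_event X1 m b `&` cyl X1 cs = word_event X1 m b.
      by apply/predeqP => w; split=> [[]|H] //; split=> //; rewrite (decided _ _ _ _ H).
    have -> : word_event X2 m b `&` cyl X2 cs = word_event X2 m b.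
      by apply/predeqP => w; split=> [[]|H] //; split=> //; rewrite (decided _ _ _ _ H).
    exact: renewal_like_word.
  have -> : word_event X1 m b `&` cyl X1 cs = set0.
    by apply/predeqP => w; split=> // -[H]; rewrite (decided _ _ _ _ H) (negbTE okf).
  have -> : word_event X2 m b `&` cyl X2 cs = set0.
    by apply/predeqP => w; split=> // -[H]; rewrite (decided _ _ _ _ H) (negbTE okf).
  by rewrite !prb0.
have step d (Omega : measurableType d) (P : probability Omega R) (X : int -> Omega -> bool) :
    (forall n, measurable [set w | X n w]) -> measurable (cyl X cs) ->
    prb P (word_event X m b `&` cyl X cs) =
    prb P (word_event X m (rcons b true) `&` cyl X cs) +
    prb P (word_event X m (rcons b false) `&` cyl X cs).
  move=> mX mc; have mW := measurable_word_event _ _ mX.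
  rewrite -prbU; [|exact: measurableI|exact: measurableI|].
    apply: prb_ext => w; split.
      move=> [H Hc]; case x : (X (m + (size b)%:Z) w); [left|right]; split=> //;
      exact/word_event_rcons.
    by move=> [|] [/word_event_rcons[H _] Hc].
  rewrite -subset0 => w [[/word_event_rcons[_ x] _] [/word_event_rcons[_ x'] _]].
  by rewrite x in x'.
rewrite !step // !IH // size_rcons addSnnS //.
Qed.
End RenewalLike.

(** * The coding map and its window *)

Section Coding.
Variables (S : Type) (m : nat) (bit : S -> bool) (word : nat -> S -> seq nat).
Local Notation pat := (pattern m bit).
Local Notation exc := (excursion m bit word).
Hypothesis m0 : (0 < m)%N.
Hypothesis word_comp : forall g x, word g x \in compositions g.

Definition gap_at (y : int -> S) (z : int) (g : nat) : Prop :=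
  [/\ (0 < g)%N, pat y z, pat y (z + g%:Z) &
      forall n : nat, (0 < n < g)%N -> ~~ pat y (z + n%:Z)].

Definition visits (e : seq nat) (k : nat) : bool :=
  (k == 0)%N || (k \in scanl addn 0%N e).

(* The last mark at or before time [0] is at [- k], the next one at [- k + g]. *)
Definition code (y : int -> S) : bool :=
  `[< exists k g : nat, [/\ (k < g)%N, gap_at y (- k%:Z) g &
        visits (word g (y (- k%:Z + g%:Z))) k] >].

Definition coded (y : int -> S) (n : int) : bool := code (fun k => y (n + k)).

(** A mark at [- k] is read from letters down to [- k - m + 1], hence the range [k <= r - m]; marks
    at [j >= 1] stay inside the window on the left because [m <= r]. *)
Definition window_ok (r : nat) (y : int -> S) : bool :=
  [&& (m <= r)%N, has (fun k : nat => pat y (- k%:Z)) (iota 0 (r - m).+1) &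
      has (fun j : nat => pat y j%:Z) (iota 1 r)].

Definition code_radius (y : int -> S) : option nat :=
  if pselect (exists r, window_ok r y) is left h then Some (ex_minn h) else None.

Lemma pattern_shift y n z : pat (fun k => y (n + k)) z = pat y (n + z).
Proof.
by rewrite /pattern; congr andb; apply: eq_in_all => j _; rewrite addrA.
Qed.

Lemma codedP y n : coded y n <-> exists k g : nat,
  [/\ (k < g)%N, gap_at y (n - k%:Z) g & visits (word g (y (n - k%:Z + g%:Z))) k].
Proof.
have shift_gap z g : gap_at (fun k => y (n + k)) z g <-> gap_at y (n + z) g.
  by split=> -[g0 p1 p2 p3]; split=> //; rewrite ?pattern_shift ?addrA //
    in p1 p2 p3 *; move=> j /p3; rewrite pattern_shift addrA.
split=> [/asboolP[k [g [kg /shift_gap gg v]]]|[k [g [kg gg v]]]].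
  by exists k, g; split=> //; rewrite -addrA.
by apply/asboolP; exists k, g; split=> //; [apply/shift_gap | rewrite addrA].
Qed.

Lemma gap_at_unique y n z z' g g' : gap_at y z g -> gap_at y z' g' ->
  z <= n < z + g%:Z -> z' <= n < z' + g'%:Z -> z = z' /\ g = g'.
Proof.
wlog zz' : z z' g g' / z <= z'.
  move=> H h1 h2 n1 n2; case/orP: (le_total z z') => zz'.
    by apply: H h1 h2 n1 n2.
  by have [-> ->] := H _ _ _ _ zz' h2 h1 n2 n1.
move=> [g0 p1 p2 p3] [g0' p1' p2' p3'] n1 n2.
have {}zz' : z = z'.
  apply/eqP; apply: contraT => nzz'.
  have := p3 (absz (z' - z)) ltac:(lia).
  by rewrite (_ : z + (absz (z' - z))%:Z = z') ?p1' //; lia.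
rewrite -zz' in p2' p3' *; split=> //.
apply/eqP; rewrite eqn_leq; apply/andP; split; rewrite leqNgt; apply/negP => h.
  by have := p3 g'; rewrite g0' h p2' => /(_ isT).
by have := p3' g; rewrite g0 h p2 => /(_ isT).
Qed.

Lemma excursion_gap_at y z e : pat y z -> exc y z e ->
  gap_at y z (sumn e) /\ word (sumn e) (y (z + (sumn e)%:Z)) = e.
Proof.
move=> pz [ms ps ns we]; split=> //; split=> //; first by lia.
move=> n hn; have [mn|nm] := leqP m n; first by apply: ns; rewrite mn; lia.
apply/negP => pn; have nm' : (0 < n < m)%N by lia.
by have := pattern_no_overlap nm' pn; rewrite addrK pz.
Qed.

Lemma gap_at_excursion y z g : gap_at y z g ->
  exc y z (word g (y (z + g%:Z))) /\ sumn (word g (y (z + g%:Z))) = g.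
Proof.
move=> [g0 pz pg ng]; set e := word _ _.
have /andP[_ /eqP se] : all (fun t => 0 < t)%N e && (sumn e == g).
  by rewrite -mem_compositions; apply: word_comp.
split=> //; split; rewrite se //; last by move=> n hn; apply: ng; lia.
rewrite leqNgt; apply/negP => gm; have gm' : (0 < g < m)%N by lia.
by have := pattern_no_overlap gm' pg; rewrite addrK pz.
Qed.

Lemma excursion_pos y z e : exc y z e -> all (fun t => 0 < t)%N e.
Proof.
move=> [_ _ _ <-]; have := word_comp (sumn e) (y (z + (sumn e)%:Z)).
by rewrite mem_compositions => /andP[].
Qed.

Lemma coded_excursion y z e k : pat y z -> exc y z e -> (k < sumn e)%N ->
  coded y (z + k%:Z) = visits e k.
Proof.
move=> pz ee ke; have [gz we] := excursion_gap_at pz ee.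
apply/idP/idP => [/codedP[k' [g' [kg' gz' v]]]|v].
  have [] := gap_at_unique (n := z + k%:Z) gz gz'; [lia | lia |].
  move=> zz' gg'; have kk' : k = k' by lia.
  by move: v; rewrite -zz' -gg' -kk' we.
apply/codedP; exists k, (sumn e).
by rewrite addrK we; split.
Qed.

Definition two_sided (y : int -> S) : Prop := forall n : int,
  (exists k : nat, pat y (n - k%:Z)) /\ (exists k : nat, (0 < k)%N && pat y (n + k%:Z)).

Lemma two_sided_excursion y z : two_sided y -> exists e, exc y z e.
Proof.
move=> ty; have [_ [k /andP[k0 pk]]] := ty (z + m%:Z).
have ex : exists n, (m <= n)%N && pat y (z + n%:Z).
  exists (m + k)%N; rewrite leq_addr /=.
  by rewrite (_ : z + (m + k)%N%:Z = z + m%:Z + k%:Z) //; lia.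
have [n /andP[mn pn] nmin] := ex_minnP ex.
have := word_comp n (y (z + n%:Z)); rewrite mem_compositions => /andP[_ /eqP se].
exists (word n (y (z + n%:Z))); split; rewrite se //.
move=> j /andP[mj jn]; apply/negP => pj; have := nmin j; rewrite mj pj => /(_ isT).
by rewrite leqNgt jn.
Qed.

Lemma two_sided_coded y z : two_sided y -> pat y z -> coded y z.
Proof.
move=> ty pz; have [e ee] := two_sided_excursion z ty.
have [ms _ _ _] := ee.
by rewrite -[z]addr0 (coded_excursion (k := 0) pz ee) //; lia.
Qed.

Lemma visits_sumn pr r : visits (pr ++ r) (sumn pr).
Proof.
case/lastP: pr => [|pr t]; first by [].
rewrite /visits scanl_cat mem_cat partial_sums_rcons mem_rcons inE sumn_rcons eqxx.
by rewrite orbT.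
Qed.

Lemma visits_inside pr t r j : (0 < j < t)%N ->
  visits (pr ++ t :: r) (sumn pr + j) = false.
Proof.
move=> jt; have := scanl_addn (sumn pr) 0 (t :: r); rewrite addn0 => scanE.
rewrite /visits scanl_cat mem_cat foldl_addn add0n {}scanE (mem_map (@addnI _)) mem_partial_sums_cons.
apply/negP => /orP[/eqP|/orP[/mem_partial_sums_le|/orP[/eqP|/andP[]]]]; lia.
Qed.

Lemma visits_prefix e k : visits e k -> exists pr r, e = pr ++ r /\ sumn pr = k.
Proof.
elim: e k => [|t e IH] k; case/orP => [/eqP->|//].
- by exists [::], [::].
- by exists [::], (t :: e).
rewrite mem_partial_sums_cons => /orP[/eqP->|/andP[tk ke]].
  by exists [:: t], e; rewrite /= addn0.
have [pr [r [-> pk]]] := IH (k - t)%N (introT orP (or_intror ke)).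
by exists (t :: pr), r; rewrite /= pk subnKC.
Qed.

Lemma visits_split e k : (k < sumn e)%N -> visits e k ->
  exists pr r, [/\ e = pr ++ r, sumn pr = k & r <> [::]].
Proof.
move=> ke /visits_prefix[pr [r [er pk]]]; exists pr, r; split=> // r0.
by move: ke; rewrite er sumn_cat r0 pk addn0 ltnn.
Qed.

Lemma prefix_unique pr r pr' r' : all (fun t => 0 < t)%N pr ->
  all (fun t => 0 < t)%N pr' -> sumn pr = sumn pr' -> pr ++ r = pr' ++ r' -> pr = pr'.
Proof.
elim: pr pr' => [|t pr IH] [|t' pr'] //=.
- by move=> _ /andP[t0 _]; lia.
- by move=> /andP[t0 _] _; lia.
move=> /andP[_ p0] /andP[_ p0'] ss [tt ee]; congr cons => //.
by apply: IH => //; lia.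
Qed.

(** Compare the prescribed jump [t] with the next jump [x] of the running excursion. If they differ,
    the smaller one is a site where exactly one of code and prescription has a 1, and no chain
    exists because excursions are unique. If they agree, continue along the excursion, or with the
    next one when it is exhausted. *)
Lemma chain_coded y ts pr r z : two_sided y -> all (fun t => 0 < t)%N ts ->
  pat y z -> exc y z (pr ++ r) -> r <> [::] ->
  (forall k : nat, (0 < k <= sumn ts)%N ->
     coded y (z + (sumn pr)%:Z + k%:Z) = (k \in scanl addn 0%N ts)) <->
  chain m bit word y z pr ts.
Proof.
move=> ty; elim: ts pr r z => [|t ts IH] pr r z.
  by move=> _ pz er r0; split=> [_|_ k /=]; [exists r | lia].
case: r => [//|x r] /andP[t0 ts0] pz er _.
have pos := excursion_pos er.
have /andP[x0 r0] : (0 < x)%N && all (fun t => 0 < t)%N r.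
  by move: pos; rewrite all_cat => /andP[_].
have before j : (0 < j < x)%N -> coded y (z + (sumn pr)%:Z + j%:Z) = false.
  move=> jx; rewrite (_ : z + _ + _ = z + (sumn pr + j)%N%:Z); last by lia.
  rewrite (coded_excursion pz er) ?visits_inside // sumn_cat /=; lia.
have next : coded y (z + (sumn pr)%:Z + x%:Z).
  rewrite (_ : z + _ + _ = z + (sumn (rcons pr x))%:Z); last by rewrite sumn_rcons; lia.
  have er' := er; rewrite -cat_rcons in er'.
  case: r r0 er er' pos => [|x' r] r0 er er' pos.
    by apply: two_sided_coded => //; case: er'; rewrite cats0.
  rewrite (coded_excursion pz er') ?visits_sumn // sumn_cat /=.
  by case/andP: r0; lia.
have [tx|ntx] := eqVneq t x; last first.
  split=> [H|]; last first.
    move=> c; have [r' er'] : exists r', exc y z (rcons pr t ++ r').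
      move: c => /= [/chain_excursion[r' [_ er']]|[er' _]]; first by exists r'.
      by exists [::]; rewrite cats0.
    have := excursion_inj er er'; rewrite cat_rcons => /eqP.
    by rewrite eqseq_cat // eqxx => /= /eqP[xt]; rewrite xt eqxx in ntx.
  have [xt|tx] := ltnP x t.
    have := H x ltac:(move: xt x0; rewrite /=; lia).
    rewrite next mem_partial_sums_cons leqNgt xt /= orbF => /esym/eqP.
    by move=> xt'; rewrite xt' eqxx in ntx.
  have := H t ltac:(move: t0; rewrite /=; lia).
  rewrite mem_partial_sums_cons eqxx /= before //.
  by rewrite t0 ltn_neqAle ntx.
subst x.
have er' := er; rewrite -cat_rcons in er'.
have shift : (forall k : nat, (0 < k <= sumn (t :: ts))%N ->
     coded y (z + (sumn pr)%:Z + k%:Z) = (k \in scanl addn 0%N (t :: ts))) <->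
   (forall k : nat, (0 < k <= sumn ts)%N ->
     coded y (z + (sumn (rcons pr t))%:Z + k%:Z) = (k \in scanl addn 0%N ts)).
  split=> H k hk.
    have := H (t + k)%N ltac:(move: hk; rewrite /=; lia).
    rewrite mem_partial_sums_cons leq_addr addKn /= (_ : (t + k == t)%N = false) /=; last by lia.
    by move=> <-; congr coded; rewrite sumn_rcons; lia.
  have [kt|kt] := ltnP k t.
    rewrite before; last by lia.
    by rewrite mem_partial_sums_cons leqNgt kt /= orbF; apply/esym/eqP; lia.
  have [->|nkt] := eqVneq k t; first by rewrite next mem_partial_sums_cons eqxx.
  rewrite mem_partial_sums_cons (negbTE nkt) kt /= -H; last by move: hk => /=; lia.
  by congr coded; rewrite sumn_rcons; lia.
rewrite shift; case: r r0 er er' pos => [|x r] r0 er er' pos; last first.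
  rewrite (IH _ _ _ ts0 pz er') //=; split=> [c|[//|[er2 _]]]; first by left.
  have := excursion_inj er' er2; rewrite -[RHS]cats0 => /eqP.
  by rewrite eqseq_cat // eqxx.
rewrite cats0 in er'; have [_ pz' _ _] := er'.
have [e' ee'] := two_sided_excursion (z + (sumn (rcons pr t))%:Z) ty.
have e'0 : e' <> [::] by move=> e0; case: ee'; rewrite e0 /=; lia.
have := IH [::] e' _ ts0 pz' ee' e'0; rewrite /= addr0 => ->.
split=> [c|[/chain_excursion[r' [r'0 er2]]|[_ //]]]; first by right.
have := excursion_inj er' er2; rewrite -[LHS]cats0 => /eqP.
by rewrite eqseq_cat // eqxx /= => /eqP/esym.
Qed.

(** A 1 at [n] is visited by the excursion of the gap around [n]: [k] is the distance to the last
    mark and [pr] the part of the excursion up to [n]. With [coded_path_unique] this turns a path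
    event into a disjoint union of events of known probability. *)
Lemma coded_path y n ts : two_sided y -> all (fun t => 0 < t)%N ts ->
  (coded y n /\ forall k : nat, (0 < k <= sumn ts)%N ->
     coded y (n + k%:Z) = (k \in scanl addn 0%N ts)) <->
  exists k, exists2 pr, pr \in compositions k &
    pat y (n - k%:Z) /\ chain m bit word y (n - k%:Z) pr ts.
Proof.
move=> ty ts0; split.
  move=> [/codedP[k [g [kg gz v]]] H].
  have [_ pz _ _] := gz; have [ee se] := gap_at_excursion gz.
  have [] := @visits_split _ k _ v; first by rewrite se.
  move=> pr [r [er pk rn0]]; rewrite er in ee.
  have := excursion_pos ee; rewrite all_cat => /andP[pr0 _].
  exists k, pr; first by rewrite mem_compositions pr0 pk eqxx.
  split=> //; apply/(chain_coded ty ts0 pz ee rn0).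
  by rewrite pk subrK.
move=> [k [pr]]; rewrite mem_compositions => /andP[pr0 /eqP pk] [pz c].
have [r [r0 er]] := chain_excursion c.
have /(chain_coded ty ts0 pz er r0) := c; rewrite pk subrK => H; split=> //.
have pos := excursion_pos er.
rewrite -[n](subrK k%:Z) (coded_excursion pz er); first by rewrite -pk visits_sumn.
rewrite sumn_cat pk; case: r r0 pos {c er} => [//|x r] _.
by rewrite all_cat /= => /and3P[_ x0 _]; lia.
Qed.

Lemma coded_path_unique y n ts ts' k k' pr pr' :
  pr \in compositions k -> pr' \in compositions k' ->
  pat y (n - k%:Z) -> pat y (n - k'%:Z) ->
  chain m bit word y (n - k%:Z) pr ts -> chain m bit word y (n - k'%:Z) pr' ts' ->
  k = k' /\ pr = pr'.
Proof.
rewrite !mem_compositions => /andP[pr0 /eqP pk] /andP[pr0' /eqP pk'] pz pz'.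
move=> /chain_excursion[r [r0 er]] /chain_excursion[r' [r0' er']].
have lt (l q : seq nat) : q <> [::] -> all (fun t => 0 < t)%N (l ++ q) ->
    (sumn l < sumn (l ++ q))%N.
  case: q => // x q _; rewrite all_cat sumn_cat /= => /and3P[_ x0 _]; lia.
have s1 := lt _ _ r0 (excursion_pos er); have s2 := lt _ _ r0' (excursion_pos er').
have [g1 _] := excursion_gap_at pz er; have [g2 _] := excursion_gap_at pz' er'.
have [kk _] := gap_at_unique (n := n) g1 g2 ltac:(clear -s1 pk; lia) ltac:(clear -s2 pk'; lia).
have kk' : k = k' by clear -kk; lia.
split=> //; rewrite -kk' in er' pk'.
by apply: (prefix_unique pr0 pr0' _ (excursion_inj er er')); rewrite pk pk'.
Qed.

End Coding.

(** * Locality of the code and its measurability *)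

Section Window.
Variables (S : Type) (m : nat) (bit : S -> bool) (word : nat -> S -> seq nat).
Local Notation pat := (pattern m bit).
Local Notation code := (code m bit word).
Local Notation window_ok := (window_ok m bit).
Local Notation code_radius := (code_radius m bit).
Hypothesis m0 : (0 < m)%N.

Lemma window_okP r y : reflect [/\ (m <= r)%N,
    exists2 k : nat, (k <= r - m)%N & pat y (- k%:Z) &
    exists2 j : nat, (0 < j <= r)%N & pat y j%:Z] (window_ok r y).
Proof.
apply: (iffP and3P) => -[mr h1 h2]; split=> //.
- by case/hasP: h1 => k; rewrite mem_iota add0n /= ltnS => kr pk; exists k.
- by case/hasP: h2 => j; rewrite mem_iota add1n ltnS => jr pj; exists j.
- by case: h1 => k kr pk; apply/hasP; exists k; rewrite // mem_iota add0n ltnS.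
- by case: h2 => j jr pj; apply/hasP; exists j; rewrite // mem_iota add1n ltnS.
Qed.

Lemma window_ok_mono r r' y : (r <= r')%N -> window_ok r y -> window_ok r' y.
Proof.
move=> rr' /window_okP[mr [k kr pk] [j jr pj]]; apply/window_okP; split.
- exact: leq_trans rr'.
- by exists k => //; apply: leq_trans kr _; apply: leq_sub2r.
- by exists j => //; case/andP: jr => -> /= jr; apply: leq_trans rr'.
Qed.

Lemma code_radius_le r y : win_le (code_radius y) r = window_ok r y.
Proof.
rewrite /code_radius; case: pselect => [h|h] /=; last first.
  by apply/esym/negP => wr; apply: h; exists r.
case: ex_minnP => s ws smin; apply/idP/idP => [sr|/smin//].
exact: window_ok_mono ws.
Qed.

Lemma code_radius_Some r y : code_radius y = Some r <->
  window_ok r y /\ forall s, (s < r)%N -> ~ window_ok s y.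
Proof.
rewrite /code_radius; case: pselect => [h|h]; last first.
  by split=> // -[wr _]; case: h; exists r.
case: ex_minnP => s ws smin; split=> [[<-]|[wr rmin]].
  by split=> // t ts wt; have := smin t wt; rewrite leqNgt ts.
congr Some; apply/eqP; rewrite eqn_leq smin //= leqNgt; apply/negP => sr.
exact: rmin sr ws.
Qed.

Lemma code_radius_None y : code_radius y = None <-> forall r, ~ window_ok r y.
Proof.
rewrite /code_radius; case: pselect => [h|h]; split=> //.
- by move=> H; have [r wr] := h; case: (H r).
- by move=> _ r wr; apply: h; exists r.
Qed.

Lemma code_radius_ge r y : (0 < r)%N -> win_ge (code_radius y) r ->
  ~ window_ok r.-1 y.
Proof.
move=> r0; rewrite -code_radius_le; case: (code_radius y) => //= s rs.
by apply/negP; rewrite -ltnNge prednK.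
Qed.

Lemma pattern_local y y' z z' : (forall k : int, z - m%:Z < k <= z' -> y k = y' k) ->
  forall x, z <= x <= z' -> pat y x = pat y' x.
Proof.
move=> yy' x xz; rewrite /pattern yy'; last by lia.
congr andb; apply: eq_in_all => j; rewrite mem_iota => jm.
by rewrite yy' //; lia.
Qed.

Lemma pattern_window r y y' : (m <= r)%N -> (forall k : int, `|k| <= r%:Z -> y k = y' k) ->
  forall x, - (r - m)%N%:Z <= x <= r%:Z -> pat y x = pat y' x.
Proof.
move=> mr yy'; apply: pattern_local => k kr; apply: yy'; lia.
Qed.

Lemma window_ok_local_imp r y y' : (forall k : int, `|k| <= r%:Z -> y k = y' k) ->
  window_ok r y -> window_ok r y'.
Proof.
move=> yy' /window_okP[mr [k kr pk] [j jr pj]].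
have pp := pattern_window mr yy'.
apply/window_okP; split=> //.
- by exists k; rewrite // -pp //; lia.
- by exists j; rewrite // -pp //; lia.
Qed.

Lemma window_ok_local r y y' : (forall k : int, `|k| <= r%:Z -> y k = y' k) ->
  window_ok r y = window_ok r y'.
Proof.
move=> yy'; apply/idP/idP; apply: window_ok_local_imp => // k kr.
by rewrite yy'.
Qed.

(** The gap around 0 has no mark in its interior, so the marks at [- k0] and [j0] confine it:
    [k <= k0] and [g <= k + j0]. All patterns that [code] tests are then readable in the window. *)
Lemma code_local_imp r y y' : (forall k : int, `|k| <= r%:Z -> y k = y' k) ->
  window_ok r y -> code y -> code y'.
Proof.
move=> yy' /window_okP[mr [k0 k0r pk0] [j0 j0r pj0]] /asboolP[k [g [kg gg v]]].
have [g0 p1 p2 p3] := gg.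
have kk0 : (k <= k0)%N.
  rewrite leqNgt; apply/negP => h; have := p3 (k - k0)%N ltac:(lia).
  by rewrite (_ : - k%:Z + (k - k0)%N%:Z = - k0%:Z) ?pk0 //; lia.
have gj0 : (g <= k + j0)%N.
  rewrite leqNgt; apply/negP => h; have := p3 (k + j0)%N ltac:(lia).
  by rewrite (_ : - k%:Z + (k + j0)%N%:Z = j0%:Z) ?pj0 //; lia.
have pp := pattern_window mr yy'.
apply/asboolP; exists k, g; split=> //.
  split=> //; [by rewrite -pp //; lia | by rewrite -pp //; lia |].
  by move=> n ng; rewrite -pp; [apply: p3 | lia].
by rewrite -yy' //; lia.
Qed.

End Window.

Section CodeMeasurability.
Variables (d : measure_display) (Omega : measurableType d).
Variables (dS : measure_display) (S : measurableType dS) (Y : int -> Omega -> S).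
Hypothesis mY : forall n A, measurable A -> measurable [set w | A (Y n w)].
Variables (m : nat) (bit : S -> bool) (word : nat -> S -> seq nat).
Hypothesis mbit : measurable [set s | bit s].
Hypothesis mword : forall g e, measurable [set s | word g s = e].
Local Notation yw w := (fun k => Y k w).

Lemma measurable_code : measurable [set w | code m bit word (yw w)].
Proof.
have mp z : measurable [set w | pattern m bit (yw w) z].
  by apply: (measurable_pattern mY).
rewrite [X in measurable X](_ : _ = [set w | exists k, exists g, exists e,
  (k < g)%N /\ ((0 < g)%N /\ (pattern m bit (yw w) (- k%:Z) /\
  (pattern m bit (yw w) (- k%:Z + g%:Z) /\
  ((forall n : nat, (0 < n < g)%N -> ~ pattern m bit (yw w) (- k%:Z + n%:Z)) /\
  (word g (Y (- k%:Z + g%:Z) w) = e /\ visits e k)))))]).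
  apply: mset_ex => k; apply: mset_ex => g; apply: mset_ex => e.
  apply: mset_and; first exact: mset_prop.
  apply: mset_and; first exact: mset_prop.
  apply: mset_and; first exact: mp.
  apply: mset_and; first exact: mp.
  apply: mset_and.
    by apply: mset_all => n; apply: mset_impl; apply: mset_not; apply: mp.
  apply: mset_and; last exact: mset_prop.
  exact: (mY _ (mword g e)).
apply/predeqP => w; split.
  move=> /asboolP[k [g [kg [g0 p1 p2 p3] v]]].
  exists k, g, (word g (Y (- k%:Z + g%:Z) w)); do 4 split=> //.
  by split=> // n ng; apply/negP/p3.
move=> [k [g [e [kg [g0 [p1 [p2 [p3 [<- v]]]]]]]]].
apply/asboolP; exists k, g; split=> //; split=> // n ng.
by apply/negP/p3.
Qed.

Lemma measurable_window_ok r : measurable [set w | window_ok m bit r (yw w)].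
Proof.
have mp z : measurable [set w | pattern m bit (yw w) z].
  by apply: (measurable_pattern mY).
rewrite [X in measurable X](_ : _ = [set w | (m <= r)%N /\
  ((exists k : nat, (k <= r - m)%N /\ pattern m bit (yw w) (- k%:Z)) /\
  (exists j : nat, (0 < j <= r)%N /\ pattern m bit (yw w) j%:Z))]).
  apply: mset_and; first exact: mset_prop.
  apply: mset_and; apply: mset_ex => k; apply: mset_and => //; exact: mset_prop.
apply/predeqP => w; split.
  by move=> /window_okP[mr [k ? ?] [j ? ?]]; split=> //; split; [exists k | exists j].
by move=> [mr [[k [? ?]] [j [? ?]]]]; apply/window_okP; split=> //; [exists k | exists j].
Qed.

Lemma measurable_code_radius r : measurable [set w | code_radius m bit (yw w) = Some r].
Proof.
rewrite [X in measurable X](_ : _ = [set w | window_ok m bit r (yw w) /\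
   forall s, (s < r)%N -> ~ window_ok m bit s (yw w)]).
  apply: mset_and; first exact: measurable_window_ok.
  apply: mset_all => s; apply: mset_impl; apply: mset_not.
  exact: measurable_window_ok.
by apply/predeqP => w; apply: code_radius_Some.
Qed.
End CodeMeasurability.

(** Apply the hypothesis to the sequence space itself with its coordinate maps: measurability
    statements about processes thereby transfer to the coding map. *)
Lemma prodZ_measurable_coordinates (dS : measure_display) (S : measurableType dS)
    (Q : set (int -> S)) :
  (forall d (Omega : measurableType d) (Y : int -> Omega -> S),
    (forall n A, measurable A -> measurable [set w | A (Y n w)]) ->
    measurable [set w | Q (fun k => Y k w)]) ->
  prodZ_measurable Q.
Proof.
move=> H.
pose G := \bigcup_(n in [set: int])
  preimage_set_system setT (fun y : int -> S => y n) (@measurable _ S).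
have := H _ (g_sigma_algebraType G) (fun n (y : int -> S) => y n).
apply=> n A mA; apply: sub_sigma_algebra; exists n => //.
by exists A => //; rewrite setTI.
Qed.

Lemma coding_window_code (dS : measure_display) (S : measurableType dS)
    (m : nat) (bit : S -> bool) (word : nat -> S -> seq nat) :
  (0 < m)%N -> measurable [set s | bit s] ->
  (forall g e, measurable [set s | word g s = e]) ->
  coding_window (code m bit word) (code_radius m bit).
Proof.
move=> m0 mbit mword; split; [|split].
- apply: (@prodZ_measurable_coordinates _ _ [set y | code m bit word y]).
  by move=> d Omega Y mY; apply: (measurable_code mY).
- move=> r; apply: (@prodZ_measurable_coordinates _ _ [set y | code_radius m bit y = Some r]).
  by move=> d Omega Y mY; apply: (measurable_code_radius mY).
move=> r y y' yy'; rewrite !code_radius_le; split; first exact: window_ok_local.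
move=> wr; have wr' : window_ok m bit r y' by rewrite -(window_ok_local bit m0 yy').
apply/idP/idP; first exact: code_local_imp wr.
by apply: (code_local_imp m0 _ wr') => k kr; rewrite yy'.
Qed.

(** * Law of the coded process and tail of its window *)

Section CodedLaw.
Variables (d : measure_display) (Omega : measurableType d) (R : realType).
Variable P : probability Omega R.
Variables (dS : measure_display) (S : measurableType dS) (Y : int -> Omega -> S).
Hypothesis HY : iid_process P Y.
Local Notation prb := (prb P).
Local Notation yw w := (fun k => Y k w).
Variables (m : nat) (dl : R) (bit : S -> bool) (word : nat -> S -> seq nat).
Hypothesis m0 : (0 < m)%N.
Hypothesis dl01 : 0 < dl < 1.
Hypothesis mbit : measurable [set s | bit s].
Hypothesis mword : forall g e, measurable [set s | word g s = e].
Hypothesis Pbit : prb [set w | bit (Y 0 w)] = dl.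
Local Notation a := (dl * (1 - dl) ^+ m.-1).
Local Notation s := (gap_tail m a).
Local Notation pat := (pattern m bit).
Variable p : nat -> R.
Hypothesis spos : forall t, 0 < s t.
Hypothesis p_ge0 : forall t, 0 <= p t.
Hypothesis p_le1 : forall M, \sum_(t < M) p t.+1 <= 1.
Hypothesis w_ge0 : forall n, 0 <= unstopped p m a n.
Hypothesis word_comp : forall g x, word g x \in compositions g.
Hypothesis Pword : forall g e, (m <= g)%N -> e \in compositions g ->
  prb [set w | bit (Y 0 w) /\ word g (Y 0 w) = e] =
  dl * (exc_wt p m a e / gap_law m a g).

Let X (n : int) (w : Omega) : bool := coded m bit word (yw w) n.

Let a0 : 0 < a.
Proof. by case/andP: dl01 => h1 h2; rewrite mulr_gt0 // exprn_gt0 // subr_gt0. Qed.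

Let q_ge0 n : 0 <= gap_law m a n.
Proof. exact: gap_law_ge0. Qed.

Let mY := measurable_coord HY.

Let mpat z : measurable [set w | pat (yw w) z].
Proof. by apply: (measurable_pattern mY). Qed.

Lemma past_pattern_at z : past P Y z [set w | pat (yw w) z] /\
  prb [set w | pat (yw w) z] = a.
Proof.
have [] := past_pattern HY m0 dl01 mbit Pbit (past_setT P Y (z - m%:Z)) mbit (@subset_refl _ _).
rewrite setTI subrK prbT mul1r Pbit mulrC.
have -> : [set w | pat (yw w) z /\ [set s | bit s] (Y z w)] = [set w | pat (yw w) z].
  by apply/predeqP => w; split=> [[]|pz] //; split=> //; have [] := patternP _ _ _ _ pz.
by [].
Qed.

Lemma prb_no_pattern z N : prb (no_pattern Y m bit z N) = s N.+1.
Proof.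
have [_] := past_no_pattern HY m0 dl01 mbit Pbit N (past_setT P Y z).
by rewrite setTI prbT mul1r.
Qed.

Let mno z N : measurable (no_pattern Y m bit z N).
Proof. by apply: (measurable_no_pattern HY). Qed.

Lemma prb_null A : measurable A ->
  (forall N, exists z, A `<=` no_pattern Y m bit z N) -> prb A = 0.
Proof.
move=> mA H; apply/eqP; rewrite eq_le prb_ge0 andbT.
have h : (fun N => s N.+1) @ \oo --> (0 : R).
  by rewrite (cvg_shiftS s); exact: gap_tail_cvg0.
rewrite -(cvg_lim _ h) //; apply: limr_ge; first by apply/cvg_ex; exists 0.
near=> N; have [z Az] := H N; rewrite -(prb_no_pattern z N).
exact: prb_le.
Unshelve. all: by end_near.
Qed.

Lemma two_sided_ae : exists G : set Omega, [/\ measurable G, prb (~` G) = 0 &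
  forall w, G w -> two_sided m bit (yw w)].
Proof.
pose A (N : nat) := [set w | forall k : nat, ~ pat (yw w) (- N%:Z - k%:Z)].
pose B (N : nat) := [set w | forall k : nat, ~ pat (yw w) (N%:Z + k.+1%:Z)].
have mA N : measurable (A N) by apply: mset_all => k; apply: mset_not; apply: mpat.
have mB N : measurable (B N) by apply: mset_all => k; apply: mset_not; apply: mpat.
have A0 N : P (A N) = 0%E.
  rewrite prbE // prb_null // => M; exists (- N%:Z - M%:Z) => w H n nM.
  by have := H (M - n)%N; rewrite (_ : - N%:Z - (M - n)%N%:Z = - N%:Z - M%:Z + n%:Z) //; lia.
have B0 N : P (B N) = 0%E.
  rewrite prbE // prb_null // => M; exists N%:Z => w H n nM.
  by have := H n.-1; rewrite prednK //; lia.
have nAB : P.-negligible (\bigcup_N (A N `|` B N)).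
  apply: negligible_bigcup => N; apply: negligibleU.
    exact/(negligibleP _ (mA N))/A0.
  exact/(negligibleP _ (mB N))/B0.
have mAB : measurable (\bigcup_N (A N `|` B N)).
  by apply: bigcup_measurable => N _; apply: measurableU.
exists (~` \bigcup_N (A N `|` B N)); split; first exact: measurableC.
  by rewrite setCK /prb measure_negligible.
move=> w H n; split.
  apply: contrapT => nk; apply: H; exists (absz n) => //; left => k pk.
  apply: nk; exists (absz (n - (- (absz n)%:Z - k%:Z))%R).
  by rewrite (_ : n - _ = - (absz n)%:Z - k%:Z) //; lia.
apply: contrapT => nk; apply: H; exists (absz n) => //; right => k pk.
apply: nk; exists (absz ((absz n)%:Z + k.+1%:Z - n)%R).
rewrite (_ : n + _ = (absz n)%:Z + k.+1%:Z) ?pk ?andbT //; lia.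
Qed.

(** Events about the code are compared on two-sided sequences, where every site lies in a gap; the
    others form a null set. *)
Lemma prb_eq_ae A B : measurable A -> measurable B ->
  (forall w, two_sided m bit (yw w) -> A w -> B w) -> prb A <= prb B.
Proof.
move=> mA mB AB; have [G [mG G0 HG]] := two_sided_ae.
apply: le_trans (_ : prb (B `|` ~` G) <= _); last first.
  rewrite -[leRHS]addr0 -[X in _ <= _ + X]G0; apply: prbU_le => //; exact: measurableC.
apply: prb_le => //; first by apply: measurableU => //; exact: measurableC.
move=> w Aw; have [Gw|nG] := pselect (G w); last by right.
by left; apply: AB => //; apply: HG.
Qed.

Let code_path (n : int) (ts : seq nat) (k : nat) : set Omega :=
  [set w | exists2 pr, pr \in compositions k &
    pat (yw w) (n - k%:Z) /\ chain m bit word (yw w) (n - k%:Z) pr ts].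

Let mpc n ts k pr : measurable [set w | pat (yw w) (n - k%:Z) /\
  chain m bit word (yw w) (n - k%:Z) pr ts].
Proof.
by apply: mset_and; [exact: mpat | apply: (measurable_chain HY)].
Qed.

Let mcp n ts k : measurable (code_path n ts k).
Proof. by apply: mset_exists_seq => pr _; apply: mpc. Qed.

Let prb_code_path n ts k : all (fun t => 0 < t)%N ts ->
  prb (code_path n ts k) = a * unstopped p m a k * \prod_(t <- ts) p t.
Proof.
move=> ts0; rewrite prb_exists_seq.
- rewrite -(sum_partial_wt w_ge0 q_ge0) mulr_sumr mulr_suml.
  apply: eq_big_seq => pr; rewrite mem_compositions => /andP[pr0 _].
  have [pp pa] := past_pattern_at (n - k%:Z).
  have := prb_chain HY m0 dl01 mbit mword Pbit spos p_ge0 p_le1 w_ge0 word_comp Pword pp pr0 ts0.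
  by rewrite pa.
- exact: compositions_uniq.
- by move=> pr _; apply: mpc.
move=> pr pr' w kpr kpr' [pz c] [pz' c'].
by have [] := coded_path_unique m0 word_comp kpr kpr' pz pz' c c'.
Qed.

Let mX n : measurable [set w | X n w].
Proof.
apply: (@measurable_code _ _ _ _ (fun k => Y (n + k)) _ m bit word) => //.
by move=> k A mA; apply: mY.
Qed.

Let path_event n ts : set Omega :=
  [set w | X n w /\ forall k : nat, (0 < k <= sumn ts)%N ->
     X (n + k%:Z) w = (k \in scanl addn 0%N ts)].

Let mpath n ts : measurable (path_event n ts).
Proof.
apply: mset_and; first exact: mX.
by apply: mset_all => k; apply: mset_impl; apply: measurable_value.
Qed.

Let path_eq n ts : gaps_after X n 0 ts = path_event n ts.
Proof.
apply/predeqP => w; rewrite /gaps_after /first_one_at /path_event -sumnE addr0; split.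
  by move=> [[_ x] H].
by move=> [x H]; split=> //; split.
Qed.

Lemma prb_code_paths n ts : all (fun t => 0 < t)%N ts ->
  P (\bigcup_k code_path n ts k) =
  (\sum_(k <oo) (a * unstopped p m a k * \prod_(t <- ts) p t)%:E)%E.
Proof.
move=> ts0; rewrite measure_semi_bigcup //; last exact: bigcup_measurable.
  by apply: eq_eseriesr => k _; rewrite -(prb_code_path n) //; apply: prbE.
apply/trivIsetP => i j _ _ ij; rewrite -subset0 => w [[pr ipr [pz c]] [pr' jpr [pz' c']]].
have [ij' _] := coded_path_unique m0 word_comp ipr jpr pz pz' c c'.
by rewrite ij' eqxx in ij.
Qed.

(** The site [n] is visited at distance [k] from the last mark with probability
    [a * unstopped p m a k], and the later jumps contribute the same factors [p t] for every [k].
    Summing over [k] leaves a constant, finite because it is a probability. *)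
Lemma renewal_like_coded : exists c, renewal_like p P X c.
Proof.
pose c := prb (\bigcup_k code_path 0 [::] k).
have mU n ts : measurable (\bigcup_k code_path n ts k) by apply: bigcup_measurable.
have cE : c%:E = (\sum_(k <oo) (a * unstopped p m a k)%:E)%E.
  rewrite -prbE // prb_code_paths //; apply: eq_eseriesr => k _.
  by rewrite big_nil mulr1.
exists c; split.
- exact: mX.
- move=> n ts ts0; rewrite path_eq.
  have -> : prb (path_event n ts) = prb (\bigcup_k code_path n ts k).
    apply/eqP; rewrite eq_le; apply/andP; split; apply: prb_eq_ae => // w tw.
      move=> H; have [k [pr kpr c']] := (coded_path m0 word_comp n tw ts0).1 H.
      by exists k => //; exists pr.
    move=> [k _ [pr kpr c']]; apply: (coded_path m0 word_comp n tw ts0).2.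
    by exists k, pr.
  apply: EFin_inj; rewrite -prbE // prb_code_paths // EFinM cE.
  rewrite muleC -nneseriesZl; last first.
    by move=> k _; rewrite lee_fin mulr_ge0 // ltW.
  by apply: eq_eseriesr => k _; rewrite -EFinM mulrC.
move=> n.
have h : (fun N => s (N + m)%N) @ \oo --> (0 : R).
  by rewrite (cvg_shiftn m); exact: gap_tail_cvg0.
apply: (squeeze_cvgr _ (cvg_cst 0) h); near=> N.
rewrite prb_ge0 /= -(prednK (_ : (0 < N + m)%N)); last by rewrite addn_gt0 m0 orbT.
(* Marks are coded as 1, so a run of zeros contains no mark; the base point is [n - m] because
   [no_pattern] tests distances from [m] on. *)
rewrite -(prb_no_pattern (n - m%:Z)).
apply: prb_eq_ae => //; first exact: measurable_word_event.
move=> w tw H k hk pk.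
have := two_sided_coded m0 word_comp tw pk.
have := H (k - m)%N; rewrite size_nseq nth_nseq; case: ifP => [_|].
  move/(_ ltac:(clear -hk m0; lia)).
  rewrite (_ : n + (k - m)%N%:Z = n - m%:Z + k%:Z); last by clear -hk; lia.
  by rewrite /X => ->.
by clear -hk m0; lia.
Unshelve. all: by end_near.
Qed.

Lemma measurable_radius_ge r : measurable [set w | win_ge (code_radius m bit (yw w)) r].
Proof.
rewrite [X in measurable X](_ : _ = [set w | forall t, (t < r)%N ->
    ~ code_radius m bit (yw w) = Some t]).
  by apply: mset_all => t; apply: mset_impl; apply: mset_not; apply: (measurable_code_radius mY).
apply/predeqP => w; rewrite /mkset; case: (code_radius m bit (yw w)) => [t|] /=.
  split=> [rt u ur [tu]|H]; first by rewrite tu leqNgt ur in rt.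
  by rewrite leqNgt; apply/negP => /H; apply.
by split.
Qed.

Lemma code_radius_finite : P [set w | code_radius m bit (yw w) = None] = 0%E.
Proof.
have mN : measurable [set w | code_radius m bit (yw w) = None].
  rewrite [X in measurable X](_ : _ = [set w | forall r, ~ window_ok m bit r (yw w)]).
    by apply: mset_all => r; apply: mset_not; apply: (measurable_window_ok mY).
  by apply/predeqP => w; apply: code_radius_None.
rewrite prbE //; congr EFin; apply/eqP; rewrite eq_le prb_ge0 andbT -(prb0 P).
apply: prb_eq_ae => // w tw /code_radius_None H.
have [[k pk] [j /andP[j0 pj]]] := tw 0.
apply: (H (maxn (k + m) j)); apply/window_okP; rewrite sub0r add0r in pk pj *; split.
- by clear; lia.
- by exists k => //; clear; lia.
- by exists j => //; clear -j0; lia.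
Qed.

Lemma code_radius_tail r : (0 < r)%N ->
  prb [set w | win_ge (code_radius m bit (yw w)) r] <= 2 * (1 - a) ^+ (r - m).
Proof.
move=> r0; have [rm|mr] := leqP r m.
  rewrite (_ : (r - m)%N = 0%N); last by clear -rm; lia.
  rewrite expr0 mulr1; apply: le_trans (_ : 1 <= _); last by rewrite ler1n.
  exact/prb_le1/measurable_radius_ge.
have sle t : (r <= t)%N -> s t <= (1 - a) ^+ (r - m).
  move=> rt; apply: le_trans (gap_tail_geom m0 a0 spos r).
  exact: gap_tail_decr.
(* [N1] tests the sites from [- (r - 1 - m)] to 0 and [N2] those from 1 to [r - 1]: the two ranges
   in [window_ok] at [r.-1]. *)
pose N1 := no_pattern Y m bit (- r.-1%:Z) r.-1.
pose N2 := no_pattern Y m bit (1 - m%:Z) (r + m).-2.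
apply: le_trans (_ : prb (N1 `|` N2) <= _).
  apply: prb_le; [exact: measurable_radius_ge | apply: measurableU; exact: mno |].
  move=> w /(code_radius_ge r0) nw; apply: contrapT => nN; apply: nw.
  have [n1 n2] : ~ N1 w /\ ~ N2 w by split=> H; apply: nN; [left | right].
  have [e1 h1] : exists n, (m <= n <= r.-1)%N && pat (yw w) (- r.-1%:Z + n%:Z).
    apply: contrapT => h; apply: n1 => n hn pn; apply: h.
    by exists n; rewrite hn.
  have [e2 h2] : exists n, (m <= n <= (r + m).-2)%N && pat (yw w) (1 - m%:Z + n%:Z).
    apply: contrapT => h; apply: n2 => n hn pn; apply: h.
    by exists n; rewrite hn.
  case/andP: h1 => h1 p1; case/andP: h2 => h2 p2.
  apply/window_okP; split; first by clear -mr; lia.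
    exists (r.-1 - e1)%N; first by clear -h1; lia.
    by rewrite (_ : - _ = - r.-1%:Z + e1%:Z) //; clear -h1; lia.
  exists (e2.+1 - m)%N; first by clear -h2 m0 mr; lia.
  by rewrite (_ : Posz (e2.+1 - m)%N = 1 - m%:Z + e2%:Z) //; clear -h2; lia.
apply: le_trans (prbU_le P (mno _ _) (mno _ _)) _.
rewrite !prb_no_pattern mulrDl !mul1r lerD // sle //; clear -mr m0; lia.
Qed.

End CodedLaw.

(** * An i.i.d. sequence of marks *)

Lemma uniform_prob_itv (R : realType) (x y : R) : 0 <= x -> x <= y -> y <= 1 ->
  uniform_prob (@ltr01 R) `[x, y[%classic = (y - x)%:E.
Proof.
move=> x0 xy y1; rewrite /uniform_prob integral_uniform_pdf setIidl; last first.
  move=> z /=; rewrite !in_itv /= => /andP[xz zy].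
  by rewrite (le_trans x0 xz) (le_trans (ltW zy) y1).
rewrite (eq_integral (fun=> 1%:E)); last first.
  move=> z; rewrite inE /= in_itv /= => /andP[xz zy].
  rewrite /uniform_pdf (le_trans x0 xz) (le_trans (ltW zy) y1) /=.
  by rewrite subr0 invr1.
rewrite integral_cst //= mul1e lebesgue_measure_itv /= lte_fin.
case: ltP => [_|yx]; first by rewrite EFinB.
by rewrite (_ : y = x) ?subrr //; apply/eqP; rewrite eq_le yx.
Qed.

(** * Independent digits of a uniform point *)

Section Cells.
Variables (R : realType) (nu : nat -> nat -> R) (N : nat -> nat).
Hypothesis nu_ge0 : forall i k, 0 <= nu i k.
Hypothesis nu_sum : forall i, \sum_(k < N i) nu i k = 1.

Definition cum (i k : nat) : R := \sum_(j < k) nu i j.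

(* Left end and length of the interval of the points of [0, 1[ whose first [n]
   digits are [f 0, ..., f n.-1]. *)
Fixpoint cell (f : nat -> nat) (n : nat) : R * R :=
  if n is n'.+1 then
    let c := cell f n' in (c.1 + c.2 * cum n' (f n'), c.2 * nu n' (f n'))
  else (0, 1).

Definition next_digit (i : nat) (c : R * R) (u : R) : nat :=
  find (fun k => u < c.1 + c.2 * cum i k.+1) (iota 0 (N i)).

Fixpoint located (n : nat) (u : R) : R * R :=
  if n is n'.+1 then
    let c := located n' u in let k := next_digit n' c u in
    (c.1 + c.2 * cum n' k, c.2 * nu n' k)
  else (0, 1).

Definition digit (n : nat) (u : R) : nat := next_digit n (located n u) u.

Lemma cumS i k : cum i k.+1 = cum i k + nu i k.
Proof. by rewrite /cum big_ord_recr. Qed.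

Lemma cum_mono i k l : (k <= l)%N -> cum i k <= cum i l.
Proof.
elim: l => [|l IH]; first by rewrite leqn0 => /eqP->.
rewrite leq_eqVlt => /orP[/eqP->//|kl].
by apply: le_trans (IH kl) _; rewrite cumS lerDl.
Qed.

Lemma cum_ge0 i k : 0 <= cum i k.
Proof. by apply: sumr_ge0. Qed.

Lemma next_digitP i c u k : 0 <= c.2 -> c.1 <= u < c.1 + c.2 -> (k < N i)%N ->
  next_digit i c u = k <-> c.1 + c.2 * cum i k <= u < c.1 + c.2 * cum i k.+1.
Proof.
move=> c0 cu kN; rewrite /next_digit; set Q := fun k => _.
split.
  move=> fk; have hasQ : has Q (iota 0 (N i)) by rewrite has_find size_iota fk.
  have := nth_find 0%N hasQ; rewrite fk nth_iota // add0n /Q => ->; rewrite andbT.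
  case: k kN fk => [|k] kN fk; first by rewrite /cum big_ord0 mulr0 addr0; case/andP: cu.
  have := @before_find _ 0%N Q (iota 0 (N i)) k; rewrite fk ltnSn => /(_ isT).
  by rewrite nth_iota ?add0n /Q; [move/negbT; rewrite -leNgt | exact: ltnW].
move=> /andP[ku uk]; have Qk : Q k by [].
have kin : k \in iota 0 (N i) by rewrite mem_iota.
have hasQ : has Q (iota 0 (N i)) by apply/hasP; exists k.
apply/eqP; rewrite eqn_leq; apply/andP; split; rewrite leqNgt; apply/negP => h.
  have := @before_find _ 0%N Q (iota 0 (N i)) k h.
  by rewrite nth_iota // add0n Qk.
have fN : (find Q (iota 0 (N i)) < N i)%N by move: hasQ; rewrite has_find size_iota.
have := nth_find 0%N hasQ; rewrite nth_iota //.
rewrite add0n /Q; apply/negP; rewrite -leNgt; apply: le_trans ku.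
by rewrite lerD2l ler_wpM2l // cum_mono.
Qed.

Lemma cell_bounds f n : (forall i, (i < n)%N -> (f i < N i)%N) ->
  [/\ 0 <= (cell f n).1, 0 <= (cell f n).2 & (cell f n).1 + (cell f n).2 <= 1].
Proof.
elim: n => [|n IH] fN /=; first by split; rewrite ?add0r.
have [h1 h2 h3] := IH (fun i hi => fN i (ltnW hi)).
have c1 : cum n (f n).+1 <= 1 by rewrite -(nu_sum n) cum_mono // fN.
split; [by rewrite addr_ge0 // mulr_ge0 // cum_ge0 | exact: mulr_ge0 |].
rewrite -addrA -mulrDr -cumS; apply: le_trans h3.
by rewrite lerD2l ler_piMr.
Qed.

Lemma cell_size f n : (cell f n).2 = \prod_(i < n) nu i (f i).
Proof.
by elim: n => [|n IH] /=; rewrite ?big_ord0 // big_ord_recr /= IH.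
Qed.

Lemma digits_cell f n u : 0 <= u < 1 -> (forall i, (i < n)%N -> (f i < N i)%N) ->
  (forall i, (i < n)%N -> digit i u = f i) <->
  (cell f n).1 <= u < (cell f n).1 + (cell f n).2.
Proof.
move=> u01; elim: n => [|n IH] fN; first by rewrite /= add0r.
have fN' i : (i < n)%N -> (f i < N i)%N by move=> hi; apply: fN; apply: ltnW.
have [h1 h2 h3] := cell_bounds fN'.
have loc : (forall i, (i < n)%N -> digit i u = f i) -> located n u = cell f n.
  elim: (n) => [//|k IHk] H /=.
  rewrite -IHk; last by move=> i ik; apply: H; apply: ltnW.
  by rewrite -/(digit k u) H.
split=> [H|].
  have Hn : forall i, (i < n)%N -> digit i u = f i by move=> i hi; apply: H; apply: ltnW.
  have := H n (ltnSn n); rewrite /digit loc // => /next_digitP.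
  move=> /(_ h2 ((IH fN').1 Hn) (fN n (ltnSn n))) /=.
  by rewrite cumS mulrDr addrA.
rewrite /= -addrA -mulrDr -cumS => hu.
have cu : (cell f n).1 <= u < (cell f n).1 + (cell f n).2.
  case/andP: hu => l1 l2; apply/andP; split.
    by apply: le_trans l1; rewrite lerDl mulr_ge0 // cum_ge0.
  apply: lt_le_trans l2 _; rewrite lerD2l ler_piMr //.
  by rewrite -(nu_sum n) cum_mono // fN.
have Hn := (IH fN').2 cu.
move=> i; rewrite ltnS leq_eqVlt => /orP[/eqP->|/Hn//].
rewrite /digit loc //; apply/next_digitP => //; exact: fN.
Qed.

Lemma digit_lt n u : 0 <= u < 1 -> (digit n u < N n)%N.
Proof.
move=> u01; elim/ltn_ind: n => n IH.
have cl : located n u = cell (fun i => digit i u) n.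
  by elim: (n) => //= k IHk; rewrite -IHk.
have := (digits_cell u01 IH).1 (fun _ _ => erefl).
have [h1 h2 h3] := cell_bounds IH.
rewrite /digit cl /next_digit => /andP[_ hu].
suff : has (fun k => u < (cell (digit^~ u) n).1 + (cell (digit^~ u) n).2 * cum n k.+1)
    (iota 0 (N n)) by rewrite has_find size_iota.
apply/hasP.
have N0 : (0 < N n)%N.
  by case: (N n) (nu_sum n) => //; rewrite big_ord0 => /eqP; rewrite eq_sym oner_eq0.
exists (N n).-1; first by rewrite mem_iota add0n prednK /=.
by rewrite prednK // /cum nu_sum mulr1.
Qed.

Local Notation U := (uniform_prob (@ltr01 R)).
Local Notation prU := (prb (uniform_prob (@ltr01 R))).

Definition prefix_event (f : nat -> nat) (n : nat) : set R :=
  [set u | 0 <= u < 1 /\ forall i, (i < n)%N -> digit i u = f i].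

Lemma prefix_eventE f n : (forall i, (i < n)%N -> (f i < N i)%N) ->
  prefix_event f n = `[(cell f n).1, (cell f n).1 + (cell f n).2[%classic.
Proof.
move=> fN; have [h1 h2 h3] := cell_bounds fN.
apply/predeqP => u; rewrite /= in_itv /=; split=> [[u01 H]|H].
  exact/(digits_cell u01 fN).
have u01 : 0 <= u < 1.
  case/andP: H => l1 l2; rewrite (le_trans h1 l1) /=; exact: lt_le_trans l2 h3.
by split=> //; apply/(digits_cell u01 fN).
Qed.

Lemma measurable_prefix_event f n : (forall i, (i < n)%N -> (f i < N i)%N) ->
  measurable (prefix_event f n : set (measurableTypeR R)).
Proof. by move=> fN; rewrite prefix_eventE //; exact: measurable_itv. Qed.

Lemma prb_prefix_event f n : (forall i, (i < n)%N -> (f i < N i)%N) ->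
  prU (prefix_event f n) = \prod_(i < n) nu i (f i).
Proof.
move=> fN; have [h1 h2 h3] := cell_bounds fN.
have le12 : (cell f n).1 <= (cell f n).1 + (cell f n).2 by rewrite lerDl.
have e := uniform_prob_itv h1 le12 h3.
rewrite prefix_eventE // -cell_size.
transitivity (fine ((cell f n).1 + (cell f n).2 - (cell f n).1)%:E).
  by congr fine; exact: e.
by rewrite /= addrAC subrr add0r.
Qed.

(* Outside [0, 1[, a null set, the digits are set to [0]. *)
Definition coordinate (n : nat) (u : R) : nat := if 0 <= u < 1 then digit n u else 0.

Definition unit_interval : set R := [set u | 0 <= u < 1].

Lemma measurable_unit_interval : measurable (unit_interval : set (measurableTypeR R)).
Proof.
have -> : unit_interval = `[0, 1[%classic by apply/predeqP => u; rewrite /= in_itv.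
exact: measurable_itv.
Qed.

Lemma prb_unit_interval : prU unit_interval = 1.
Proof.
have -> : unit_interval = `[0, 1[%classic by apply/predeqP => u; rewrite /= in_itv.
transitivity (fine (1 - 0 : R)%:E); last by rewrite /= subr0.
by congr fine; apply: uniform_prob_itv; rewrite ?lexx ?ler01.
Qed.

Lemma measurable_coordinate n k :
  measurable ([set u | coordinate n u = k] : set (measurableTypeR R)).
Proof.
rewrite [X in measurable X](_ : _ = [set u | (exists ks : seq nat,
     (all (fun i => nth 0 ks i < N i)%N (iota 0 n.+1) /\ nth 0%N ks n = k) /\
     prefix_event (nth 0%N ks) n.+1 u) \/ (k = 0%N /\ ~ unit_interval u)]).
  apply: mset_or; last first.
    apply: mset_and; first exact: mset_prop.
    apply: mset_not; exact: measurable_unit_interval.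
  apply: mset_ex => ks.
  have [h|h] := pselect (all (fun i => nth 0 ks i < N i)%N (iota 0 n.+1)).
    apply: mset_and; first exact: mset_prop.
    apply: measurable_prefix_event => i hi.
    by move/allP: h; apply; rewrite mem_iota.
  rewrite [X in measurable X](_ : _ = set0) //.
  by apply/predeqP => u; split=> // -[[]].
apply/predeqP => u; rewrite /mkset /coordinate; split.
  have [u01|nu01] := boolP (0 <= u < 1) => uk; last by right; split=> //; apply/negP.
  left; exists (mkseq (digit^~ u) n.+1).
  have mk i : (i < n.+1)%N -> nth 0%N (mkseq (digit^~ u) n.+1) i = digit i u.
    by move=> hi; rewrite nth_mkseq.
  split; last by split=> // i hi; rewrite mk.
  split; last by rewrite mk.
  by apply/allP => i; rewrite mem_iota => /andP[_ hi]; rewrite mk // digit_lt.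
case=> [[ks [[_ <-] [-> H]]]|[-> /negP/negbTE]]; first exact: H.
by rewrite /unit_interval /mkset => ->.
Qed.

Lemma measurable_coordinate_pred n (D : pred nat) :
  measurable ([set u | D (coordinate n u)] : set (measurableTypeR R)).
Proof.
rewrite [X in measurable X](_ : _ = [set u | exists k, D k /\ coordinate n u = k]).
  apply: mset_ex => k; apply: mset_and; first exact: mset_prop.
  exact: measurable_coordinate.
apply/predeqP => u; split=> [h|[k [h e]]]; first by exists (coordinate n u).
by rewrite /mkset e.
Qed.

Definition digit_mass (i : nat) (D : pred nat) : R := \sum_(k < N i | D k) nu i k.

(** Induction on [j]: splitting on digit [n] moves it into the prefix, whose probability is a
    product, so the sum over its admissible values factors out. *)
Lemma prb_prefix_cond (D : nat -> pred nat) n j f :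
  (forall i, (i < n)%N -> (f i < N i)%N) ->
  prU (prefix_event f n `&` [set u | forall i, (n <= i < n + j)%N -> D i (coordinate i u)]) =
  prU (prefix_event f n) * \prod_(n <= i < n + j) digit_mass i (D i).
Proof.
have mC n' j' : measurable ([set u | forall i, (n' <= i < n' + j')%N -> D i (coordinate i u)] :
    set (measurableTypeR R)).
  by apply: mset_all => i; apply: mset_impl; apply: measurable_coordinate_pred.
elim: j n f => [|j IH] n f fN.
  rewrite addn0 big_geq // mulr1; congr prb; apply/predeqP => u.
  by split=> [[]|h] //; split=> // i; lia.
pose upd k i := if (i == n)%N then k else f i.
have updN k : (k < N n)%N -> forall i, (i < n.+1)%N -> (upd k i < N i)%N.
  by move=> kN i hi; rewrite /upd; case: eqP => [->//|/eqP ni]; apply: fN; lia.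
have updE k u : prefix_event (upd k) n.+1 u <-> prefix_event f n u /\ digit n u = k.
  split=> [[u01 H]|[[u01 H] uk]].
    split; last by rewrite H // /upd eqxx.
    by split=> // i hi; rewrite H; [rewrite /upd ltn_eqF | exact: ltnW].
  by split=> // i hi; rewrite /upd; case: eqP => [->//|/eqP ni]; apply: H; lia.
pose s := [seq k <- iota 0 (N n) | D n k].
pose F k := prefix_event (upd k) n.+1 `&`
  [set u | forall i, (n.+1 <= i < n.+1 + j)%N -> D i (coordinate i u)].
have -> : prefix_event f n `&` [set u | forall i, (n <= i < n + j.+1)%N -> D i (coordinate i u)]
    = [set u | exists2 k, k \in s & F k u].
  apply/predeqP => u; split.
    move=> [[u01 Hf] HD]; exists (digit n u).
      rewrite mem_filter mem_iota leq0n add0n digit_lt // !andbT.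
      by have := HD n ltac:(lia); rewrite /coordinate u01.
    split; first exact/updE.
    by move=> i hi; apply: HD; lia.
  move=> [k]; rewrite mem_filter mem_iota => /andP[Dk _] [/updE[[u01 Hf] uk] HD].
  split=> // i hi; have [->|ni] := eqVneq i n; first by rewrite /coordinate u01 uk.
  by apply: HD; lia.
rewrite prb_exists_seq; last first.
- by move=> k l u _ _ [/updE[_ e1] _] [/updE[_ e2] _]; rewrite -e1.
- move=> k; rewrite mem_filter mem_iota => /andP[_ kN].
  apply: measurableI => //; apply: measurable_prefix_event; exact: updN.
- by rewrite filter_uniq // iota_uniq.
rewrite big_filter (_ : iota 0 (N n) = index_iota 0 (N n)); last by rewrite /index_iota subn0.
rewrite big_mkord [in RHS]big_ltn; last by rewrite addnS ltnS leq_addr.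
rewrite mulrA mulr_sumr mulr_suml; apply: eq_bigr => k _.
rewrite IH; last exact: updN.
rewrite addSnnS; congr (_ * _).
rewrite !prb_prefix_event //; last exact: updN.
rewrite big_ord_recr /= {2}/upd eqxx; congr (_ * _).
by apply: eq_bigr => i _; rewrite /upd ltn_eqF.
Qed.

Lemma prb_coordinates (D : nat -> pred nat) n :
  prU [set u | forall i, (i < n)%N -> D i (coordinate i u)] =
  \prod_(i < n) digit_mass i (D i).
Proof.
have := @prb_prefix_cond D 0 n (fun=> 0%N) (fun _ => ltac:(by [])).
have -> : prefix_event (fun=> 0%N) 0 = unit_interval by apply/predeqP => u; split=> [[]|].
rewrite prb_unit_interval mul1r add0n big_mkord => <-.
set A := [set u | _]; have mA : measurable (A : set (measurableTypeR R)).
  by apply: mset_all => i; apply: mset_impl; apply: measurable_coordinate_pred.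
have mU := measurable_unit_interval.
rewrite (prb_split U mA mU) setIC [X in _ + X](_ : _ = 0) ?addr0 //.
apply/eqP; rewrite eq_le prb_ge0 andbT.
apply: le_trans (_ : prU (~` unit_interval) <= _).
  by apply: prb_le; [apply: measurableI => //; apply: measurableC | exact: measurableC | move=> u []].
by rewrite -setTD prbD // prbT setTI prb_unit_interval subrr.
Qed.

Lemma digit_mass_setT i (D : pred nat) : (forall k, D k) -> digit_mass i D = 1.
Proof. by move=> DT; rewrite /digit_mass (eq_bigl xpredT) // => k; apply: DT. Qed.
End Cells.

(** Element [x] uses digit [pickle x]. The conditions on [L] become conditions on the first [B]
    digits, trivial at digits that belong to no element of [L]. *)
Lemma independent_family (R : realType) (I : countType) (mu : I -> nat -> R) (N : I -> nat) :
  (forall x k, 0 <= mu x k) -> (forall x, \sum_(k < N x) mu x k = 1) -> inhabited I ->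
  exists W : I -> measurableTypeR R -> nat,
    (forall x k, measurable [set u | W x u = k]) /\
    forall (L : seq I) (D : I -> pred nat), uniq L ->
      prb (uniform_prob (@ltr01 R)) [set u | forall x, x \in L -> D x (W x u)] =
      \prod_(x <- L) \sum_(k < N x | D x k) mu x k.
Proof.
move=> mu_ge0 mu_sum [x0].
(* Integers that code no element borrow the law of [x0]; their digits are never constrained. *)
pose idx i := odflt x0 (unpickle i).
have idxK x : idx (pickle x) = x by rewrite /idx pickleK.
pose nu i := mu (idx i); pose M i := N (idx i).
have nu_ge0 i k : 0 <= nu i k by exact: mu_ge0.
have nu_sum i : \sum_(k < M i) nu i k = 1 by exact: mu_sum.
exists (fun x => coordinate nu M (pickle x)); split.
  by move=> x k; apply: (measurable_coordinate nu_ge0 nu_sum).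
move=> L D uL.
pose DL (L' : seq I) i := fun k => if (unpickle i : option I) is Some x then
  (pickle x == i) && (x \in L') ==> D x k else true.
pose B := (\sum_(x <- L) (pickle x).+1)%N.
have pB x : x \in L -> (pickle x < B)%N.
  by move=> xL; rewrite /B (big_rem _ xL) /= leq_addr.
transitivity (prb (uniform_prob (@ltr01 R))
    [set u | forall i, (i < B)%N -> DL L i (coordinate nu M i u)]).
  apply: prb_ext => u; split=> [H i iB|H x xL].
    rewrite /DL; case e : (unpickle i) => [x|//]; apply/implyP => /andP[/eqP <-].
    exact: H.
  by have := H _ (pB _ xL); rewrite /DL pickleK eqxx xL.
rewrite (prb_coordinates nu_ge0 nu_sum).
move: (B) pB => {}B pB; elim: L uL pB => [|x L IH] /= uL pB.
  rewrite big_nil big1 // => i _; apply: (digit_mass_setT nu_sum) => k.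
  by rewrite /DL; case: (unpickle _) => // y; rewrite in_nil andbF.
case/andP: uL => xL uL; have xB : (pickle x < B)%N by apply: pB; rewrite mem_head.
rewrite big_cons -IH //; last by move=> y yL; apply: pB; rewrite inE yL orbT.
rewrite (bigD1 (Ordinal xB)) //= [in RHS](bigD1 (Ordinal xB)) //= mulrA; congr (_ * _).
  rewrite [X in _ * X](digit_mass_setT nu_sum) ?mulr1; last first.
    by move=> k; rewrite /DL pickleK (negbTE xL) andbF.
  rewrite /digit_mass /nu /M idxK; apply: eq_bigl => k.
  by rewrite /DL pickleK eqxx mem_head.
apply: eq_bigr => i ix; rewrite /digit_mass; apply: eq_bigl => k.
rewrite /DL; case e : (unpickle i) => [y|//]; rewrite inE.
case: eqP => //= yi; case: eqP => [yx|//].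
by case/eqP: ix; apply: val_inj; rewrite /= -yi yx.
Qed.

Definition cylinder_set (M : nat) (D : nat -> pred nat) : set (nat -> nat) :=
  [set s | forall j, (j < M)%N -> D j (s j)].

Definition cylinder_sets : set (set (nat -> nat)) :=
  [set C | exists M D, C = cylinder_set M D].

(** The alphabet of the i.i.d. process. Entry 0 of a letter will hold the bit, and entry [g] the
    choice of an excursion to be used if the gap ending there has length [g]; preparing a choice for
    every [g] is what allows letters to be independent of each other. *)
Definition marks := g_sigma_algebraType cylinder_sets.

Lemma cylinder_sets_setI : setI_closed cylinder_sets.
Proof.
move=> _ _ [M1 [D1 ->]] [M2 [D2 ->]].
exists (maxn M1 M2), (fun j k => ((j < M1) ==> D1 j k) && ((j < M2) ==> D2 j k))%N.
apply/predeqP => s; split=> [[h1 h2] j _|H].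
  by apply/andP; split; apply/implyP => jM; [apply: h1 | apply: h2].
by split=> j jM; have := H j; rewrite leq_max jM ?orbT => /(_ isT)/andP[/= h1 h2].
Qed.

Lemma cylinder_sets_setT : cylinder_sets setT.
Proof. by exists 0%N, (fun _ => xpredT); apply/predeqP. Qed.

Lemma measurable_mark j k : measurable ([set s | s j = k] : set marks).
Proof.
apply: sub_sigma_algebra; exists j.+1, (fun i l => (i == j) ==> (l == k)).
apply/predeqP => s; split=> [sj i _|H].
  by apply/implyP => /eqP->; apply/eqP.
by have := H j (ltnSn j); rewrite eqxx => /eqP.
Qed.

Section CylinderUnique.
Variables (d : measure_display) (Omega : measurableType d) (R : realType).
Variable P : probability Omega R.

Lemma measurable_into_marks (Z : Omega -> marks) :
  (forall j k, measurable [set u | Z u j = k]) ->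
  forall A : set marks, measurable A -> measurable [set u | A (Z u)].
Proof.
move=> mZ; apply: (@dynkin_induction _ marks cylinder_sets
  (fun A => measurable [set u | A (Z u)])) => //.
- exact: cylinder_sets_setI.
- exact: mset_prop.
- move=> _ [M [D ->]]; apply: mset_all => j; apply: mset_impl.
  rewrite [X in measurable X](_ : _ = [set u | exists k, D j k /\ Z u j = k]).
    by apply: mset_ex => k; apply: mset_and; [exact: mset_prop | exact: mZ].
  apply/predeqP => u; split=> [h|[k [h e]]]; first by exists (Z u j).
  by rewrite /mkset e.
- by move=> A _ mA; apply: mset_not.
move=> F _ _ mF.
rewrite [X in measurable X](_ : _ = [set u | exists k, F k (Z u)]); first exact: mset_ex.
by apply/predeqP => u; split=> [[k _ Fk]|[k Fk]]; exists k.
Qed.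

(** A pi-lambda argument with weights, to be used twice: unit weights and full events give equal
    marginals, while [E2 = setT] and [c2] the probability of [E1] give independence. *)
Lemma cylinder_unique (Z1 Z2 : Omega -> marks) (E1 E2 : set Omega) (c1 c2 : R) :
  (forall j k, measurable [set u | Z1 u j = k]) ->
  (forall j k, measurable [set u | Z2 u j = k]) ->
  measurable E1 -> measurable E2 -> 0 <= c1 -> 0 <= c2 ->
  (forall C, cylinder_sets C -> c1 * prb P ([set u | C (Z1 u)] `&` E1) =
                                c2 * prb P ([set u | C (Z2 u)] `&` E2)) ->
  forall A : set marks, measurable A ->
    c1 * prb P ([set u | A (Z1 u)] `&` E1) = c2 * prb P ([set u | A (Z2 u)] `&` E2).
Proof.
move=> m1 m2 mE1 mE2 c10 c20 HC.
have mZ1 := measurable_into_marks m1; have mZ2 := measurable_into_marks m2.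
apply: (@dynkin_induction _ marks cylinder_sets
  (fun A => c1 * prb P ([set u | A (Z1 u)] `&` E1) =
            c2 * prb P ([set u | A (Z2 u)] `&` E2))) => //.
- exact: cylinder_sets_setI.
- exact: HC cylinder_sets_setT.
- move=> A mA HA; have HT := HC _ cylinder_sets_setT.
  have compl (Z : Omega -> marks) E : measurable [set u | A (Z u)] -> measurable E ->
      prb P ([set u | (~` A) (Z u)] `&` E) =
      prb P ([set u | [set: nat -> nat] (Z u)] `&` E) - prb P ([set u | A (Z u)] `&` E).
    move=> mA' mE; rewrite (_ : [set u | [set: nat -> nat] (Z u)] = setT) ?setTI //.
    by rewrite (setIC _ E) (setIC [set u | A (Z u)]) -prbD // setDE.
  by rewrite !compl ?mulrBr; [rewrite HT HA | exact: mZ2 | | exact: mZ1 |].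
move=> F mF tF HF.
have union (Z : Omega -> marks) E c : (forall k, measurable [set u | F k (Z u)]) ->
    measurable E -> 0 <= c ->
    (c * prb P ([set u | (\bigcup_k F k) (Z u)] `&` E))%:E =
    (\sum_(k <oo) (c * prb P ([set u | F k (Z u)] `&` E))%:E)%E.
  move=> mFk mE c0.
  have mI k : measurable ([set u | F k (Z u)] `&` E) by exact: measurableI.
  have UE : [set u | (\bigcup_k F k) (Z u)] `&` E = \bigcup_k ([set u | F k (Z u)] `&` E).
    apply/predeqP => u; split=> [[[k _ Fk] Eu]|[k _ [Fk Eu]]]; first by exists k.
    by split=> //; exists k.
  have mU : measurable (\bigcup_k ([set u | F k (Z u)] `&` E)) by exact: bigcup_measurable.
  rewrite EFinM UE -prbE // measure_semi_bigcup //.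
    rewrite -nneseriesZl; last by move=> k _; exact: measure_ge0.
    by apply: eq_eseriesr => k _; rewrite EFinM; congr (_ * _)%E; apply: prbE.
  apply/trivIsetP => i j _ _ ij; rewrite -subset0 => u [[Fi _] [Fj _]].
  by move/trivIsetP: tF => /(_ i j I I ij) FF; have : (F i `&` F j) (Z u) by []; rewrite FF.
apply: EFin_inj; rewrite !union //; first by apply: eq_eseriesr => k _; rewrite HF.
- by move=> k; exact: mZ2.
- by move=> k; exact: mZ1.
Qed.
End CylinderUnique.

Section IidMarks.
Variables (R : realType) (mu : nat -> nat -> R) (N : nat -> nat).
Hypothesis mu_ge0 : forall j k, 0 <= mu j k.
Hypothesis mu_sum : forall j, \sum_(k < N j) mu j k = 1.

Definition mark_mass (j : nat) (D : pred nat) : R := \sum_(k < N j | D k) mu j k.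

Lemma iid_marks : exists (d : measure_display) (Omega : measurableType d)
  (P : probability Omega R) (Y : int -> Omega -> marks),
  iid_process P Y /\
  forall M D, prb P [set u | cylinder_set M D (Y 0 u)] = \prod_(j < M) mark_mass j (D j).
Proof.
pose I := (int * nat)%type.
have [W [mW HW]] := @independent_family R I (fun x => mu x.2) (fun x => N x.2)
  (fun x => mu_ge0 x.2) (fun x => mu_sum x.2) (inhabits (0, 0%N)).
pose P : probability (measurableTypeR R) R := uniform_prob (@ltr01 R).
pose Y (n : int) (u : measurableTypeR R) : marks := fun j => W (n, j) u.
have mYj n j k : measurable [set u | Y n u j = k] by exact: mW.
have mY n := measurable_into_marks (mYj n).
have cylE l (M : int -> nat) (D : int -> nat -> pred nat) : uniq l ->
    prb P [set u | forall n, n \in l -> cylinder_set (M n) (D n) (Y n u)] =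
    \prod_(n <- l) \prod_(j < M n) mark_mass j (D n j).
  move=> ul; pose L := [seq (n, j) | n <- l, j <- iota 0 (M n)].
  have uL : uniq L.
    apply: allpairs_uniq_dep => //; first by move=> n _; apply: iota_uniq.
    by move=> [n j] [n' j'] _ _ /= [-> ->].
  have := HW L (fun x => D x.1 x.2) uL; rewrite big_allpairs_dep /=.
  under [in X in _ = X -> _]eq_bigr => n _.
    rewrite (_ : iota 0 (M n) = index_iota 0 (M n)) ?big_mkord; last by rewrite /index_iota subn0.
    over.
  move=> <-; apply: prb_ext => u; split=> [H x|H n nl j jM].
    by move=> /allpairsPdep[n [j [nl]]]; rewrite mem_iota => jM ->; apply: H.
  apply: (H (n, j)); apply/allpairsPdep; exists n, j; split=> //.
  by rewrite mem_iota.
have cyl1 n M D : prb P [set u | cylinder_set M D (Y n u)] = \prod_(j < M) mark_mass j (D j).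
  have := cylE [:: n] (fun=> M) (fun=> D) isT; rewrite big_seq1 => <-.
  apply: prb_ext => u.
  by split=> [H k|H]; [rewrite inE => /eqP-> | apply: H; rewrite mem_head].
(* The sets on [l1] are arbitrary and those on [l2] still cylinders; the induction frees one letter
   at a time. *)
have indep l1 l2 (A C : int -> set marks) : uniq (l1 ++ l2) ->
    (forall n, measurable (A n)) -> (forall n, cylinder_sets (C n)) ->
    prb P ([set u | forall n, n \in l1 -> A n (Y n u)] `&`
           [set u | forall n, n \in l2 -> C n (Y n u)]) =
    \prod_(n <- l1) prb P [set u | A n (Y n u)] * \prod_(n <- l2) prb P [set u | C n (Y n u)].
  have mlist l (B : int -> set marks) : (forall n, measurable (B n)) ->
      measurable [set u | forall n, n \in l -> B n (Y n u)].
    move=> mB; apply: (@mset_all _ _ int (fun n u => n \in l -> B n (Y n u))) => n.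
    by apply: mset_impl; apply: mY.
  move=> + mA; elim: l1 l2 C => [|n l1 IH] l2 C ul HC.
    have /choice[M HM] := HC; have /choice[D HD] := HM.
    rewrite big_nil mul1r (_ : [set u | _] = setT) ?setTI; last by apply/predeqP.
    rewrite (prb_ext P (B := [set u | forall n, n \in l2 -> cylinder_set (M n) (D n) (Y n u)])).
      by rewrite cylE //; apply: eq_bigr => n _; rewrite HD cyl1.
    by move=> u; split=> H n nl; [rewrite -HD | rewrite HD]; apply: H.
  have mC k : measurable (C k : set marks) by apply: sub_sigma_algebra.
  pose E := [set u | forall k, k \in l1 -> A k (Y k u)] `&`
            [set u | forall k, k \in l2 -> C k (Y k u)].
  have mE : measurable E by apply: measurableI; apply: mlist.
  have [nl1 nl2] : n \notin l1 /\ n \notin l2.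
    by move: ul; rewrite /= mem_cat negb_or => /andP[/andP[]].
  have ul' : uniq (l1 ++ l2) by case/andP: ul.
  have := @cylinder_unique _ _ _ P (Y n) (Y n) E setT 1 (prb P E) (mYj n) (mYj n) mE
    measurableT ler01 (prb_ge0 P E).
  have onC B : cylinder_sets B -> 1 * prb P ([set u | B (Y n u)] `&` E) =
      prb P E * prb P ([set u | B (Y n u)] `&` setT).
    move=> cB; pose C' k := if k == n then B else C k.
    have uC' : uniq (l1 ++ n :: l2).
      by rewrite cat_uniq /= nl2 negb_or nl1 -andbA /= -cat_uniq.
    have := IH (n :: l2) C' uC' ltac:(by move=> k; rewrite /C'; case: eqP).
    rewrite (prb_ext P (B := [set u | B (Y n u)] `&` E)); last first.
      move=> u; split.
        move=> [H1 H2]; split; first by have := H2 n (mem_head _ _); rewrite /C' eqxx.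
        split=> // k kl2; have := H2 k; rewrite inE kl2 orbT /C' => /(_ isT).
        by case: eqP => // kn; rewrite kn (negbTE nl2) in kl2.
      move=> [Bn [H1 H2]]; split=> // k; rewrite inE /C'; case: eqP => [->//|_] /= kl2.
      exact: H2.
    rewrite mul1r => ->; rewrite setIT IH // big_cons {1}/C' eqxx.
    rewrite mulrCA [RHS]mulrC; congr (_ * (_ * _)).
    apply: eq_big_seq => k kl2; rewrite /C'; case: eqP => // kn.
    by rewrite kn (negbTE nl2) in kl2.
  move=> /(_ onC (A n) (mA n)); rewrite mul1r setIT => h.
  rewrite big_cons -mulrA -IH // mulrC -h; apply: prb_ext => u; split.
    move=> [H1 H2]; split; first by apply: H1; rewrite mem_head.
    by split=> // k kl1; apply: H1; rewrite inE kl1 orbT.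
  move=> [An [H1 H2]]; split=> // k; rewrite inE => /orP[/eqP->//|]; exact: H1.
have same n A : measurable A -> prb P [set u | A (Y n u)] = prb P [set u | A (Y 0 u)].
  move=> mA; have := @cylinder_unique _ _ _ P (Y n) (Y 0) setT setT 1 1 (mYj n) (mYj 0)
    measurableT measurableT ler01 ler01.
  have onC B : cylinder_sets B ->
      1 * prb P ([set u | B (Y n u)] `&` setT) = 1 * prb P ([set u | B (Y 0 u)] `&` setT).
    by move=> [M [D ->]]; rewrite !mul1r !setIT !cyl1.
  by move=> /(_ onC A mA); rewrite !mul1r !setIT.
exists _, (measurableTypeR R), P, Y; split; last by move=> M D; apply: cyl1.
split; [|split].
- by move=> n _ A mA; rewrite setTI; apply: mY.
- by move=> n A mA; rewrite !prbE; [congr EFin; apply: same | exact: mY | exact: mY].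
move=> ns A uns mA.
have mI : measurable [set u | forall n, n \in ns -> A n (Y n u)].
  apply: (@mset_all _ _ int (fun n u => n \in ns -> A n (Y n u))) => n.
  by apply: mset_impl; apply: mY.
have -> : \bigcap_(n in [set` ns]) (Y n @^-1` A n) =
    [set u | forall n, n \in ns -> A n (Y n u)].
  by apply/predeqP => u; split=> H n; apply: H.
rewrite prbE //.
have := indep ns [::] A (fun=> setT) ltac:(by rewrite cats0) mA (fun=> cylinder_sets_setT).
rewrite big_nil mulr1 setIC (_ : [set u | _] = setT) ?setTI; last by apply/predeqP.
move=> ->; rewrite -prodEFin; apply: eq_bigr => n _.
by rewrite -prbE //; apply: mY.
Qed.
End IidMarks.

(** * Law of the bit and of the excursion choices *)

Section MarkLaw.
Variables (R : realType) (p : nat -> R) (m : nat) (dl : R).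
Local Notation a := (dl * (1 - dl) ^+ m.-1).
Hypothesis m0 : (0 < m)%N.
Hypothesis dl01 : 0 < dl < 1.
Hypothesis spos : forall t, 0 < gap_tail m a t.
Hypothesis p_ge0 : forall t, 0 <= p t.
Hypothesis w_ge0 : forall n, 0 <= unstopped p m a n.

Definition mark_bit (x : marks) : bool := x 0%N == 1%N.

(* The default [nseq g 1] is one more composition of [g]; indices out of range have probability 0. *)
Definition mark_word (g : nat) (x : marks) : seq nat :=
  nth (nseq g 1%N) (compositions g) (x g).

(** Entry 0 is a bit and entries from [m] on choose a composition; in between, where no gap length
    lies, the entry has the single value 0. *)
Definition mark_range (j : nat) : nat :=
  if j == 0%N then 2 else if (m <= j)%N then size (compositions j) else 1.

Definition mark_law (j k : nat) : R :=
  if j == 0%N then (if k == 1%N then dl else 1 - dl)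
  else if (m <= j)%N then exc_wt p m a (nth [::] (compositions j) k) / gap_law m a j
  else 1.

Let a0 : 0 < a.
Proof. by case/andP: dl01 => h1 h2; rewrite mulr_gt0 // exprn_gt0 // subr_gt0. Qed.

Let q_ge0 n : 0 <= gap_law m a n.
Proof. exact: gap_law_ge0. Qed.

Let q_gt0 n : (m <= n)%N -> 0 < gap_law m a n.
Proof. by move=> mn; rewrite /gap_law mn mulr_gt0. Qed.

Lemma mark_law_ge0 j k : 0 <= mark_law j k.
Proof.
case/andP: dl01 => d0 d1; rewrite /mark_law; case: ifP => _.
  by case: ifP => _; [exact: ltW | rewrite subr_ge0 ltW].
by case: ifP => _ //; rewrite divr_ge0 // exc_wt_ge0.
Qed.

Lemma sum_mark_law_word g (D : pred (seq nat)) : (m <= g)%N ->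
  \sum_(k < mark_range g | D (nth [::] (compositions g) k)) mark_law g k =
  \sum_(e <- compositions g | D e) exc_wt p m a e / gap_law m a g.
Proof.
move=> mg; have g0 : (g == 0%N) = false by apply/eqP; lia.
by rewrite /mark_range /mark_law g0 mg [RHS](big_nth [::]) big_mkord.
Qed.

Lemma mark_law_sum j : \sum_(k < mark_range j) mark_law j k = 1.
Proof.
have [->|j0] := eqVneq j 0%N.
  by rewrite /mark_range /mark_law /= !big_ord_recl big_ord0 /= addr0 subrK.
have [mj|jm] := leqP m j.
  rewrite (sum_mark_law_word xpredT mj) -mulr_suml sum_exc_wt ?divff ?gt_eqF ?q_gt0 //.
  by rewrite lt0n.
by rewrite /mark_range /mark_law (negbTE j0) leqNgt jm /= big_ord_recl big_ord0 addr0.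
Qed.

Lemma mark_word_comp g x : mark_word g x \in compositions g.
Proof.
have [h|h] := ltnP (x g) (size (compositions g)); first exact: mem_nth.
rewrite /mark_word nth_default // mem_compositions sumn_nseq mul1n eqxx andbT.
by apply/allP => t /nseqP[->].
Qed.

Lemma measurable_mark_bit : measurable [set x | mark_bit x].
Proof.
rewrite [X in measurable X](_ : _ = [set x : marks | x 0%N = 1%N]).
  exact: measurable_mark.
by apply/predeqP => x; split=> /eqP.
Qed.

Lemma measurable_mark_word g e : measurable [set x | mark_word g x = e].
Proof.
rewrite [X in measurable X](_ : _ = [set x : marks | exists k,
    nth (nseq g 1%N) (compositions g) k = e /\ x g = k]).
  apply: mset_ex => k; apply: mset_and; first exact: mset_prop.
  exact: measurable_mark.
by apply/predeqP => x; split=> [h|[k [h1 h2]]]; [exists (x g) | rewrite /mkset /mark_word h2].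
Qed.

Variables (d : measure_display) (Omega : measurableType d).
Variables (P : probability Omega R) (Y : int -> Omega -> marks).
Hypothesis HY : forall M D, prb P [set u | cylinder_set M D (Y 0 u)] =
  \prod_(j < M) mark_mass mark_law mark_range j (D j).

Let mass_bit : mark_mass mark_law mark_range 0 (pred1 1%N) = dl.
Proof.
rewrite /mark_mass /mark_range /mark_law /= big_mkcond !big_ord_recl big_ord0 /=.
by rewrite add0r addr0.
Qed.

Lemma prb_mark_bit : prb P [set u | mark_bit (Y 0 u)] = dl.
Proof.
rewrite -mass_bit; have := HY 1 (fun=> pred1 1%N); rewrite big_ord1 => <-.
by apply: prb_ext => u; split=> [H [|]//|]; apply.
Qed.

Lemma prb_mark_word g e : (m <= g)%N -> e \in compositions g ->
  prb P [set u | mark_bit (Y 0 u) /\ mark_word g (Y 0 u) = e] =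
  dl * (exc_wt p m a e / gap_law m a g).
Proof.
case: g => [|g] mg eg; first by rewrite leqNgt m0 in mg.
pose D j : pred nat := fun k => if j == 0%N then k == 1%N else
  (j == g.+1) ==> (nth (nseq g.+1 1%N) (compositions g.+1) k == e).
have := HY g.+2 D.
have -> : prb P [set u | cylinder_set g.+2 D (Y 0 u)] =
    prb P [set u | mark_bit (Y 0 u) /\ mark_word g.+1 (Y 0 u) = e].
  apply: prb_ext => u; split=> [H|[hb hw] j _].
    split; first exact: (H 0%N).
    by have := H g.+1 (ltnSn g.+1); rewrite /D /= eqxx => /eqP.
  rewrite /D; case: eqP => [->//|_]; apply/implyP => /eqP->.
  exact/eqP.
move=> ->.
rewrite big_ord_recl big_ord_recr /= big1 ?mul1r.
  congr (_ * _); first by rewrite -[RHS]mass_bit.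
  rewrite /mark_mass.
  rewrite (eq_bigl (fun k : 'I_(mark_range g.+1) => pred1 e (nth [::] (compositions g.+1) k))).
    rewrite (sum_mark_law_word (pred1 e) mg) -big_filter.
    by rewrite filter_pred1_uniq ?compositions_uniq // big_seq1.
  move=> k; rewrite /D eqxx /=; congr (_ == _); apply: set_nth_default.
  by have := ltn_ord k; rewrite {2}/mark_range mg.
move=> i _; rewrite /mark_mass (eq_bigl xpredT) ?mark_law_sum // => k.
rewrite /D /= (_ : (bump 0 i == g.+1)%N = false) //.
by rewrite /bump /= add1n eqSS ltn_eqF.
Qed.
End MarkLaw.

(** Stationarity makes the density of ones the same at every site. Runs of zeros vanish in the limit
    by continuity from above, since almost surely a 1 occurs to the right of every site. *)
Lemma stationary_renewal_like d (Omega : measurableType d) (R : realType)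
    (P : probability Omega R) (X : int -> Omega -> bool) (p : nat -> R) :
  stationary_renewal_process P X p -> renewal_like p P X (prb P [set w | X 0 w]).
Proof.
move=> [_ [stat [mX [ae gaps]]]]; split=> //.
  move=> n ts ts0; rewrite /prb gaps // prodEFin.
  have -> : P (first_one_at X n 0) = P [set w | X 0 w].
    have := stat n [:: (0, true)]; rewrite /cyl /=.
    have -> : [set w | (X (0 + n) w == true) && true] = first_one_at X n 0.
      apply/predeqP => w; rewrite /first_one_at /= add0r addr0 andbT.
      by split=> [/eqP|[_ ->]].
    by move=> ->; congr (P _); apply/predeqP => w; rewrite /= andbT; split=> /eqP.
  by rewrite (prbE P (mX 0)).
move=> n.
have mW N : measurable (word_event X n (nseq N false)) by exact: measurable_word_event.
have mI : measurable (\bigcap_N word_event X n (nseq N false)).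
  by apply: bigcapT_measurable.
have cv : P (word_event X n (nseq N false)) @[N --> \oo] -->
    P (\bigcap_N word_event X n (nseq N false)).
  apply: nonincreasing_cvg_mu => //; first by rewrite ltey_eq fin_num_measure.
  move=> M N MN; apply/subsetPset => w H i; rewrite size_nseq => iM.
  have iN : (i < N)%N by exact: leq_trans MN.
  by have := H i; rewrite size_nseq !nth_nseq iM iN => /(_ isT).
have z : P (\bigcap_N word_event X n (nseq N false)) = 0%E.
  apply: measure_negligible => //; apply: negligibleS ae => w H /= /(_ (absz n)).
  move=> [[k [nk Xk]] _].
  have := H (absz (k - n)).+1 I (absz (k - n)); rewrite size_nseq => /(_ (ltnSn _)).
  rewrite nth_nseq ltnSn (_ : n + _ = k) ?Xk //; lia.
rewrite z in cv; exact: (fine_cvg cv).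
Qed.

Theorem theorem2 (R : realType) (d : measure_display) (Omega : measurableType d)
  (P : probability Omega R) (X : int -> Omega -> bool) (p : nat -> R) :
  stationary_renewal_process P X p ->
  non_lattice p ->
  exp_tails p ->
  finitary_factor_of_iid_exp_tails P X.
Proof.
move=> rX nl et; have [jd _] := rX; have [p0 [p_ge0 _]] := jd.
have [m [dl [m0 dl01 spos w_ge0]]] := embedding jd nl et.
pose a := dl * (1 - dl) ^+ m.-1.
have p_le1 M : \sum_(t < M) p t.+1 <= 1.
  have := jump_tail_ge0 M jd; rewrite /jump_tail big_ord_recl p0 add0r subr_ge0.
  exact.
have [d2 [T2 [P2 [Y [HY cylY]]]]] := iid_marks
  (mark_law_ge0 dl01 spos p_ge0 w_ge0) (mark_law_sum m0 dl01 spos w_ge0).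
have mbit := measurable_mark_bit; have mword := measurable_mark_word.
have Pbit := prb_mark_bit cylY.
have Pword := prb_mark_word m0 dl01 spos w_ge0 cylY.
pose X' n w := coded m mark_bit mark_word (fun k => Y k w) n.
have [c rX'] := renewal_like_coded HY m0 dl01 mbit mword Pbit spos p_ge0 p_le1
  w_ge0 mark_word_comp Pword.
exists d2, T2, P2, _, marks, Y, (code m mark_bit mark_word), (code_radius m mark_bit).
split=> //; split; first exact: coding_window_code.
split.
  move=> cs; have rXX := stationary_renewal_like rX.
  have [mX' _ _] := rX'; have [mX _ _] := rXX.
  rewrite [LHS](prbE P2 (measurable_cyl cs mX')) [RHS](prbE P (measurable_cyl cs mX)).
  by rewrite (renewal_like_cyl rX' rXX).
split; first exact: (code_radius_finite HY m0 dl01 mbit Pbit spos).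
have a0 : 0 < a by case/andP: dl01 => h1 h2; rewrite mulr_gt0 // exprn_gt0 // subr_gt0.
have a1 : a < 1 by exact: gap_tail_lt1 m0 a0 spos.
have b0 : 0 < 1 - a by rewrite subr_gt0.
(* The shift by [m] in the bound [2 * (1 - a) ^+ (r - m)] goes into the constant, and [- ln (1 - a)]
   is the rate. *)
exists (2 / (1 - a) ^+ m), (- ln (1 - a)); split; [|split].
- by rewrite divr_gt0 // exprn_gt0.
- by rewrite oppr_gt0 ln_lt0 // b0 gtrBl.
move=> r r0; rewrite prbE; last exact: (measurable_radius_ge HY m mbit).
rewrite lee_fin; apply: le_trans (code_radius_tail HY m0 dl01 mbit Pbit spos r0) _.
rewrite -/a opprK expRM_natr lnK ?posrE // mulrAC -mulrA ler_wpM2l //.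
(* Truncated subtraction still gives [r <= r - m + m], and the base [1 - a] is at most 1. *)
rewrite ler_pdivlMr ?exprn_gt0 // -exprD.
by apply: ler_wiXn2l; [exact: ltW | rewrite gerBl ltW | lia].
Qed.
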